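(* The category of $(0,3)$-bimodules (in a symmetric monoidal category $\mathcal E$) is isomorphic to the category of covariant presheaves over $\Omega_p$ (i.e. functors $\Omega_p\to\mathcal E$).
   Context: **$(0,3)$-bimodules.** Let $I_3$ be the set of isomorphism classes of planar rooted trees (vertices may have any number $\ge0$ of inputs; the free living edge, with no vertex, is included). Let $B_3$ be the set of operations of the polynomial monad $\mathbf{Id}^{+3}$ (threefold Baez–Dolan plus construction of the identity monad on $\mathrm{Set}$): isomorphism classes of rooted trees $b$ whose edges are decorated by natural numbers and vertices by elements of $I_3$, such that if a vertex is decorated by a planar tree $S$, its outgoing edge is decorated by the number of leaves of $S$ and its incoming edges are in bijection with the vertices of $S$, the edge corresponding to a vertex $w$ of $S$ being decorated by the number of inputs of $w$ (free living edges decorated by $k\in\mathbb N$ are allowed). For a vertex $v$ of $b$, $s(v)\in I_3$ is its decoration; $t(b)\in I_3$ is the planar tree obtained by inserting, for each inner edge of $b$, the tree decorating the vertex above into the corresponding vertex of the tree decorating the vertex below. $B_{0,3}$ is the set of $b\in B_3$ with one distinguished white vertex $v$, such that the other (black) vertices are not unary and no two of them are adjacent. A $(0,3)$-bimodule in $\mathcal E$ is a collection $(A_T)_{T\in I_3}$ of objects with, for all $(b,v)\in B_{0,3}$, a map $A_{s(v)}\to A_{t(b)}$, satisfying associativity and unitality, where the composite of operations inserts one tree into the white vertex of the other, then contracts all edges between two black vertices (inserting decorations) and removes all unary black vertices. (This is the polynomial monad $\mathbf{Bimod}_{0,3}$, which is a small category.) **$\Omega_p$.** The planar dendroidal category: objects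 are isomorphism classes of planar rooted trees; morphisms are generated, under the usual dendroidal relations, by inner faces $\partial_e:T/e\to T$ (contraction of an internal edge $e$), outer faces $\partial_v:T/v\to T$ (removal of a vertex $v$, possibly the root vertex, with exactly one inner edge attached to it, together with the outer edges at $v$) and degeneracies $\sigma_v:T\to T\backslash v$ (removal of a unary vertex $v$, merging its two incident edges).
   Formalization: The outer faces of Ω_p also include the n+1 maps from the free living edge to each corolla with n inputs (one per edge), as is standard; with only the outer faces listed (a vertex with exactly one inner edge attached) the free edge has no outgoing maps and the claim fails. *)

(* Defs.v *)
From mathcomp Require Import all_boot.
From Stdlib Require Import FunctionalExtensionality PropExtensionality.
From Stdlib Require Import ProofIrrelevance.

Set Implicit Arguments.
Unset Strict Implicit.
Unset Printing Implicit Defensive.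

(** * Categories *)

Record category := Category {
  Ob :> Type;
  Hom : Ob -> Ob -> Type;
  idm : forall a, Hom a a;
  compm : forall a b c, Hom b c -> Hom a b -> Hom a c;
  comp1m : forall a b (f : Hom a b), compm (idm b) f = f;
  compm1 : forall a b (f : Hom a b), compm f (idm a) = f;
  compA : forall a b c d (h : Hom c d) (g : Hom b c) (f : Hom a b),
    compm h (compm g f) = compm (compm h g) f }.

Arguments Hom {c} _ _ : rename.
Arguments idm {c} a : rename.
Arguments compm {c a b c0} _ _ : rename.

Declare Scope category_scope.
Notation "g ∘ f" := (compm g f) (at level 40, left associativity)
  : category_scope.
Local Open Scope category_scope.

Definition is_iso (C : category) (a b : C) (f : Hom a b) : Prop :=
  exists g : Hom b a, g ∘ f = idm a /\ f ∘ g = idm b.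

Record functor (C D : category) := Functor {
  fob :> C -> D;
  fhom : forall a b, Hom a b -> Hom (fob a) (fob b);
  fhom1 : forall a, fhom (idm a) = idm (fob a);
  fhomM : forall a b c (g : Hom b c) (f : Hom a b),
    fhom (g ∘ f) = fhom g ∘ fhom f }.

Arguments fhom {C D} f [a b] _ : rename.

Definition functor_id (C : category) : functor C C :=
  @Functor C C id (fun a b f => f) (fun=> erefl) (fun _ _ _ _ _ => erefl).

Lemma functor_comp1 (C D E : category) (G : functor D E) (F : functor C D) a :
  fhom G (fhom F (idm a)) = idm (G (F a)).
Proof. by rewrite !fhom1. Qed.

Lemma functor_compM (C D E : category) (G : functor D E) (F : functor C D)
    (a b c : C) (g : Hom b c) (f : Hom a b) :
  fhom G (fhom F (g ∘ f)) = fhom G (fhom F g) ∘ fhom G (fhom F f).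
Proof. by rewrite !fhomM. Qed.

Definition functor_comp (C D E : category) (G : functor D E) (F : functor C D) :
    functor C E :=
  @Functor C E (fun a => G (F a)) (fun a b f => fhom G (fhom F f))
    (functor_comp1 G F) (functor_compM G F).

(* Isomorphism (not mere equivalence) of categories. *)
Definition isomorphic (C D : category) : Prop :=
  exists (F : functor C D) (G : functor D C),
    functor_comp G F = functor_id C /\ functor_comp F G = functor_id D.

Record nat_trans (C D : category) (F G : functor C D) := NatTrans {
  ncomp :> forall a, Hom (F a) (G a);
  nnat : forall a b (f : Hom a b), ncomp b ∘ fhom F f = fhom G f ∘ ncomp a }.

Lemma nat_trans_eq (C D : category) (F G : functor C D) (s t : nat_trans F G) :
  (forall a, s a = t a) -> s = t.
Proof.
case: s t => [s sP] [t tP] /= st.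
have E : s = t by apply: functional_extensionality_dep.
by case: t / E tP st => tP _; congr NatTrans; apply: proof_irrelevance.
Qed.

Lemma nat_id_nat (C D : category) (F : functor C D) (a b : C) (f : Hom a b) :
  idm (F b) ∘ fhom F f = fhom F f ∘ idm (F a).
Proof. by rewrite comp1m compm1. Qed.

Definition nat_id (C D : category) (F : functor C D) : nat_trans F F :=
  NatTrans (@nat_id_nat C D F).

Lemma nat_comp_nat (C D : category) (F G H : functor C D)
    (t : nat_trans G H) (s : nat_trans F G) (a b : C) (f : Hom a b) :
  (t b ∘ s b) ∘ fhom F f = fhom H f ∘ (t a ∘ s a).
Proof. by rewrite -compA nnat compA nnat compA. Qed.

Definition nat_comp (C D : category) (F G H : functor C D)
    (t : nat_trans G H) (s : nat_trans F G) : nat_trans F H :=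
  NatTrans (nat_comp_nat t s).

Definition functor_category (C D : category) : category.
Proof.
refine (@Category (functor C D) (@nat_trans C D) (@nat_id C D)
  (@nat_comp C D) _ _ _) => *; apply: nat_trans_eq => a /=.
- exact: comp1m.
- exact: compm1.
- exact: compA.
Defined.

Record symmetric_monoidal_category := SymmetricMonoidalCategory {
  smc_cat :> category;
  tens : smc_cat -> smc_cat -> smc_cat;
  tensm : forall a b a' b' : smc_cat,
    Hom a b -> Hom a' b' -> Hom (tens a a') (tens b b');
  munit : smc_cat;
  assoc : forall a b c : smc_cat,
    Hom (tens (tens a b) c) (tens a (tens b c));
  lunit : forall a : smc_cat, Hom (tens munit a) a;
  runit : forall a : smc_cat, Hom (tens a munit) a;
  braid : forall a b : smc_cat, Hom (tens a b) (tens b a);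
  tensm1 : forall a b : smc_cat, tensm (idm a) (idm b) = idm (tens a b);
  tensmM : forall (a b c a' b' c' : smc_cat) (g : Hom b c) (f : Hom a b)
    (g' : Hom b' c') (f' : Hom a' b'),
    tensm (g ∘ f) (g' ∘ f') = tensm g g' ∘ tensm f f';
  assoc_iso : forall a b c : smc_cat, is_iso (assoc a b c);
  lunit_iso : forall a : smc_cat, is_iso (lunit a);
  runit_iso : forall a : smc_cat, is_iso (runit a);
  assoc_nat : forall (a b c a' b' c' : smc_cat) (f : Hom a a') (g : Hom b b')
    (h : Hom c c'),
    assoc a' b' c' ∘ tensm (tensm f g) h = tensm f (tensm g h) ∘ assoc a b c;
  lunit_nat : forall (a b : smc_cat) (f : Hom a b),
    lunit b ∘ tensm (idm munit) f = f ∘ lunit a;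
  runit_nat : forall (a b : smc_cat) (f : Hom a b),
    runit b ∘ tensm f (idm munit) = f ∘ runit a;
  braid_nat : forall (a b a' b' : smc_cat) (f : Hom a a') (g : Hom b b'),
    braid a' b' ∘ tensm f g = tensm g f ∘ braid a b;
  pentagon : forall a b c d : smc_cat,
    assoc a b (tens c d) ∘ assoc (tens a b) c d =
    tensm (idm a) (assoc b c d) ∘ assoc a (tens b c) d
      ∘ tensm (assoc a b c) (idm d);
  triangle : forall a b : smc_cat,
    tensm (idm a) (lunit b) ∘ assoc a munit b = tensm (runit a) (idm b);
  hexagon : forall a b c : smc_cat,
    assoc b c a ∘ braid a (tens b c) ∘ assoc a b c =
    tensm (idm b) (braid a c) ∘ assoc b a c ∘ tensm (braid a b) (idm c);
  braidK : forall a b : smc_cat, braid b a ∘ braid a b = idm (tens a b) }.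

(** * Planar trees *)

(* Planar rooted trees with vertices labelled in [A].  [Eta] is the free living
   edge; [Node a ts] has a root vertex labelled [a] whose inputs carry, from
   left to right, the trees [ts].  Planar trees have no nontrivial
   automorphisms, so the terms are the isomorphism classes. *)
Inductive tree (A : Type) : Type :=
| Eta
| Node of A & seq (tree A).

Arguments Eta {A}.

(* The set I_3. *)
Definition ptree := tree unit.

Definition tmap (A B : Type) (f : A -> B) : tree A -> tree B :=
  fix tmap t :=
    match t with Eta => Eta | Node a ts => Node (f a) (map tmap ts) end.

Definition tshape (A : Type) : tree A -> ptree := tmap (fun=> tt).

Fixpoint labels (A : Type) (t : tree A) : seq A :=
  match t with Eta => [::] | Node a ts => a :: flatten (map (@labels A) ts) end.

Definition nvertices (A : Type) (t : tree A) : nat := size (labels t).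

Fixpoint nleaves (A : Type) (t : tree A) : nat :=
  match t with Eta => 1 | Node _ ts => sumn (map (@nleaves A) ts) end.

(* [p a n] holds at every vertex, with label [a] and [n] inputs. *)
Definition all_vertices (A : Type) (p : A -> nat -> bool) : tree A -> bool :=
  fix all_vertices t :=
    match t with
    | Eta => true
    | Node a ts => p a (size ts) && all all_vertices ts
    end.

Definition corolla (A : Type) (n : nat) (a : A) : tree A := Node a (nseq n Eta).

(* The trees [us] are grafted onto the leaves of [t], from left to right. *)
Fixpoint graft (A : Type) (t : tree A) (us : seq (tree A)) : tree A :=
  match t with
  | Eta => head Eta us
  | Node a ts =>
      Node a ((fix graft_seq ts us :=
        match ts with
        | [::] => [::]
        | t :: ts => graft t (take (nleaves t) us)
                       :: graft_seq ts (drop (nleaves t) us)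
        end) ts us)
  end.

(* Every vertex of [t] is replaced by the tree which labels it. *)
Fixpoint tjoin (A : Type) (t : tree (tree A)) : tree A :=
  match t with Eta => Eta | Node u ts => graft u (map (@tjoin A) ts) end.

(** * The operations of the threefold plus construction *)

(* A term of [op X] is a tree b as in the definition of B_3 with two colours of
   vertices and with leaves labelled in [X].  [Stem k x] is the free living edge
   decorated by [k].  In [Vertex white D], the decoration of the root vertex is
   [tshape D] and each vertex w of [D] is labelled by the part of b lying over
   the incoming edge which corresponds to w; this is the bijection between
   incoming edges and vertices of the decoration.  Such trees are rigid, so the
   terms are the isomorphism classes. *)
Inductive op (X : Type) : Type :=
| Stem of nat & X
| Vertex of bool & tree (op X).

(* The decoration of the root edge. *)
Definition root_edge (X : Type) (b : op X) : nat :=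
  match b with Stem k _ => k | Vertex _ D => nleaves D end.

(* The edge corresponding to a vertex w of a decoration is decorated by the
   number of inputs of w. *)
Fixpoint well_decorated (X : Type) (b : op X) : bool :=
  match b with
  | Stem _ _ => true
  | Vertex _ D =>
      all_vertices (fun c n => (root_edge c == n) && well_decorated c) D
  end.

(* The planar tree t(b); its vertices correspond to the leaves of b, whose
   labels are carried along. *)
Fixpoint target (X : Type) (b : op X) : tree X :=
  match b with
  | Stem k x => corolla k x
  | Vertex _ D => tjoin (tmap (@target X) D)
  end.

(* The decorations of the white vertices, together with what lies over them. *)
Fixpoint whites (X : Type) (b : op X) : seq (tree (op X)) :=
  match b with
  | Stem _ _ => [::]
  | Vertex white D =>
      (if white then [:: D] else [::]) ++ flatten (labels (tmap (@whites X) D))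
  end.

Definition is_black (X : Type) (b : op X) : bool :=
  match b with Vertex false _ => true | _ => false end.

(* A vertex of b is unary when its decoration has exactly one vertex. *)
Fixpoint reduced (X : Type) (b : op X) : bool :=
  match b with
  | Stem _ _ => true
  | Vertex white D =>
      (white || (nvertices D != 1) && ~~ has (@is_black X) (labels D))
        && all id (labels (tmap (@reduced X) D))
  end.

Fixpoint opmap (X Y : Type) (f : X -> Y) (b : op X) : op Y :=
  match b with
  | Stem k x => Stem k (f x)
  | Vertex white D => Vertex white (tmap (opmap f) D)
  end.

(* Grafts onto every leaf the tree which labels it. *)
Fixpoint opjoin (X : Type) (b : op (op X)) : op X :=
  match b with
  | Stem _ c => c
  | Vertex white D => Vertex white (tmap (@opjoin X) D)
  end.

(* Replaces the white vertex, and all that lies over it, by [c]. *)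
Fixpoint replace_white (X : Type) (c : op X) (b : op X) : op X :=
  match b with
  | Stem k x => Stem k x
  | Vertex true _ => c
  | Vertex false D => Vertex false (tmap (replace_white c) D)
  end.

Definition expand_black (X : Type) (b : op X) : tree (op X) :=
  match b with
  | Vertex false D => D
  | _ => corolla (root_edge b) b
  end.

Definition black_vertex (X : Type) (D : tree (op X)) : op X :=
  match D with
  | Node b ts => if nvertices D == 1 then b else Vertex false D
  | Eta => Vertex false D
  end.

(* Contracts the edges between black vertices (the decoration of the upper vertex
   is inserted into that of the lower one) and removes the unary black
   vertices. *)
Fixpoint normalize (X : Type) (b : op X) : op X :=
  match b with
  | Stem k x => Stem k x
  | Vertex true D => Vertex true (tmap (@normalize X) D)
  | Vertex false D =>
      black_vertex (tjoin (tmap (fun c => expand_black (normalize c)) D))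
  end.

(** * (0,3)-bimodules *)

(* The elements (b, v) of B_{0,3} with s(v) = S and t(b) = T. *)
Record B03 (S T : ptree) := MkB03 {
  b03 :> op unit;
  b03_decorated : well_decorated b03;
  b03_reduced : reduced b03;
  b03_source : map (@tshape _) (whites b03) = [:: S];
  b03_target : target b03 = T }.

(* The operation (b, v) where v is the only vertex of b. *)
Fixpoint stems (T : ptree) : tree (op unit) :=
  match T with
  | Eta => Eta
  | Node _ ts => Node (Stem (size ts) tt) (map stems ts)
  end.

Definition unit_op (T : ptree) : op unit := Vertex true (stems T).

(* [c] is the composite of [b'] with [b].  The leaves of [b] are matched with
   the branches over the white vertex of [b'] by the bijection between the
   leaves of [b] and the vertices of t(b): [l] is [b] with every leaf labelled
   by the corresponding branch.  As [l] is determined by [b] and [b'], the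
   composite exists and is unique as soon as s(v') = t(b). *)
Definition is_composite (b' b c : op unit) : Prop :=
  exists l : op (op unit),
    [/\ opmap (fun=> tt) l = b,
        whites b' = [:: target l] &
        c = normalize (replace_white (opjoin l) b')].

Record bimodule03 (E : category) := Bimodule03 {
  bob :> ptree -> E;
  bact : forall S T, B03 S T -> Hom (bob S) (bob T);
  bact_unit : forall T (u : B03 T T), b03 u = unit_op T -> bact u = idm (bob T);
  bact_comp : forall S T U (b' : B03 T U) (b : B03 S T) (c : B03 S U),
    is_composite b' b c -> bact c = bact b' ∘ bact b }.

Record bimodule03_hom (E : category) (A B : bimodule03 E) := Bimodule03Hom {
  bhom :> forall T, Hom (A T) (B T);
  bhom_act : forall S T (b : B03 S T),
    bhom T ∘ bact A b = bact B b ∘ bhom S }.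

Lemma bimodule03_hom_eq (E : category) (A B : bimodule03 E)
    (f g : bimodule03_hom A B) : (forall T, f T = g T) -> f = g.
Proof.
case: f g => [f fP] [g gP] /= fg.
have e : f = g by apply: functional_extensionality_dep.
by case: g / e gP fg => gP _; congr Bimodule03Hom; apply: proof_irrelevance.
Qed.

Lemma bimodule03_id_act (E : category) (A : bimodule03 E) S T (b : B03 S T) :
  idm (A T) ∘ bact A b = bact A b ∘ idm (A S).
Proof. by rewrite comp1m compm1. Qed.

Lemma bimodule03_comp_act (E : category) (A B C : bimodule03 E)
    (g : bimodule03_hom B C) (f : bimodule03_hom A B) S T (b : B03 S T) :
  (g T ∘ f T) ∘ bact A b = bact C b ∘ (g S ∘ f S).
Proof. by rewrite -compA bhom_act compA bhom_act compA. Qed.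

Definition bimodule03_category (E : category) : category.
Proof.
refine (@Category (bimodule03 E) (@bimodule03_hom E)
  (fun A => Bimodule03Hom (@bimodule03_id_act E A))
  (fun A B C g f => Bimodule03Hom (bimodule03_comp_act g f)) _ _ _) => *;
  apply: bimodule03_hom_eq => T /=.
- exact: comp1m.
- exact: compm1.
- exact: compA.
Defined.

(** * The planar dendroidal category *)

(* Edges are addressed from the root: [::] is the root edge of [T], and
   [i :: e] is the edge [e] of the tree carried by the [i]-th input of the root
   vertex.  [subtree T e] is the part of [T] lying over the edge [e]; it is a
   [Node] exactly when there is a vertex on top of [e], and that vertex is then
   addressed by [e] too. *)
Fixpoint subtree (T : ptree) (e : seq nat) : option ptree :=
  match e with
  | [::] => Some T
  | i :: e' =>
      match T with
      | Eta => None
      | Node _ ts => if i < size ts then subtree (nth Eta ts i) e' else None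
      end
  end.

Definition is_edge (T : ptree) (e : seq nat) : bool := isSome (subtree T e).

(* Replaces by [U] the part of [T] lying over the edge [e]. *)
Fixpoint replace_subtree (T : ptree) (e : seq nat) (U : ptree) : ptree :=
  match e with
  | [::] => U
  | i :: e' =>
      match T with
      | Eta => Eta
      | Node x ts =>
          Node x (set_nth Eta ts i (replace_subtree (nth Eta ts i) e' U))
      end
  end.

Inductive elementary : ptree -> ptree -> Type :=
(* contraction of the inner edge e = rcons p (size l), the output of the vertex
   with inputs [m] *)
| inner_face (T : ptree) (p : seq nat) (l m r : seq ptree) of
    subtree T p = Some (Node tt (l ++ Node tt m :: r)) :
    elementary (replace_subtree T p (Node tt (l ++ m ++ r))) T
(* removal of a vertex [p], other than the root vertex, all of whose inputs are
   leaves *)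
| top_face (T : ptree) (p : seq nat) (n : nat) of
    p <> [::] & subtree T p = Some (corolla n tt) :
    elementary (replace_subtree T p Eta) T
(* removal of a root vertex exactly one of whose inputs is an inner edge *)
| root_face (U : ptree) (l r : nat) of U <> Eta :
    elementary U (Node tt (nseq l Eta ++ U :: nseq r Eta))
(* removal of the vertex of a corolla, leaving only the edge [e]: these are the
   outer faces of a tree without inner edges *)
| corolla_face (n : nat) (e : seq nat) of is_edge (corolla n tt) e :
    elementary Eta (corolla n tt)
(* removal of the unary vertex [p] *)
| degeneracy (T : ptree) (p : seq nat) (U : ptree) of
    subtree T p = Some (Node tt [:: U]) :
    elementary T (replace_subtree T p U).

Definition at_vertex (p : seq nat) (f : seq nat -> seq nat) (a : seq nat) :=
  if prefix p a then p ++ f (drop (size p) a) else a.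

(* For a vertex with [i] inputs followed by an inner edge, on top of which is a
   vertex with [k] inputs. *)
Definition uncontract (i k : nat) (a : seq nat) : seq nat :=
  match a with
  | [::] => [::]
  | j :: a' => if j < i then j :: a'
               else if j < i + k then i :: (j - i) :: a'
               else (j - k).+1 :: a'
  end.

(* The effect on edges of an elementary map. *)
Definition on_edges (S T : ptree) (g : elementary S T) : seq nat -> seq nat :=
  match g with
  | inner_face _ p l m _ _ => at_vertex p (uncontract (size l) (size m))
  | top_face _ _ _ _ _ => id
  | root_face _ l _ _ => cons l
  | corolla_face _ e _ => fun=> e
  | degeneracy _ p _ _ => at_vertex p behead
  end.

(* Formal composites of elementary maps, written in order of application. *)
Inductive word : ptree -> ptree -> Type :=
| word_nil (T : ptree) : word T T
| word_cons (S T U : ptree) of elementary S T & word T U : word S U.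

Fixpoint word_cat (S T U : ptree) (u : word S T) : word T U -> word S U :=
  match u with
  | word_nil _ => id
  | word_cons _ _ _ g u' => fun v => word_cons g (word_cat u' v)
  end.

(* The congruence generated by the dendroidal relations.  All of these are
   commutative squares of elementary maps ([dend_square]) or exhibit a face as a
   section of a degeneracy ([dend_section]), the edges and vertices involved
   being matched through the maps on edges:
   - two inner faces commute; two outer faces commute (for a tree with two
     vertices, this square passes through the free living edge); an inner and
     an outer face commute if not adjacent, and otherwise contracting an inner
     edge and then removing the resulting outer vertex is removing its two ends
     one after the other;
   - two degeneracies commute;
   - a face followed by a degeneracy is an identity if it is a face at one of
     the edges of the vertex removed by the degeneracy, or the face removing
     that vertex, and otherwise the two commute. *)
Inductive dend_eq : forall S T : ptree, word S T -> word S T -> Prop :=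
| dend_square S T T' U (g : elementary S T) (h : elementary T U)
    (g' : elementary S T') (h' : elementary T' U) of
    (forall e, is_edge S e ->
       on_edges h (on_edges g e) = on_edges h' (on_edges g' e)) :
    dend_eq (word_cons g (word_cons h (word_nil U)))
            (word_cons g' (word_cons h' (word_nil U)))
| dend_section S T (g : elementary S T) (h : elementary T S) of
    (forall e, is_edge S e -> on_edges h (on_edges g e) = e) :
    dend_eq (word_cons g (word_cons h (word_nil S))) (word_nil S)
| dend_refl S T (u : word S T) : dend_eq u u
| dend_sym S T (u v : word S T) of dend_eq u v : dend_eq v u
| dend_trans S T (u v w : word S T) of dend_eq u v & dend_eq v w : dend_eq u w
| dend_cat S T U (u u' : word S T) (v v' : word T U) of
    dend_eq u u' & dend_eq v v' : dend_eq (word_cat u v) (word_cat u' v').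

(* Morphisms are the equivalence classes of words. *)
Definition dend_hom (S T : ptree) : Type :=
  {P : word S T -> Prop | exists u, P = dend_eq u}.

Definition dend_class (S T : ptree) (u : word S T) : dend_hom S T :=
  exist _ (dend_eq u) (ex_intro _ u erefl).

Lemma dend_class_eq S T (u v : word S T) :
  dend_eq u v -> dend_class u = dend_class v.
Proof.
move=> uv; apply: eq_sig_hprop => [P|/=]; first exact: proof_irrelevance.
apply: functional_extensionality => w; apply: propositional_extensionality.
by split; apply: dend_trans => //; apply: dend_sym.
Qed.

Lemma dend_classP S T (f : dend_hom S T) : exists u, f = dend_class u.
Proof.
case: f => P [u uP]; exists u.
by apply: eq_sig_hprop => // Q; apply: proof_irrelevance.
Qed.

Lemma dend_comp_subproof S T U (g : dend_hom T U) (f : dend_hom S T) :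
  exists w : word S U,
    (fun w' => exists u v, [/\ sval f u, sval g v & dend_eq (word_cat u v) w'])
    = dend_eq w.
Proof.
case: (dend_classP f) (dend_classP g) => [u ->] [v ->] /=; exists (word_cat u v).
apply: functional_extensionality => w; apply: propositional_extensionality.
split=> [[u' [v' [uu' vv']]]|uvw]; last first.
  by exists u, v; split=> //; apply: dend_refl.
by apply: dend_trans; apply: dend_cat.
Qed.

Definition dend_comp S T U (g : dend_hom T U) (f : dend_hom S T) :
  dend_hom S U := exist _ _ (dend_comp_subproof g f).

Lemma dend_compE S T U (v : word T U) (u : word S T) :
  dend_comp (dend_class v) (dend_class u) = dend_class (word_cat u v).
Proof.
apply: eq_sig_hprop => [P|/=]; first exact: proof_irrelevance.
apply: functional_extensionality => w; apply: propositional_extensionality.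
split=> [[u' [v' [uu' vv']]]|uvw]; last first.
  by exists u, v; split=> //; apply: dend_refl.
by apply: dend_trans; apply: dend_cat.
Qed.

Lemma word_cats0 S T (u : word S T) : word_cat u (word_nil T) = u.
Proof. by elim: u => //= S' T' U g u ->. Qed.

Lemma word_catA S T U V (u : word S T) (v : word T U) (w : word U V) :
  word_cat (word_cat u v) w = word_cat u (word_cat v w).
Proof. by elim: u v => //= S' T' U' g u IHu v; rewrite IHu. Qed.

Definition Omega_p : category.
Proof.
refine (@Category ptree dend_hom (fun T => dend_class (word_nil T)) dend_comp
  _ _ _) => [S T f|S T f|S T U V h g f].
- by have [u ->] := dend_classP f; rewrite dend_compE word_cats0.
- by have [u ->] := dend_classP f; rewrite dend_compE.
- have [u ->] := dend_classP f; have [v ->] := dend_classP g.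
  by have [w ->] := dend_classP h; rewrite !dend_compE word_catA.
Defined.

(* Main.v *)
(* The effect on edges determines both the morphisms S -> T of Omega_p and the
   operations (b, v) with s(v) = S and t(b) = T, and both are classified by the
   same data: an edge q of T and a root-preserving map from S to the part of T
   over q, which replaces every vertex w of S by a tree with as many leaves as w
   has inputs and then grafts trees onto the leaves of the result.  For the
   operations, the trees decorating the vertices over v are the replacements,
   and the vertex under v records q and the grafted trees.  For Omega_p, such
   data have a canonical word; composing an elementary map with a canonical word
   yields, up to the dendroidal relations, the canonical word of the composite,
   so that words with the same effect on edges are related.  Composition of
   operations corresponds to composition of the effects on edges, because
   normalization, grafting and replacing the white vertex are compatible with
   them. *)

From mathcomp Require Import all_boot zify.
From Stdlib Require Import FunctionalExtensionality ProofIrrelevance JMeq.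
From Stdlib Require Import ClassicalEpsilon Permutation.
Require Import Defs.

Set Implicit Arguments.
Unset Strict Implicit.
Unset Printing Implicit Defensive.

(** * Grafting and joining trees *)

(** The dendroidal relations are squares and sections made of single elementary maps, while the
    argument rewrites long words inside larger trees. Elementary maps are therefore replaced by
    untyped steps, which act at the root of a tree or, nested, over one of its inputs; typing is
    kept apart in the relations [rstep] and [gstep], and typed words return only once normal forms
    are available. The shape of the normal form makes precomposition with one step computable: the
    word [blow D] that replaces a vertex does not depend on what lies over the vertex, so that steps
    above it can slide past. Three families of relations carry the weight, for a contraction
    ([inner_blow]), a new top vertex ([grow_blow]) and a new root vertex ([up_blow]). Images of
    edges do not show everything inside a replacement, for instance a vertex without inputs, so a
    normal form is recovered from its edge map together with its target ([rmap_edge_inj]). On the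
    side of operations, the address of the white vertex in the target is well defined because white
    vertices can be counted, and normalization keeps it because substitution of trees is
    associative. *)

(* Statements about trees are proved simultaneously with their analogues for
   forests, as pairs. *)
Lemma tree_forest_ind (A : Type) (P : tree A -> Prop) (Q : seq (tree A) -> Prop) :
  P Eta -> (forall a ts, Q ts -> P (Node a ts)) ->
  Q [::] -> (forall t ts, P t -> Q ts -> Q (t :: ts)) ->
  (forall t, P t) * (forall ts, Q ts).
Proof.
move=> PE PN Q0 Qc.
have PT : forall t, P t.
  fix IH 1; case=> [//|a ts]; apply: PN.
  by elim: ts => [//|t ts IHts]; apply: Qc.
by split=> //; elim=> // t ts; apply: Qc.
Qed.

Lemma split_size (A : Type) (s : seq A) m n :
  size s = m + n -> exists s1 s2, [/\ s = s1 ++ s2, size s1 = m & size s2 = n].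
Proof.
move=> sz; exists (take m s), (drop m s).
rewrite cat_take_drop size_takel ?size_drop sz ?leq_addr //.
by split=> //; lia.
Qed.

Section Trees.
Variable A : Type.
Implicit Types (t : tree A) (ts us : seq (tree A)).

(** The anonymous inner recursion of [graft], named so that statements about forests can mention it;
    the two are convertible. *)
Fixpoint grafts ts us : seq (tree A) :=
  match ts with
  | [::] => [::]
  | t :: ts => graft t (take (nleaves t) us) :: grafts ts (drop (nleaves t) us)
  end.

Lemma graft_node a ts us : graft (Node a ts) us = Node a (grafts ts us).
Proof. by []. Qed.

Lemma grafts_cons t ts us vs : size us = nleaves t ->
  grafts (t :: ts) (us ++ vs) = graft t us :: grafts ts vs.
Proof. by move=> /= <-; rewrite take_size_cat // drop_size_cat. Qed.

Lemma size_grafts ts us : size (grafts ts us) = size ts.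
Proof. by elim: ts us => //= t ts IH us; rewrite IH. Qed.

Lemma grafts_cat ts ts' us us' : size us = sumn (map (@nleaves A) ts) ->
  grafts (ts ++ ts') (us ++ us') = grafts ts us ++ grafts ts' us'.
Proof.
elim: ts us => [[]//|t ts IH us] /= /split_size[u1 [u2 [-> s1 s2]]].
rewrite -catA -!s1 !take_size_cat // !drop_size_cat //.
by rewrite IH.
Qed.

Lemma nleaves_graft :
  (forall t us, size us = nleaves t ->
     nleaves (graft t us) = sumn (map (@nleaves A) us)) *
  (forall ts us, size us = sumn (map (@nleaves A) ts) ->
     sumn (map (@nleaves A) (grafts ts us)) = sumn (map (@nleaves A) us)).
Proof.
apply: tree_forest_ind => [[|u []]//= _|a ts IH us /=|[]//|t ts IHt IHts us].
- by rewrite addn0.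
- exact: IH.
move=> /split_size[u1 [u2 [-> s1 s2]]].
by rewrite grafts_cons //= IHt // IHts // map_cat sumn_cat.
Qed.

(* The addresses of the leaves of [t], from left to right. *)
Fixpoint leaves t : seq (seq nat) :=
  match t with
  | Eta => [:: [::]]
  | Node _ ts =>
      (fix leaves_from i ts := match ts with
       | [::] => [::]
       | t :: ts => map (cons i) (leaves t) ++ leaves_from i.+1 ts
       end) 0 ts
  end.

Fixpoint leaves_from i ts : seq (seq nat) :=
  match ts with
  | [::] => [::]
  | t :: ts => map (cons i) (leaves t) ++ leaves_from i.+1 ts
  end.

Lemma leaves_node a ts : leaves (Node a ts) = leaves_from 0 ts.
Proof. by []. Qed.

Lemma size_leaves :
  (forall t, size (leaves t) = nleaves t) *
  (forall ts i, size (leaves_from i ts) = sumn (map (@nleaves A) ts)).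
Proof.
apply: tree_forest_ind => //= t ts IHt IHts i.
by rewrite size_cat size_map IHt IHts.
Qed.

Fixpoint above t (e : seq nat) : tree A :=
  match e with
  | [::] => t
  | i :: e' => if t is Node _ ts then above (nth Eta ts i) e' else Eta
  end.

Fixpoint edge t (e : seq nat) : bool :=
  match e with
  | [::] => true
  | i :: e' => if t is Node _ ts then (i < size ts) && edge (nth Eta ts i) e'
               else false
  end.

Lemma above_cat t e e' : above t (e ++ e') = above (above t e) e'.
Proof.
elim: e t => //= i e IH [|a ts] //.
by case: e' {IH}.
Qed.

Lemma edge_cat t e e' : edge t (e ++ e') = edge t e && edge (above t e) e'.
Proof.
elim: e t => //= i e IH [|a ts] //.
by rewrite IH andbA.
Qed.

Lemma above_edge t e a ts : above t e = Node a ts -> edge t e.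
Proof.
elim: e t => //= i e IH [|b us] //= rstep.
rewrite (IH _ rstep) andbT; case: ltnP => // ge.
by move: rstep; rewrite nth_default //; case: e {IH}.
Qed.

(** For forests, [pre] stands for the siblings on the left, whose number [k] is the offset in the
    addresses made by [leaves_from]. *)
Lemma above_graft_leaf :
  (forall t us i, size us = nleaves t -> i < nleaves t ->
     above (graft t us) (nth [::] (leaves t) i) = nth Eta us i /\
     edge (graft t us) (nth [::] (leaves t) i)) *
  (forall ts us i k pre a, size us = sumn (map (@nleaves A) ts) ->
     i < sumn (map (@nleaves A) ts) -> size pre = k ->
     above (Node a (pre ++ grafts ts us)) (nth [::] (leaves_from k ts) i) = nth Eta
       us i /\
     edge (Node a (pre ++ grafts ts us)) (nth [::] (leaves_from k ts) i)).
Proof.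
apply: tree_forest_ind => [[|u []] // []//|a ts IH us i su li| |].
- exact: (IH us i 0 [::] a su li).
- by move=> us [].
move=> t ts IHt IHts us i k pre a /split_size[u1 [u2 [-> s1 s2]]] li sk.
rewrite grafts_cons //= nth_cat size_map size_leaves.1.
case: ltnP => [lt|ge].
  rewrite (nth_map [::]) ?size_leaves.1 //= nth_cat sk ltnn subnn /=.
  rewrite nth_cat s1 lt size_cat /= sk.
  have [-> ->] := IHt u1 i s1 lt; split=> //; lia.
have := IHts u2 (i - nleaves t) k.+1 (rcons pre (graft t u1)) a s2.
rewrite cat_rcons size_rcons sk [nth Eta (u1 ++ u2) i]nth_cat s1.
rewrite [i < nleaves t]ltnNge ge /=; apply=> //.
by move: li => /=; lia.
Qed.

Lemma leaves_edge :
  (forall t i, i < nleaves t ->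
     above t (nth [::] (leaves t) i) = Eta /\ edge t (nth [::] (leaves t) i)) *
  (forall ts i k pre a,
     i < sumn (map (@nleaves A) ts) -> size pre = k ->
     above (Node a (pre ++ ts)) (nth [::] (leaves_from k ts) i) = Eta /\
     edge (Node a (pre ++ ts)) (nth [::] (leaves_from k ts) i)).
Proof.
apply: tree_forest_ind => [[]//|a ts IH i li|//|].
  exact: (IH i 0 [::] a li).
move=> t ts IHt IHts i k pre a li sk /=.
rewrite nth_cat size_map size_leaves.1; case: ltnP => [lt|ge].
  rewrite (nth_map [::]) ?size_leaves.1 //= nth_cat sk ltnn subnn size_cat sk /=.
  have [-> ->] := IHt i lt; split=> //; lia.
have := IHts (i - nleaves t) k.+1 (rcons pre t) a.
rewrite cat_rcons size_rcons sk; apply=> //.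
by move: li => /=; lia.
Qed.

Lemma leaves_graft :
  (forall t us, size us = nleaves t ->
     leaves (graft t us) =
     flatten [seq map (cat p.1) (leaves p.2) | p <- zip (leaves t) us]) *
  (forall ts us k, size us = sumn (map (@nleaves A) ts) ->
     leaves_from k (grafts ts us) =
     flatten [seq map (cat p.1) (leaves p.2) | p <- zip (leaves_from k ts) us]).
Proof.
apply: tree_forest_ind => [[|u []]//= _|a ts IH us su|[]//|].
- by rewrite cats0 map_id.
- exact: IH.
move=> t ts IHt IHts us k /split_size[u1 [u2 [-> s1 s2]]].
rewrite grafts_cons //= zip_cat ?size_map ?size_leaves.1 ?s1 //.
rewrite map_cat flatten_cat IHts // IHt //; congr (_ ++ _).
rewrite map_flatten -!map_comp; congr flatten.
elim: (leaves t) u1 {s1} => [|l ls IH] [|u us1] //=.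
by rewrite IH -map_comp.
Qed.

(** Only up to permutation: labels are listed depth first, so those of a grafted tree come before
    the labels of [t] to the right of its leaf. *)
Lemma labels_graft :
  (forall t us, size us = nleaves t ->
     Permutation (labels (graft t us)) (labels t ++ flatten (map (@labels A) us))) *
  (forall ts us, size us = sumn (map (@nleaves A) ts) ->
     Permutation (flatten (map (@labels A) (grafts ts us)))
       (flatten (map (@labels A) ts) ++ flatten (map (@labels A) us))).
Proof.
apply: tree_forest_ind => [[|u []]//= _|a ts IH us su|[]//|].
- by rewrite cats0.
- by apply: Permutation_cons => //; apply: IH.
move=> t ts IHt IHts us /split_size[u1 [u2 [-> s1 s2]]].
rewrite grafts_cons //= map_cat flatten_cat.
rewrite (IHt u1) // (IHts u2) // -!catA.
apply: Permutation_app_head.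
rewrite !catA; apply: Permutation_app_tail.
exact: Permutation_app_comm.
Qed.

Lemma all_vertices_graft (p : A -> nat -> bool) :
  (forall t us, size us = nleaves t ->
     all_vertices p (graft t us) = all_vertices p t && all (all_vertices p) us) *
  (forall ts us, size us = sumn (map (@nleaves A) ts) ->
     all (all_vertices p) (grafts ts us) =
     all (all_vertices p) ts && all (all_vertices p) us).
Proof.
apply: tree_forest_ind => [[|u []]//= _|a ts IH us su|[]//|].
- by rewrite andbT.
- by rewrite graft_node /= size_grafts IH // andbA.
move=> t ts IHt IHts us /split_size[u1 [u2 [-> s1 s2]]].
by rewrite grafts_cons //= IHt // IHts // all_cat -!andbA; do !bool_congr.
Qed.

(** Associativity of grafting. The size conditions exclude the truncation and the padding by [Eta]
    that are built into [graft]. *)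
Lemma graft_graft :
  (forall t us vs, size us = nleaves t ->
     size vs = sumn (map (@nleaves A) us) ->
     graft (graft t us) vs = graft t (grafts us vs)) *
  (forall ts us vs, size us = sumn (map (@nleaves A) ts) ->
     size vs = sumn (map (@nleaves A) us) ->
     grafts (grafts ts us) vs = grafts ts (grafts us vs)).
Proof.
apply: tree_forest_ind => [[|u []]//= vs _|a ts IH us vs su sv|[]//|].
- by rewrite addn0 => sv; rewrite take_oversize // sv.
- by rewrite !graft_node IH.
move=> t ts IHt IHts us vs /split_size[u1 [u2 [-> s1 s2]]].
rewrite map_cat sumn_cat => /split_size[v1 [v2 [-> t1 t2]]].
rewrite [grafts (t :: ts) _]grafts_cons // grafts_cons; last first.
  by rewrite t1 nleaves_graft.1.
by rewrite IHt // IHts // [grafts (u1 ++ _) _]grafts_cat // grafts_cons // size_grafts.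
Qed.

Lemma graft_eta :
  (forall t, graft t (nseq (nleaves t) Eta) = t) *
  (forall ts, grafts ts (nseq (sumn (map (@nleaves A) ts)) Eta) = ts).
Proof.
apply: tree_forest_ind => //= [a ts IH|t ts IHt IHts].
  by rewrite -/(grafts _ _) IH.
by rewrite nseqD take_size_cat ?size_nseq // drop_size_cat ?size_nseq // IHt IHts.
Qed.

End Trees.

Lemma nleaves_corolla (A : Type) n (a : A) : nleaves (corolla n a) = n.
Proof. by rewrite /= map_nseq sumn_nseq mul1n. Qed.

Lemma grafts_eta (A : Type) (us : seq (tree A)) :
  grafts (nseq (size us) Eta) us = us.
Proof. by elim: us => //= u us IH; rewrite drop0 IH. Qed.

Lemma graft_corolla (A : Type) (a : A) us : graft (corolla (size us) a) us = Node a us.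
Proof. by rewrite graft_node grafts_eta. Qed.

Section Maps.
Variables (A B : Type) (f : A -> B).

Lemma nleaves_tmap t : nleaves (tmap f t) = nleaves t.
Proof.
move: t; apply: (fst (tree_forest_ind (Q := fun ts =>
  sumn (map (@nleaves B) (map (tmap f) ts)) = sumn (map (@nleaves A) ts)) _ _ _ _))
    => //=.
by move=> t ts -> ->.
Qed.

Lemma tmap_graft :
  (forall t us, tmap f (graft t us) = graft (tmap f t) (map (tmap f) us)) *
  (forall ts us, map (tmap f) (grafts ts us) =
     grafts (map (tmap f) ts) (map (tmap f) us)).
Proof.
apply: tree_forest_ind => [[]//|a ts IH us|//|t ts IHt IHts us].
- by rewrite [RHS]graft_node -IH.
- by rewrite /= IHt IHts nleaves_tmap map_take map_drop.
Qed.

Lemma leaves_tmap :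
  (forall t, leaves (tmap f t) = leaves t) *
  (forall ts i, leaves_from i (map (tmap f) ts) = leaves_from i ts).
Proof. by apply: tree_forest_ind => //= t ts IHt IHts i; rewrite IHt IHts. Qed.

Lemma labels_tmap :
  (forall t, labels (tmap f t) = map f (labels t)) *
  (forall ts, flatten (map (@labels B) (map (tmap f) ts)) =
     map f (flatten (map (@labels A) ts))).
Proof.
apply: tree_forest_ind => //= [a ts -> //|t ts -> ->]; by rewrite map_cat.
Qed.

Lemma above_tmap t e : above (tmap f t) e = tmap f (above t e).
Proof.
elim: e t => //= i e IH [|a ts] //=.
case: (ltnP i (size ts)) => li; first by rewrite (nth_map Eta) // IH.
by rewrite !nth_default ?size_map //; case: e {IH}.
Qed.

Lemma edge_tmap t e : edge (tmap f t) e = edge t e.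
Proof.
elim: e t => //= i e IH [|a ts] //=; rewrite size_map.
by case: ltnP => //= li; rewrite (nth_map Eta).
Qed.

Lemma all_vertices_tmap (p : B -> nat -> bool) :
  (forall t, all_vertices p (tmap f t) = all_vertices (fun a => p (f a)) t) *
  (forall ts, all (all_vertices p) (map (tmap f) ts) =
     all (all_vertices (fun a => p (f a))) ts).
Proof.
apply: tree_forest_ind => //= [a ts|t ts] ->; rewrite ?size_map // => ->.
by [].
Qed.

End Maps.

Lemma tmap_comp (A B C : Type) (g : B -> C) (f : A -> B) t :
  tmap g (tmap f t) = tmap (g \o f) t.
Proof.
move: t; apply: (fst (tree_forest_ind (Q := fun ts =>
  map (tmap g) (map (tmap f) ts) = map (tmap (g \o f)) ts) _ _ _ _)) => //=
    [a ts ->|t ts -> ->] //.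
Qed.

Lemma eq_tmap (A B : Type) (f g : A -> B) : f =1 g -> tmap f =1 tmap g.
Proof.
move=> fg t; move: t; apply: (fst (tree_forest_ind (Q := fun ts =>
  map (tmap f) ts = map (tmap g) ts) _ _ _ _)) => //= [a ts ->|t ts -> ->] //.
by rewrite fg.
Qed.

Lemma tmap_id (A : Type) (f : A -> A) t : f =1 id -> tmap f t = t.
Proof.
move=> fi; move: t; apply: (fst (tree_forest_ind (Q := fun ts =>
  map (tmap f) ts = ts) _ _ _ _)) => //= [a ts ->|t ts -> ->] //.
by rewrite fi.
Qed.

Lemma all_vertices_above (A : Type) (p : A -> nat -> bool) t e :
  all_vertices p t -> all_vertices p (above t e).
Proof.
elim: e t => //= i e IH [|a ts] //= /andP[_ al].
apply: IH; elim: ts i al => [|t ts IHts] [|i] //= /andP[] //.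
by move=> _; apply: IHts.
Qed.

Lemma all_vertices_impl (A : Type) (p q : A -> nat -> bool) :
  (forall a n, p a n -> q a n) -> forall t, all_vertices p t -> all_vertices q t.
Proof.
move=> pq; apply: (fst (tree_forest_ind (Q := fun ts =>
  all (all_vertices p) ts -> all (all_vertices q) ts) _ _ _ _)) => //=.
- by move=> a ts IH /andP[/pq-> /IH].
- by move=> t ts IHt IHts /andP[/IHt-> /IHts].
Qed.

(** * Substitution of trees into vertices *)

Section Join.
Variable A : Type.
Implicit Types (Z Y : tree (tree A)) (Zs : seq (tree (tree A))).

(** The arity condition under which [tjoin] is operadic substitution: every [graft] in it then
    receives exactly one tree per leaf. *)
Definition wf : tree (tree A) -> bool := all_vertices (fun t n => nleaves t == n).

Lemma nleaves_tjoin :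
  (forall Z, wf Z -> nleaves (tjoin Z) = nleaves Z) *
  (forall Zs, all wf Zs ->
     sumn (map (@nleaves A) (map (@tjoin A) Zs)) = sumn (map (@nleaves _) Zs)).
Proof.
apply: tree_forest_ind => //= [t Zs IH /andP[/eqP nt wZ]|Z Zs IHZ IHZs /andP[wZ wZs]].
  by rewrite (nleaves_graft _).1 ?size_map ?IH.
by rewrite IHZ ?IHZs.
Qed.

Lemma tjoin_graft :
  (forall Z us, wf Z -> all wf us -> size us = nleaves Z ->
     tjoin (graft Z us) = graft (tjoin Z) (map (@tjoin A) us)) *
  (forall Zs us, all wf Zs -> all wf us -> size us = sumn (map (@nleaves _) Zs) ->
     map (@tjoin A) (grafts Zs us) = grafts (map (@tjoin A) Zs) (map (@tjoin A) us)).
Proof.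
apply: tree_forest_ind => [[|u []]//|t Zs IH us /= /andP[/eqP nt wZ] wu su|[]//|].
  rewrite -/(grafts Zs us) /= IH // (graft_graft _).1 ?size_map //.
  by rewrite nleaves_tjoin.2.
move=> Z Zs IHZ IHZs us /andP[wZ wZs] wu /split_size[u1 [u2 [E s1 s2]]].
move: wu; rewrite E all_cat => /andP[w1 w2].
rewrite grafts_cons //= map_cat take_size_cat ?drop_size_cat ?size_map
  ?nleaves_tjoin.1 //.
by rewrite IHZ // IHZs.
Qed.

(* The edge of [tjoin Z] which comes from the edge [e] of [Z]. *)
Fixpoint join_edge Z (e : seq nat) : seq nat :=
  match e with
  | [::] => [::]
  | i :: e' => if Z is Node t Zs then nth [::] (leaves t) i ++ join_edge
    (nth Eta Zs i) e'
               else [::]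
  end.

Lemma join_edge_cat Z e e' : join_edge Z (e ++ e') = join_edge Z e ++ join_edge
  (above Z e) e'.
Proof.
elim: e Z => //= i e IH [|t Zs] //; last by rewrite IH catA.
by case: e' {IH}.
Qed.

Lemma wf_nth Zs i : all wf Zs -> wf (nth Eta Zs i).
Proof. by elim: Zs i => [|Z Zs IH] [|i] //= /andP[] // _ /IH. Qed.

Lemma above_tjoin Z e : wf Z -> edge Z e ->
  above (tjoin Z) (join_edge Z e) = tjoin (above Z e) /\ edge (tjoin Z) (join_edge Z e).
Proof.
elim: e Z => //= i e IH [|t Zs] //= /andP[/eqP nt wZ] /andP[li ed].
rewrite above_cat edge_cat.
have [//|//|-> ->] := (above_graft_leaf A).1 t (map (@tjoin A) Zs) i.
- by rewrite size_map nt.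
- by rewrite nt.
rewrite (nth_map Eta) //; apply: IH => //; exact: wf_nth.
Qed.

Lemma join_edge_graft Y us e : edge Y e -> join_edge (graft Y us) e = join_edge Y e.
Proof.
elim: e Y us => //= i e IH [|t Ys] us //= /andP[li ed].
congr (_ ++ _); rewrite -/(grafts Ys us).
elim: Ys us i li ed => [|Y Ys IHYs] us [|i] //= li ed; first exact: IH.
exact: IHYs.
Qed.

(** In the second half, [Ls] is the list of leaves of the label [t] from index [k] on, and [pre]
    holds the subtrees already treated. *)
Lemma leaves_tjoin :
  (forall Z, wf Z -> leaves (tjoin Z) = map (join_edge Z) (leaves Z)) *
  (forall Zs, all wf Zs -> forall (Ls : seq (seq nat)) k pre t,
      size Ls = size Zs -> (forall i, nth [::] (leaves t) (k + i) = nth [::] Ls i) ->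
      size pre = k ->
      flatten [seq map (cat p.1) (leaves p.2) | p <- zip Ls (map (@tjoin A) Zs)] =
      map (join_edge (Node t (pre ++ Zs))) (leaves_from k Zs)).
Proof.
apply: tree_forest_ind => //.
- move=> t Zs IH /= /andP[/eqP nt wZ].
  rewrite (leaves_graft _).1 ?size_map //.
  by rewrite (IH wZ (leaves t) 0 [::] t) // (size_leaves _).1.
- by move=> _ [].
move=> Z Zs IHZ IHZs /andP[wZ wZs] [|L Ls] //= k pre t [sL] HL sp.
rewrite map_cat; congr (_ ++ _).
  rewrite (IHZ wZ) -!map_comp; apply: eq_map => e /=.
  rewrite nth_cat sp ltnn subnn /=.
  by rewrite -[k in nth _ _ k]addn0 HL.
rewrite (IHZs wZs Ls k.+1 (rcons pre Z) t) ?cat_rcons ?size_rcons ?sp //.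
by move=> i; rewrite addSnnS HL.
Qed.

Lemma edge_join_edge Z e : wf Z -> edge Z e -> edge (tjoin Z) (join_edge Z e).
Proof. by move=> wZ eZ; have [] := above_tjoin wZ eZ. Qed.

End Join.

Arguments join_edge {A} Z e.

Lemma join_edge_tmap (A B : Type) (f : A -> B) Z e : join_edge (tmap (tmap f) Z) e =
  join_edge Z e.
Proof.
elim: e Z => //= i e IH [|t Zs] //=; rewrite (leaves_tmap _).1.
case: (ltnP i (size Zs)) => li; first by rewrite (nth_map Eta) // IH.
by rewrite !(@nth_default _ Eta) ?size_map //; case: e {IH}.
Qed.

Lemma tjoin_tmap (A B : Type) (f : A -> B) Z :
  tjoin (tmap (tmap f) Z) = tmap f (tjoin Z).
Proof.
move: Z; apply: (fst (tree_forest_ind (Q := fun Zs =>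
  map (@tjoin B) (map (tmap (tmap f)) Zs) = map (tmap f) (map (@tjoin A) Zs)) _ _ _
    _)) => //=.
- by move=> t Zs ->; rewrite (tmap_graft _).1.
- by move=> Z Zs -> ->.
Qed.

Lemma all_vertices_tjoin (A : Type) (p : A -> nat -> bool) :
  (forall Z, wf Z -> all_vertices p (tjoin Z) = all_vertices
    (fun t _ => all_vertices p t) Z) *
  (forall Zs, all (@wf A) Zs -> all (all_vertices p) (map (@tjoin A) Zs) =
     all (all_vertices (fun t _ => all_vertices p t)) Zs).
Proof.
apply: tree_forest_ind => //= [t Zs IH /andP[/eqP nt wZ]|Z Zs IHZ IHZs /andP[wZ wZs]].
  by rewrite (all_vertices_graft p).1 ?size_map ?IH.
by rewrite IHZ ?IHZs.
Qed.

Lemma labels_tjoin (A : Type) :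
  (forall Z, wf Z -> Permutation (labels (tjoin Z))
    (flatten (map (@labels A) (labels Z)))) *
  (forall Zs, all (@wf A) Zs ->
     Permutation (flatten (map (@labels A) (map (@tjoin A) Zs)))
       (flatten (map (@labels A) (flatten (map (@labels _) Zs))))).
Proof.
apply: tree_forest_ind => //= [t Zs IH /andP[/eqP nt wZ]|Z Zs IHZ IHZs /andP[wZ wZs]].
  rewrite (labels_graft A).1 ?size_map //; apply: Permutation_app_head; exact: IH.
rewrite map_cat flatten_cat; apply: Permutation_app; [exact: IHZ|exact: IHZs].
Qed.

Section JoinMap.
Variables (A B : Type) (h : A -> tree B).

Let ok : A -> nat -> bool := fun a n => nleaves (h a) == n.

Lemma wf_tmap t : wf (tmap h t) = all_vertices ok t.
Proof. by rewrite /wf (all_vertices_tmap h _).1. Qed.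

(** Associativity of substitution: the trees [h a] are substituted after the first substitution, or
    into its labels beforehand. *)
Lemma tjoin_tmap_tjoin :
  (forall Z, wf Z -> all_vertices (fun t _ => all_vertices ok t) Z ->
     tjoin (tmap h (tjoin Z)) = tjoin (tmap (fun t => tjoin (tmap h t)) Z)) *
  (forall Zs, all (@wf A) Zs -> all (all_vertices (fun t _ => all_vertices ok t)) Zs ->
     map (fun Z => tjoin (tmap h (tjoin Z))) Zs =
     map (fun Z => tjoin (tmap (fun t => tjoin (tmap h t)) Z)) Zs).
Proof.
apply: tree_forest_ind => //=; last first.
  by move=> Z Zs IHZ IHZs /andP[wZ wZs] /andP[oZ oZs]; rewrite IHZ // IHZs.
move=> t Zs IH /andP[/eqP nt wZ] /andP[ot oZ].
rewrite (tmap_graft h).1 (tjoin_graft B).1; last 1 first.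
- by rewrite !size_map nleaves_tmap.
- by rewrite -!map_comp; congr graft; apply: IH.
- by rewrite wf_tmap.
have -> : all (@wf B) (map (tmap h) (map (@tjoin A) Zs)) =
          all (all_vertices ok) (map (@tjoin A) Zs).
  by rewrite !all_map; apply: eq_all => Z /=; rewrite wf_tmap.
by rewrite (all_vertices_tjoin ok).2.
Qed.

(** The effect on edges of the associativity of substitution. An edge [e] of the label [t] of the
    vertex [p] has the address [join_edge Z p ++ e] in [tjoin Z]; both orders of substitution send
    it to the same place. *)
Lemma join_edge_tjoin_node Z p t us e : wf Z ->
  all_vertices (fun t _ => all_vertices ok t) Z ->
  above Z p = Node t us -> edge t e ->
  join_edge (tmap h (tjoin Z)) (join_edge Z p ++ e) =
  join_edge (tmap (fun t => tjoin (tmap h t)) Z) p ++ join_edge (tmap h t) e.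
Proof.
elim: p Z => [|i p IH] [|t0 Zs] //=.
  move=> _ _ [-> _] et; rewrite (tmap_graft h).1.
  by rewrite join_edge_graft // edge_tmap.
move=> /andP[/eqP nt wZ] /andP[ot oZ] sp et.
have li : i < size Zs.
  by case: ltnP => // ge; move: sp; rewrite nth_default //; case: p {IH}.
rewrite (tmap_graft h).1 -catA join_edge_cat -!(leaves_tmap h).1.
have nl : nleaves (tmap h t0) = size Zs by rewrite nleaves_tmap nt.
have [||-> _] := (above_graft_leaf (tree B)).1 (tmap h t0)
  (map (tmap h) (map (@tjoin A) Zs)) i.
- by rewrite !size_map nl.
- by rewrite nl.
have [|_ el] := (leaves_edge (tree B)).1 (tmap h t0) i; first by rewrite nl.
rewrite join_edge_graft // (leaves_tjoin B).1 ?wf_tmap //.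
rewrite (nth_map [::]) ?(size_leaves _).1 ?nl // -catA; congr (_ ++ _).
rewrite -map_comp !(nth_map Eta) //=; apply: IH => //; first exact: wf_nth.
by elim: Zs (i) oZ {wZ nt nl el li sp} => [|Z Zs IHZ] [|j] //= /andP[] // _ /IHZ.
Qed.

End JoinMap.

(** * Words of elementary maps *)

Notation N := (Node tt).

(* Untyped elementary maps.  [Inner i k] adds a vertex whose inputs are the [k]
   inputs of the root vertex from the [i]-th on, [Deg] removes a unary root
   vertex, [Top n] puts a vertex with [n] inputs on the free edge, [At i g]
   applies [g] to the tree carried by the [i]-th input, and [Up l r] adds a root
   vertex with [l] leaves to the left and [r] leaves to the right.  All of them
   but [Up] preserve the root, hence can be applied inside a larger tree. *)
Inductive step := Inner of nat & nat | Deg | Top of nat | At of nat & step | Up of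
  nat & nat.

Fixpoint step_edge (g : step) (a : seq nat) : seq nat :=
  match g with
  | Inner i k => uncontract i k a
  | Deg => behead a
  | Top _ => a
  | At i g => if a is j :: a' then if j == i then i :: step_edge g a' else a else [::]
  | Up l _ => l :: a
  end.

Fixpoint steps_edge (ws : seq step) (a : seq nat) : seq nat :=
  if ws is g :: ws then steps_edge ws (step_edge g a) else a.

Lemma steps_edge_cat u v a : steps_edge (u ++ v) a = steps_edge v (steps_edge u a).
Proof. by elim: u a => /=. Qed.

Inductive rstep : step -> tree unit -> tree unit -> Prop :=
| rstep_inner l m r : rstep (Inner (size l) (size m)) (N (l ++ m ++ r))
  (N (l ++ N m :: r))
| rstep_deg U : rstep Deg (N [:: U]) U
| rstep_top n : rstep (Top n) Eta (corolla n tt)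
| rstep_at l r g S T : rstep g S T -> rstep (At (size l) g) (N (l ++ S :: r))
  (N (l ++ T :: r)).

Lemma innerP i k S T l m r : S = N (l ++ m ++ r) -> T = N (l ++ N m :: r) ->
  size l = i -> size m = k -> rstep (Inner i k) S T.
Proof. by move=> -> -> <- <-; apply: rstep_inner. Qed.

Lemma atP i g S T l r S' T' : rstep g S' T' -> S = N (l ++ S' :: r) ->
  T = N (l ++ T' :: r) -> size l = i -> rstep (At i g) S T.
Proof. by move=> gstep -> -> <-; apply: rstep_at. Qed.

Definition gstep g S T := rstep g S T \/
  exists l r, g = Up l r /\ T = N (nseq l Eta ++ S :: nseq r Eta).

Lemma rstep_gstep g S T : rstep g S T -> gstep g S T. Proof. by left. Qed.
Lemma upP l r S T : T = N (nseq l Eta ++ S :: nseq r Eta) -> gstep (Up l r) S T.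
Proof. by move=> ->; right; exists l, r. Qed.

Lemma edge_node (A : Type) (a : A) ts j e :
  edge (Node a ts) (j :: e) = (j < size ts) && edge (nth Eta ts j) e.
Proof. by []. Qed.

Lemma rstep_edge g S T : rstep g S T -> forall a, edge S a -> edge T (step_edge g a).
Proof.
elim=> {g S T} [l m r|U|n|l r g S T _ IH] [|j a] //.
- rewrite [step_edge _ _]/= edge_node !size_cat !nth_cat => /andP[lj].
  case: (ltnP j (size l)) => jl.
    by rewrite edge_node size_cat nth_cat jl /= => ->; rewrite andbT; lia.
  case: (ltnP (j - size l) (size m)) => join_edge ea.
    have -> : j < size l + size m by lia.
    rewrite edge_node size_cat nth_cat ltnn subnn /= ea join_edge !andbT; lia.
  have -> : j < size l + size m = false by lia.
  rewrite edge_node size_cat nth_cat.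
  have -> : (j - size m).+1 < size l = false by lia.
  have -> : (j - size m).+1 - size l = (j - size l - size m).+1 by lia.
  by rewrite /= ea andbT; lia.
- by case: j.
- rewrite edge_node [step_edge _ _]/= size_cat nth_cat /= => /andP[lj].
  case: eqP => [->|ne].
    by rewrite ltnn subnn edge_node size_cat nth_cat ltnn subnn /= => /IH ->;
      rewrite andbT; lia.
  rewrite edge_node size_cat nth_cat /= lj.
  case: ltnP => // jl.
  by have -> : j - size l = (j - size l).-1.+1 by lia.
Qed.

Lemma gstep_edge g S T : gstep g S T -> forall a, edge S a -> edge T (step_edge g a).
Proof.
case=> [/rstep_edge//|[l [r [-> ->]]] a ea].
by rewrite edge_node size_cat nth_cat size_nseq ltnn subnn /= ea size_nseq; lia.
Qed.

(** * Typed paths and the congruence on untyped words *)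

Section Req.
Variable R : step -> tree unit -> tree unit -> Prop.

Fixpoint path ws S T : Prop :=
  if ws is g :: ws then exists2 S', R g S S' & path ws S' T else S = T.

Lemma path_cat u v S T U : path u S T -> path v T U -> path (u ++ v) S U.
Proof.
elim: u S => [S /= ->//|g u IH S /= [S' gS uS] vT].
by exists S' => //; apply: IH.
Qed.

(* The dendroidal relations, restricted to the steps allowed by [R]; unlike
   [dend_eq], the case of [rstep] is stable under [At i]. *)
Inductive req : tree unit -> tree unit -> seq step -> seq step -> Prop :=
| req_sq S T T' U g h g' h' of R g S T & R h T U & R g' S T' & R h' T' U &
    (forall a, edge S a -> step_edge h (step_edge g a) = step_edge h'
      (step_edge g' a)) :
    req S U [:: g; h] [:: g'; h']
| req_sec S T g h of R g S T & R h T S &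
    (forall a, edge S a -> step_edge h (step_edge g a) = a) :
    req S S [:: g; h] [::]
| req_refl S T ws of path ws S T : req S T ws ws
| req_sym S T u v of req S T u v : req S T v u
| req_trans S T u v w of req S T u v & req S T v w : req S T u w
| req_cat S T U u u' v v' of req S T u u' & req T U v v' : req S U (u ++ v) (u' ++ v').

Lemma req_path S T u v : req S T u v -> path u S T /\ path v S T.
Proof.
elim=> //=.
- move=> {S T u v} S T T' U g h g' h' R1 R2 R3 R4 _; split.
    by exists T => //; exists U.
  by exists T' => //; exists U.
- by move=> {S T u v} S T g h R1 R2 _; split=> //; exists T => //; exists S.
- by move=> {}S {}T {}u {}v _ [].
- by move=> {}S {}T {}u {}v w _ [? _] _ [].
- move=> {}S {}T U {}u u' {}v v' _ [p1 p2] _ [q1 q2].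
  by split; apply: path_cat; eassumption.
Qed.

Lemma req_via v S T u w : req S T u v -> req S T v w -> req S T u w.
Proof. exact: req_trans. Qed.

Lemma req_catA S T a b c a' b' c' : req S T ((a ++ b) ++ c) ((a' ++ b') ++ c') ->
  req S T (a ++ b ++ c) (a' ++ b' ++ c').
Proof. by rewrite -!catA. Qed.

Lemma req_pathl S T u v : req S T u v -> path u S T. Proof. by case/req_path. Qed.
Lemma req_pathr S T u v : req S T u v -> path v S T. Proof. by case/req_path. Qed.

Lemma req_catl S T U u u' v : req S T u u' -> path v T U -> req S U (u ++ v) (u' ++ v).
Proof. by move=> ? ?; apply: req_cat; [eassumption|apply: req_refl]. Qed.

Lemma req_catr S T U u v v' : path u S T -> req T U v v' -> req S U (u ++ v) (u ++ v').
Proof. by move=> ? ?; apply: req_cat; [apply: req_refl; eassumption|]. Qed.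

Lemma req_cons S T U g v v' : R g S T -> req T U v v' -> req S U (g :: v) (g :: v').
Proof. by move=> gS; apply: (@req_catr _ _ _ [:: g]); exists T. Qed.

Lemma path1 g S T : R g S T -> path [:: g] S T.
Proof. by move=> gS; exists T. Qed.

End Req.

Arguments req_via {R} v {S T u w}.

Lemma req_mono (R R' : step -> tree unit -> tree unit -> Prop) :
  (forall g S T, R g S T -> R' g S T) ->
  forall S T u v, req R S T u v -> req R' S T u v.
Proof.
move=> RR' S T u v; elim=> {S T u v}.
- by move=> S T T' U g h g' h' /RR' ? /RR' ? /RR' ? /RR' ? ?; apply: req_sq;
  eassumption.
- by move=> S T g h /RR' ? /RR' ? ?; apply: req_sec; eassumption.
- move=> S T ws p; apply: req_refl; elim: ws S p => [//|g ws IH S /= [S' /RR' ? /IH ?]].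
  by exists S'.
- by move=> S T u v _; apply: req_sym.
- by move=> S T u v w _ ? _; apply: req_trans.
- by move=> S T U u u' v v' _ ? _; apply: req_cat.
Qed.

Lemma path_mono (R R' : step -> tree unit -> tree unit -> Prop) :
  (forall g S T, R g S T -> R' g S T) ->
  forall S T u, path R u S T -> path R' u S T.
Proof. by move=> RR' S T u p; apply: req_pathl (req_mono RR' (req_refl p)). Qed.

Definition greq S T u v (r : req rstep S T u v) : req gstep S T u v := req_mono
  rstep_gstep r.
Definition gpath S T u (p : path rstep u S T) : path gstep u S T := path_mono
  rstep_gstep p.

Lemma path_edge ws S T : path gstep ws S T -> forall a, edge S a -> edge T
  (steps_edge ws a).
Proof.
elim: ws S => [S <-//|g ws IH S /= [S' gS p] a ea].
by apply: (IH _ p); apply: gstep_edge gS _ ea.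
Qed.

Lemma req_edge S T u v : req gstep S T u v -> forall a, edge S a -> steps_edge u a =
  steps_edge v a.
Proof.
elim=> {S T u v} //.
- by move=> S T u v _ IH a /IH.
- by move=> S T u v w _ IH1 _ IH2 a ea; rewrite IH1 // IH2.
- move=> S T U u u' v v' /req_path[_ p] IH1 _ IH2 a ea; rewrite !steps_edge_cat IH1
  // IH2 //.
  exact: path_edge p _ ea.
Qed.

Lemma path_at ws S T l r : path rstep ws S T ->
  path rstep (map (At (size l)) ws) (N (l ++ S :: r)) (N (l ++ T :: r)).
Proof.
elim: ws S => [S /= ->//|g ws IH S /= [S' gS p]].
by exists (N (l ++ S' :: r)); [apply: rstep_at|apply: IH].
Qed.

Lemma pathat i ws S T S' T' l r : path rstep ws S' T' -> S = N (l ++ S' :: r) ->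
  T = N (l ++ T' :: r) -> size l = i -> path rstep (map (At i) ws) S T.
Proof. by move=> p -> -> <-; apply: path_at. Qed.

Lemma req_at S T u v l r : req rstep S T u v ->
  req rstep (N (l ++ S :: r)) (N (l ++ T :: r)) (map (At (size l)) u)
    (map (At (size l)) v).
Proof.
elim=> {S T u v}.
- move=> S T T' U g h g' h' R1 R2 R3 R4 E.
  apply: (@req_sq _ _ (N (l ++ T :: r)) (N (l ++ T' :: r))); try exact: rstep_at.
  move=> [|j a] // ea /=; case: (j =P size l) => [jl|/eqP/negbTE jl]; last
    by rewrite jl.
  move: ea; rewrite edge_node jl nth_cat ltnn subnn /= => /andP[_ /E].
  by rewrite eqxx => ->.
- move=> S T g h R1 R2 E.
  apply: (@req_sec _ _ (N (l ++ T :: r))); try exact: rstep_at.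
  move=> [|j a] // ea /=; case: (j =P size l) => [jl|/eqP/negbTE jl]; last
    by rewrite jl.
  move: ea; rewrite edge_node jl nth_cat ltnn subnn /= => /andP[_ /E].
  by rewrite eqxx => ->.
- by move=> S T ws p; apply: req_refl; apply: path_at.
- by move=> S T u v _; apply: req_sym.
- by move=> S T u v w _ ? _; apply: req_trans.
- by move=> S T U u u' v v' _ r1 _ r2; rewrite !map_cat; apply: req_cat r1 r2.
Qed.

Lemma reqat i S T S' T' u v l r : req rstep S' T' u v -> S = N (l ++ S' :: r) ->
  T = N (l ++ T' :: r) -> size l = i -> req rstep S T (map (At i) u) (map (At i) v).
Proof. by move=> p -> -> <-; apply: req_at. Qed.

(** * Squares and sections between pairs of steps *)

Ltac ifs := repeat (match goal with
  | |- context [if ?b then _ else _] => case: (boolP b) => ? //=; try (exfalso; lia)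
  end).
Ltac cons_lia := repeat apply: (f_equal2 cons); first [reflexivity|lia].
Ltac sq := case=> [|j a] //=; try (move=> _); ifs; try cons_lia.

Section Squares.
Implicit Types (l m r s : seq (tree unit)).

Lemma sq_at_at l S S' m T T' r g h : rstep g S S' -> rstep h T T' ->
  req rstep (N (l ++ S :: m ++ T :: r)) (N (l ++ S' :: m ++ T' :: r))
    [:: At (size l) g; At (size l + (size m).+1) h]
    [:: At (size l + (size m).+1) h; At (size l) g].
Proof.
move=> gS hT; apply: req_sq.
- by apply: rstep_at; eassumption.
- apply: (@atP _ _ _ _ (l ++ S' :: m)); first exact: hT.
  + by rewrite -catA. + by rewrite -catA. + by rewrite size_cat.
- apply: (@atP _ _ _ _ (l ++ S :: m)); first exact: hT.
  + by rewrite -catA. + by rewrite -catA. + by rewrite size_cat.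
- by apply: rstep_at; eassumption.
by sq.
Qed.

Lemma sq_deg S T g : rstep g S T -> req rstep (N [:: S]) T [:: At 0 g; Deg] [:: Deg; g].
Proof.
move=> gS; apply: (req_sq _ (rstep_deg T) (rstep_deg S) gS).
- exact: (@rstep_at [::] [::] g S T gS).
case=> [|[|j] a] //= _.
(* Only the root edge is left; it is fixed because no constructor of [rstep] is an [Up]. *)
by case: gS.
Qed.

(** Naturality of contraction, in three lemmas according to the place of the other step: on the
    left, over the vertex created (where [At] becomes nested) and on the right (where the index
    changes, as [size m] inputs become one). *)
Lemma sq_inner_l l S T l' m r g : rstep g S T ->
  req rstep (N ((l ++ S :: l') ++ m ++ r)) (N ((l ++ T :: l') ++ N m :: r))
    [:: At (size l) g; Inner (size l + (size l').+1) (size m)]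
    [:: Inner (size l + (size l').+1) (size m); At (size l) g].
Proof.
move=> gS; apply: req_sq.
- apply: (@atP _ _ _ _ l (l' ++ m ++ r) _ _ gS); rewrite -?catA //.
- apply: (@innerP _ _ _ _ (l ++ T :: l') m r); rewrite -?catA ?size_cat //.
- apply: (@innerP _ _ _ _ (l ++ S :: l') m r); rewrite -?catA ?size_cat //.
- apply: (@atP _ _ _ _ l (l' ++ N m :: r) _ _ gS); rewrite -?catA //.
by sq.
Qed.

Lemma sq_inner_m l m S T m' r g : rstep g S T ->
  req rstep (N (l ++ (m ++ S :: m') ++ r)) (N (l ++ N (m ++ T :: m') :: r))
    [:: At (size l + size m) g; Inner (size l) (size m + (size m').+1)]
    [:: Inner (size l) (size m + (size m').+1); At (size l) (At (size m) g)].
Proof.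
move=> gS; apply: req_sq.
- apply: (@atP _ _ _ _ (l ++ m) (m' ++ r) _ _ gS); rewrite -?catA ?size_cat //.
- apply: (@innerP _ _ _ _ l (m ++ T :: m') r); rewrite -?catA ?size_cat //.
- apply: (@innerP _ _ _ _ l (m ++ S :: m') r); rewrite -?catA ?size_cat //.
- apply: rstep_at; exact: rstep_at.
by sq.
Qed.

Lemma sq_inner_r l m r S T r' g : rstep g S T ->
  req rstep (N (l ++ m ++ r ++ S :: r')) (N (l ++ N m :: r ++ T :: r'))
    [:: At (size l + size m + size r) g; Inner (size l) (size m)]
    [:: Inner (size l) (size m); At (size l + (size r).+1) g].
Proof.
move=> gS; apply: req_sq.
- apply: (@atP _ _ _ _ (l ++ m ++ r) r' _ _ gS); rewrite -?catA ?size_cat ?addnA //.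
- apply: (@innerP _ _ _ _ l m (r ++ T :: r')); rewrite -?catA ?size_cat //.
- apply: (@innerP _ _ _ _ l m (r ++ S :: r')); rewrite -?catA ?size_cat //.
- apply: (@atP _ _ _ _ (l ++ N m :: r) r' _ _ gS); rewrite -?catA ?size_cat //.
by sq.
Qed.

Lemma sec_top : req rstep Eta Eta [:: Top 1; Deg] [::].
Proof.
apply: (@req_sec _ _ (corolla 1 tt)); [exact: rstep_top|exact: rstep_deg|by case].
Qed.

Lemma sec_root m : req rstep (N m) (N m) [:: Inner 0 (size m); Deg] [::].
Proof.
apply: (@req_sec _ _ (N [:: N m])).
- by apply: (@innerP _ _ _ _ [::] m [::]); rewrite //= cats0.
- exact: rstep_deg.
case=> [|j a] //= /andP[join_edge _]; rewrite add0n join_edge /=; by rewrite subn0.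
Qed.

Lemma sec_child l U r :
  req rstep (N (l ++ U :: r)) (N (l ++ U :: r))
    [:: Inner (size l) 1; At (size l) Deg] [::].
Proof.
apply: (@req_sec _ _ (N (l ++ N [:: U] :: r))).
- exact: (@innerP _ _ _ _ l [:: U] r).
- by apply: rstep_at; apply: rstep_deg.
by sq.
Qed.

(** Both words send the free edge to the root edge of a tree with two vertices. On one side the two
    vertices arise from a corolla by splitting, on the other side one after the other. *)
Lemma sq_top (l m r : nat) :
  req rstep Eta (N (nseq l Eta ++ corolla m tt :: nseq r Eta))
    [:: Top (l + m + r); Inner l m] [:: Top (l + 1 + r); At l (Top m)].
Proof.
apply: req_sq; first exact: rstep_top.
- by apply: (@innerP _ _ _ _ (nseq l Eta) (nseq m Eta) (nseq r Eta));
    rewrite ?size_nseq // /corolla !nseqD -!catA.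
- exact: rstep_top.
- by apply: (@atP _ _ _ _ (nseq l Eta) (nseq r Eta) _ _ (rstep_top m));
    rewrite ?size_nseq // /corolla !nseqD -!catA.
by case.
Qed.

Lemma sq_inner_inner l m s m' r :
  req rstep (N (l ++ m ++ s ++ m' ++ r)) (N (l ++ N m :: s ++ N m' :: r))
    [:: Inner (size l + size m + size s) (size m'); Inner (size l) (size m)]
    [:: Inner (size l) (size m); Inner (size l + (size s).+1) (size m')].
Proof.
apply: req_sq.
- by apply: (@innerP _ _ _ _ (l ++ m ++ s) m' r); rewrite -?catA ?size_cat ?addnA.
- by apply: (@innerP _ _ _ _ l m (s ++ N m' :: r)).
- by apply: (@innerP _ _ _ _ l m (s ++ m' ++ r)).
- by apply: (@innerP _ _ _ _ (l ++ N m :: s) m' r); rewrite -?catA ?size_cat.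
by sq.
Qed.

(** Two consecutive edges on a branch, contracted in either order; [sq_inner_inner] is the case of
    two edges that enter the same vertex. *)
Lemma sq_inner_nested l m1 m m2 r :
  req rstep (N (l ++ (m1 ++ m ++ m2) ++ r)) (N (l ++ N (m1 ++ N m :: m2) :: r))
    [:: Inner (size l + size m1) (size m); Inner (size l) (size m1 + (size m2).+1)]
    [:: Inner (size l) (size m1 + size m + size m2); At (size l)
      (Inner (size m1) (size m))].
Proof.
apply: req_sq.
- by apply: (@innerP _ _ _ _ (l ++ m1) m (m2 ++ r)); rewrite -?catA ?size_cat.
- by apply: (@innerP _ _ _ _ l (m1 ++ N m :: m2) r); rewrite -?catA ?size_cat.
- by apply: (@innerP _ _ _ _ l (m1 ++ m ++ m2) r); rewrite -?catA ?size_cat ?addnA.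
- by apply: rstep_at; apply: rstep_inner.
by sq.
Qed.

Lemma sq_up (l r : nat) S T g : rstep g S T ->
  req gstep S (N (nseq l Eta ++ T :: nseq r Eta)) [:: g; Up l r] [:: Up l r; At l g].
Proof.
move=> gS; apply: req_sq.
- exact: rstep_gstep gS.
- exact: upP.
- exact: upP.
- by apply: rstep_gstep; apply: (@atP _ _ _ _ (nseq l Eta) (nseq r Eta) _ _ gS);
  rewrite ?size_nseq.
by move=> a _ /=; rewrite eqxx.
Qed.

Lemma sec_up S : req gstep S S [:: Up 0 0; Deg] [::].
Proof. by apply: (@req_sec _ _ (N [:: S])) => //;
  [apply: upP|apply: rstep_gstep; apply: rstep_deg]. Qed.

(** Some leaves of the new root vertex, all to the left of [S], are gathered under a vertex of their
    own; alternatively a smaller root vertex is added and a corolla is put on one of its leaves.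
    [sq_up_right] is the mirror case. *)
Lemma sq_up_left (l m s r : nat) S :
  req gstep S (N (nseq l Eta ++ corolla m tt :: nseq s Eta ++ S :: nseq r Eta))
    [:: Up (l + m + s) r; Inner l m] [:: Up (l + s.+1) r; At l (Top m)].
Proof.
apply: req_sq.
- exact: upP.
- by apply: rstep_gstep; apply: (@innerP _ _ _ _ (nseq l Eta) (nseq m Eta));
   rewrite ?size_nseq ?nseqD -?catA.
- exact: upP.
- by apply: rstep_gstep; apply: (@atP _ _ _ _ (nseq l Eta)
  (nseq s Eta ++ S :: nseq r Eta) _ _ (rstep_top m));
   rewrite ?size_nseq ?nseqD -?catA.
move=> a _ /=; ifs; cons_lia.
Qed.

Lemma sq_up_right (l s m r : nat) S :
  req gstep S (N (nseq l Eta ++ S :: nseq s Eta ++ corolla m tt :: nseq r Eta))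
    [:: Up l (s + m + r); Inner (l + s.+1) m]
      [:: Up l (s + r.+1); At (l + s.+1) (Top m)].
Proof.
apply: req_sq.
- exact: upP.
- by apply: rstep_gstep; apply: (@innerP _ _ _ _ (nseq l Eta ++ S :: nseq s Eta)
  (nseq m Eta));
   rewrite ?size_cat /= ?size_nseq ?nseqD -?catA.
- exact: upP.
- by apply: rstep_gstep; apply: (@atP _ _ _ _ (nseq l Eta ++ S :: nseq s Eta)
  (nseq r Eta) _ _ (rstep_top m));
   rewrite ?size_cat /= ?size_nseq ?nseqD -?catA.
move=> a _ /=; ifs; cons_lia.
Qed.

(** Splitting the new root vertex along an edge below [S] amounts to adding two root vertices in
    turn. *)
Lemma sq_up_up (l l' r' r : nat) S :
  req gstep S (N (nseq l Eta ++ N (nseq l' Eta ++ S :: nseq r' Eta) :: nseq r Eta))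
    [:: Up (l + l') (r' + r); Inner l (l' + r'.+1)] [:: Up l' r'; Up l r].
Proof.
apply: req_sq.
- exact: upP.
- by apply: rstep_gstep; apply: (@innerP _ _ _ _ (nseq l Eta)
  (nseq l' Eta ++ S :: nseq r' Eta) (nseq r Eta));
   rewrite ?size_cat /= ?size_nseq ?nseqD -?catA.
- exact: upP.
- exact: upP.
move=> a _ /=; ifs; cons_lia.
Qed.

End Squares.

(** * Words acting over several inputs *)

(** The words of [wss] one after the other, the [j]-th of them relocated by [phi (k + j)]. The
    parameter [phi] covers inputs of the root, shifted inputs, and inputs of a vertex one level
    higher. *)
Fixpoint gpar (phi : nat -> step -> step) k (wss : seq (seq step)) : seq step :=
  if wss is ws :: wss then map (phi k) ws ++ gpar phi k.+1 wss else [::].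

Notation par := (gpar At).

Lemma gpar_cat phi k u v : gpar phi k (u ++ v) = gpar phi k u ++ gpar phi
  (k + size u) v.
Proof.
elim: u k => [|w u IH] k /=; first by rewrite addn0.
by rewrite IH catA addSnnS.
Qed.

Lemma gpar_shift i k wss : gpar (fun j => At (i + j)) k wss = par (i + k) wss.
Proof. by elim: wss k => //= w wss IH k; rewrite IH addnS. Qed.

Lemma gpar_at i k wss : gpar (fun j g => At i (At j g)) k wss = map (At i) (par k wss).
Proof. by elim: wss k => //= w wss IH k; rewrite IH map_cat -map_comp. Qed.

Lemma par_nil k n : par k (nseq n [::]) = [::].
Proof. by elim: n k => //= n IH k; rewrite IH. Qed.

Inductive paths : seq (seq step) -> seq (tree unit) -> seq (tree unit) -> Prop :=
| paths_nil : paths [::] [::] [::]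
| paths_cons ws wss s ss t ts of path rstep ws s t & paths wss ss ts :
    paths (ws :: wss) (s :: ss) (t :: ts).

Lemma paths_size wss ss ts : paths wss ss ts -> size wss = size ss /\ size ts = size ss.
Proof. by elim=> {wss ss ts} //= ws wss s ss t ts _ _ [-> ->]. Qed.

Lemma parP k S T pre ss ts post wss : paths wss ss ts ->
  S = N (pre ++ ss ++ post) -> T = N (pre ++ ts ++ post) -> size pre = k ->
  path rstep (par k wss) S T.
Proof.
move=> p -> -> <- {S T k}; elim: p pre => [|ws {}wss s {}ss t {}ts p _ IH] pre //=.
apply: (@path_cat _ _ _ _ (N (pre ++ t :: ss ++ post))).
  exact: (@pathat _ _ _ _ _ _ pre (ss ++ post) p).
by have := IH (rcons pre t); rewrite size_rcons !cat_rcons.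
Qed.

Lemma paths_cat u v ss1 ss2 ts1 ts2 : paths u ss1 ts1 -> paths v ss2 ts2 ->
  paths (u ++ v) (ss1 ++ ss2) (ts1 ++ ts2).
Proof.
by move=> pu pv; elim: pu => //= ws wss s ss t ts p _ IH; apply: paths_cons.
Qed.

Lemma req_mid R S T T' U u v v' w : path R u S T -> req R T T' v v' ->
  path R w T' U -> req R S U (u ++ v ++ w) (u ++ v' ++ w).
Proof. by move=> pu r pw; apply: req_catr pu (req_catl r pw). Qed.

Section Slide.
Variable R : step -> tree unit -> tree unit -> Prop.

(** A step [h] that is natural with respect to single steps is natural with respect to words. [F]
    and [G] are the contexts before and after [h], and [phi] and [psi] relocate a step into them. *)
Lemma slide (F G : tree unit -> tree unit) (phi psi : step -> step) h :
  (forall g S T, rstep g S T -> req R (F S) (G T) [:: phi g; h] [:: h; psi g]) ->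
  (forall S, R h (F S) (G S)) ->
  (forall g S T, rstep g S T -> R (phi g) (F S) (F T)) ->
  (forall g S T, rstep g S T -> R (psi g) (G S) (G T)) ->
  forall ws S T, path rstep ws S T ->
    req R (F S) (G T) (map phi ws ++ [:: h]) (h :: map psi ws).
Proof.
move=> H Hh Hphi Hpsi; elim=> [|g ws IH] S T /=.
  by move=> ->; apply: req_refl; apply: path1.
case=> S' gS p; apply: (req_trans (req_cons (Hphi _ _ _ gS) (IH _ _ p))).
apply: (@req_catl _ _ _ _ [:: phi g; h] [:: h; psi g] _ (H _ _ _ gS)).
elim: ws S' {gS IH} p => [_ -> //|g' ws IH S' /= [S'' gS' p]].
by exists (G S''); [apply: Hpsi|apply: IH].
Qed.

(** The version of [slide] for a family of words over consecutive positions. The last words pass [h]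
    first, since they stand next to it. *)
Lemma slides n (F G : seq (tree unit) -> tree unit) (phi psi : nat -> step -> step) h :
  (forall pre post g S T, rstep g S T -> size (pre ++ S :: post) = n ->
     req R (F (pre ++ S :: post)) (G (pre ++ T :: post))
       [:: phi (size pre) g; h] [:: h; psi (size pre) g]) ->
  (forall ss, size ss = n -> R h (F ss) (G ss)) ->
  (forall pre post g S T, rstep g S T -> size (pre ++ S :: post) = n ->
     R (phi (size pre) g) (F (pre ++ S :: post)) (F (pre ++ T :: post))) ->
  (forall pre post g S T, rstep g S T -> size (pre ++ S :: post) = n ->
     R (psi (size pre) g) (G (pre ++ S :: post)) (G (pre ++ T :: post))) ->
  forall wss ss ts, paths wss ss ts -> forall pre, size (pre ++ ss) = n ->
    req R (F (pre ++ ss)) (G (pre ++ ts))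
      (gpar phi (size pre) wss ++ [:: h]) (h :: gpar psi (size pre) wss).
Proof.
move=> H Hh Hphi Hpsi wss ss ts ps.
have sz' pre s u vs : size (pre ++ s :: vs) = n -> size (pre ++ u :: vs) = n.
  by rewrite !size_cat.
have pathg (f : nat -> step -> step) (K : seq (tree unit) -> tree unit) :
  (forall pre post g S T, rstep g S T -> size (pre ++ S :: post) = n ->
     R (f (size pre) g) (K (pre ++ S :: post)) (K (pre ++ T :: post))) ->
  forall wss ss ts, paths wss ss ts -> forall pre, size (pre ++ ss) = n ->
  path R (gpar f (size pre) wss) (K (pre ++ ss)) (K (pre ++ ts)).
  move=> HK {wss ss ts ps} wss ss ts.
  elim=> [|ws {}wss s {}ss t {}ts p _ IH] pre sz //=.
  apply: (@path_cat _ _ _ _ (K (pre ++ t :: ss))); last first.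
    by have := IH (rcons pre t); rewrite size_rcons !cat_rcons; apply; apply: sz' sz.
  elim: ws s p sz => [s /= -> //|g ws IHw s /= [s' gs p]] sz.
  by exists (K (pre ++ s' :: ss)); [apply: HK|apply: IHw => //; apply: sz' sz].
elim: ps => [|ws {}wss s {}ss t {}ts p ps IH] pre sz /=.
  by apply: req_refl; apply: path1; apply: Hh.
have szt := sz' _ _ _ t _ sz.
have := IH (rcons pre t); rewrite size_rcons !cat_rcons => /(_ szt) IH'.
rewrite -catA; apply: (req_via
  (map (phi (size pre)) ws ++ h :: gpar psi (size pre).+1 wss)).
  apply: req_catr IH'; elim: ws s p sz => [s /= -> //|g ws IHw s /= [s' gs p]] sz.
  by exists (F (pre ++ s' :: ss)); [apply: Hphi|apply: IHw => //; apply: sz' sz].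
rewrite -cat_cons -(cat_rcons h) -cats1.
apply: (@req_catl _ _ (G (pre ++ t :: ss))).
  apply: (@slide (fun x => F (pre ++ x :: ss)) (fun x => G (pre ++ x :: ss))
    _ _ _ _ _ _ _ _ _ _ p) => *.
  - by apply: H => //; apply: sz' sz.
  - by apply: Hh => //; apply: sz' sz.
  - by apply: Hphi => //; apply: sz' sz.
  - by apply: Hpsi => //; apply: sz' sz.
by have := pathg _ _ Hpsi _ _ _ ps (rcons pre t); rewrite size_rcons !cat_rcons; apply.
Qed.

End Slide.

Lemma deg_word ws S T : path rstep ws S T ->
  req rstep (N [:: S]) T (map (At 0) ws ++ [:: Deg]) (Deg :: ws).
Proof.
move=> p; have := @slide rstep (fun S => N [:: S]) id (At 0) id Deg.
move=> /(_ _ _ _ _ ws S T p); rewrite map_id; apply=>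
  [g S1 T1 gS|S1|g S1 T1 gS|g S1 T1 gS].
- exact: sq_deg.
- exact: rstep_deg.
- by apply: (@rstep_at [::] [::]).
- by [].
Qed.

Lemma up_word l r ws S T : path rstep ws S T ->
  req gstep S (N (nseq l Eta ++ T :: nseq r Eta)) (ws ++ [:: Up l r])
    (Up l r :: map (At l) ws).
Proof.
move=> p; have := @slide gstep id (fun S => N (nseq l Eta ++ S :: nseq r Eta)) id
  (At l) (Up l r).
move=> /(_ _ _ _ _ ws S T p); rewrite map_id; apply=>
  [g S1 T1 gS|S1|g S1 T1 gS|g S1 T1 gS].
- exact: sq_up.
- exact: upP.
- exact: rstep_gstep.
- by apply: rstep_gstep; apply: atP; rewrite ?size_nseq //; eassumption.
Qed.

Lemma inner_l l l' m r ws S T i j k : path rstep ws S T ->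
  size l = i -> size l + (size l').+1 = j -> size m = k ->
  req rstep (N (l ++ S :: l' ++ m ++ r)) (N (l ++ T :: l' ++ N m :: r))
    (map (At i) ws ++ [:: Inner j k]) (Inner j k :: map (At i) ws).
Proof.
move=> p <- <- <-.
have := @slide rstep (fun S => N ((l ++ S :: l') ++ m ++ r))
  (fun S => N ((l ++ S :: l') ++ N m :: r)) (At (size l)) (At (size l))
  (Inner (size l + (size l').+1) (size m)).
move=> /(_ _ _ _ _ ws S T p); rewrite -!catA !cat_cons; apply=>
  [g S1 T1 gS|S1|g S1 T1 gS|g S1 T1 gS].
- exact: sq_inner_l.
- by apply: (@innerP _ _ _ _ (l ++ S1 :: l') m r); rewrite ?size_cat.
- by apply: (@atP _ _ _ _ l (l' ++ m ++ r) _ _ gS); rewrite -?catA.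
- by apply: (@atP _ _ _ _ l (l' ++ N m :: r) _ _ gS); rewrite -?catA.
Qed.

Lemma inner_m l m m' r ws S T i j k : path rstep ws S T ->
  size l = i -> size m = j -> size m + (size m').+1 = k ->
  req rstep (N (l ++ m ++ S :: m' ++ r)) (N (l ++ N (m ++ T :: m') :: r))
    (map (At (i + j)) ws ++ [:: Inner i k]) (Inner i k :: map (At i) (map (At j) ws)).
Proof.
move=> p <- <- <-.
have := @slide rstep (fun S => N (l ++ (m ++ S :: m') ++ r))
  (fun S => N (l ++ N (m ++ S :: m') :: r)) (At (size l + size m))
  (fun g => At (size l) (At (size m) g))
  (Inner (size l) (size m + (size m').+1)).
move=> /(_ _ _ _ _ ws S T p); rewrite -!catA !cat_cons -map_comp; apply=>
  [g S1 T1 gS|S1|g S1 T1 gS|g S1 T1 gS].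
- exact: sq_inner_m.
- by apply: (@innerP _ _ _ _ l (m ++ S1 :: m') r); rewrite ?size_cat.
- by apply: (@atP _ _ _ _ (l ++ m) (m' ++ r) _ _ gS); rewrite -?catA ?size_cat.
- by apply: rstep_at; apply: rstep_at.
Qed.

Lemma inner_r l m r r' ws S T i j j' k : path rstep ws S T ->
  size l = i -> size m = k -> size l + size m + size r = j ->
  size l + (size r).+1 = j' ->
  req rstep (N (l ++ m ++ r ++ S :: r')) (N (l ++ N m :: r ++ T :: r'))
    (map (At j) ws ++ [:: Inner i k]) (Inner i k :: map (At j') ws).
Proof.
move=> p <- <- <- <-.
have := @slide rstep (fun S => N (l ++ m ++ r ++ S :: r'))
  (fun S => N (l ++ N m :: r ++ S :: r')) (At (size l + size m + size r))
  (At (size l + (size r).+1))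
  (Inner (size l) (size m)).
move=> /(_ _ _ _ _ ws S T p); apply=> [g S1 T1 gS|S1|g S1 T1 gS|g S1 T1 gS].
- exact: sq_inner_r.
- exact: (@innerP _ _ _ _ l m (r ++ S1 :: r')).
- by apply: (@atP _ _ _ _ (l ++ m ++ r) r' _ _ gS); rewrite -?catA ?size_cat ?addnA.
- by apply: (@atP _ _ _ _ (l ++ N m :: r) r' _ _ gS); rewrite -?catA ?size_cat.
Qed.

(** Words over all inputs of the root pass a contraction. Those over the block [m] come to lie over
    the inputs of the new vertex, whence the nested [par 0 wm]. *)
Lemma inner_par wl wm wr l m r l' m' r' i k :
  paths wl l l' -> paths wm m m' -> paths wr r r' -> size l = i -> size m = k ->
  req rstep (N (l ++ m ++ r)) (N (l' ++ N m' :: r'))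
    (par 0 (wl ++ wm ++ wr) ++ [:: Inner i k])
    (Inner i k :: par 0 (wl ++ par 0 wm :: wr)).
Proof.
move=> pl pm pr Ei Ek.
have [wli li] := paths_size pl; have [wmi mi] := paths_size pm.
rewrite !gpar_cat /= add0n wli wmi Ei -!catA.
(* [Inner] moves to the front past the words over [r], then those over [m], then those over [l]; at
   each stage the blocks whose words come earlier are already mapped. *)
have R1 : req rstep (N (l' ++ m' ++ r)) (N (l' ++ N m' :: r'))
   (par (i + size m) wr ++ [:: Inner i k]) (Inner i k :: par i.+1 wr).
  have := @slides rstep (size r) (fun r => N (l' ++ m' ++ r))
    (fun r => N (l' ++ N m' :: r))
    (fun j => At (i + size m + j)) (fun j => At (i.+1 + j)) (Inner i k).
  move=> /(_ _ _ _ _ wr r r' pr [::] (erefl _)) /=.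
  rewrite !gpar_shift !addn0; apply=>
    [pre post g S T gS _|ss _|pre post g S T gS _|pre post g S T gS _].
  - rewrite addSnnS -Ei -Ek -li -mi; exact: sq_inner_r.
  - by apply: (@innerP _ _ _ _ l' m' ss) => //; lia.
  - by apply: (@atP _ _ _ _ (l' ++ m' ++ pre) post _ _ gS); rewrite -?catA ?size_cat
    //; lia.
  - by apply: (@atP _ _ _ _ (l' ++ N m' :: pre) post _ _ gS); rewrite -?catA
    ?size_cat //=; lia.
have R2 : req rstep (N (l' ++ m ++ r)) (N (l' ++ N m' :: r))
   (par i wm ++ [:: Inner i k]) (Inner i k :: map (At i) (par 0 wm)).
  have := @slides rstep (size m) (fun m => N (l' ++ m ++ r))
    (fun m => N (l' ++ N m :: r))
    (fun j => At (i + j)) (fun j g => At i (At j g)) (Inner i k).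
  move=> /(_ _ _ _ _ wm m m' pm [::] (erefl _)) /=.
  rewrite gpar_shift gpar_at addn0; apply=>
    [pre post g S T gS sz|ss sz|pre post g S T gS sz|pre post g S T gS sz].
  - have -> : k = size pre + (size post).+1 by rewrite -Ek -sz size_cat.
    by rewrite -Ei -li; apply: sq_inner_m.
  - by apply: (@innerP _ _ _ _ l' ss r) => //; lia.
  - by apply: (@atP _ _ _ _ (l' ++ pre) (post ++ r) _ _ gS); rewrite -?catA ?size_cat
    //; lia.
  - rewrite -Ei -li; apply: rstep_at; exact: rstep_at.
have R3 : req rstep (N (l ++ m ++ r)) (N (l' ++ N m :: r))
   (par 0 wl ++ [:: Inner i k]) (Inner i k :: par 0 wl).
  have := @slides rstep (size l) (fun l => N (l ++ m ++ r)) (fun l => N (l ++ N m :: r))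
    At At (Inner i k).
  move=> /(_ _ _ _ _ wl l l' pl [::] (erefl _)) /=.
  apply=> [pre post g S T gS sz|ss sz|pre post g S T gS sz|pre post g S T gS sz].
  - rewrite -Ek -Ei -sz size_cat; exact: sq_inner_l.
  - by apply: (@innerP _ _ _ _ ss m r) => //; lia.
  - by apply: (@atP _ _ _ _ pre (post ++ m ++ r) _ _ gS); rewrite -?catA.
  - by apply: (@atP _ _ _ _ pre (post ++ N m :: r) _ _ gS); rewrite -?catA.
have pl0 := parP (k := 0) (pre := [::]) pl (erefl (N (l ++ m ++ r))) erefl erefl.
have pm0 := parP (k := i) (pre := l') pm (erefl (N (l' ++ m ++ r))) erefl
  (etrans li Ei).
apply: (req_trans (req_catr pl0 (req_catr pm0 R1))).
rewrite -(cat_rcons (Inner i k)) -cats1.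
apply: (req_via (par 0 wl ++ (Inner i k :: map (At i) (par 0 wm)) ++ par i.+1 wr)).
  apply: (req_mid pl0 R2).
  by apply: (parP pr (pre := rcons l' (N m')) (post := [::]));
    rewrite ?cat_rcons ?cats0 ?size_rcons ?li ?Ei.
rewrite cat_cons -(cat_rcons (Inner i k)) -cats1
  -[Inner i k :: par 0 wl ++ _]cat_cons; apply: (req_catl R3).
apply: (@path_cat _ _ _ _ (N (l' ++ N m' :: r))).
  have pm1 : path rstep (par 0 wm) (N m) (N m').
    by apply: (parP (pre := [::]) (post := [::]) pm); rewrite ?cats0.
  by apply: (pathat pm1 (l := l') (r := r)) => //; rewrite li.
by apply: (parP pr (pre := rcons l' (N m')) (post := [::]));
  rewrite ?cat_rcons ?cats0 ?size_rcons ?li ?Ei.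
Qed.

Lemma at_words u v l S S' m T T' r i j : path rstep u S S' -> path rstep v T T' ->
  size l = i -> size l + (size m).+1 = j ->
  req rstep (N (l ++ S :: m ++ T :: r)) (N (l ++ S' :: m ++ T' :: r))
    (map (At i) u ++ map (At j) v) (map (At j) v ++ map (At i) u).
Proof.
move=> pu pv Ei Ej.
have pathv S1 T1 T2 w : path rstep w T1 T2 ->
    path rstep (map (At j) w) (N (l ++ S1 :: m ++ T1 :: r))
      (N (l ++ S1 :: m ++ T2 :: r)).
  move=> p; apply: (pathat p (l := l ++ S1 :: m) (r := r)); by rewrite -?catA ?size_cat.
elim: v T pv => [T /= ->|h v IH T /= [T1 hT pv]].
  by rewrite cats0; apply: req_refl; rewrite -Ei; apply: path_at.
apply: (req_via (At j h :: map (At i) u ++ map (At j) v)); last first.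
  apply: (req_cons _ (IH _ pv)).
  by apply: (@atP _ _ _ _ (l ++ S :: m) r _ _ hT); rewrite -?catA ?size_cat.
rewrite -(cat_rcons (At j h)) -cats1 -[At j h :: _ ++ _]cat_cons;
  apply: (req_catl _ (pathv _ _ _ _ pv)).
have := @slide rstep (fun S => N (l ++ S :: m ++ T :: r))
  (fun S => N (l ++ S :: m ++ T1 :: r))
  (At i) (At i) (At j h).
move=> /(_ _ _ _ _ u S S' pu); apply=> [g S1 S2 gS|S1|g S1 S2 gS|g S1 S2 gS].
- by rewrite -Ei -Ej; apply: sq_at_at.
- by apply: (@atP _ _ _ _ (l ++ S1 :: m) r _ _ hT); rewrite -?catA ?size_cat.
- by apply: (atP gS).
- by apply: (atP gS).
Qed.

Lemma at_par u wss l S S' m ss ts r i j : path rstep u S S' -> paths wss ss ts ->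
  size l = i -> size l + (size m).+1 = j ->
  req rstep (N (l ++ S :: m ++ ss ++ r)) (N (l ++ S' :: m ++ ts ++ r))
    (map (At i) u ++ par j wss) (par j wss ++ map (At i) u).
Proof.
move=> pu ps Ei; elim: ps m j => [|v {}wss s {}ss t {}ts pv ps IH] m j Ej /=.
  by rewrite cats0; apply: req_refl; rewrite -Ei; apply: path_at.
rewrite catA -[_ ++ map (At i) u]catA.
have := IH (rcons m t) j.+1; rewrite !cat_rcons size_rcons => IH'.
apply: (req_trans _ (req_catr _ (IH' _))); last by lia.
  rewrite [RHS in req _ _ _ _ RHS]catA; apply: req_catl; first
    exact: (at_words _ pu pv Ei Ej).
  by apply: (parP (pre := l ++ S' :: m ++ [:: t]) ps (post := r));
    rewrite -?catA //= -?catA // size_cat /= size_cat /=; lia.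
by apply: (pathat pv (l := l ++ S :: m) (r := ss ++ r)); rewrite -?catA ?size_cat //;
  lia.
Qed.

(* A word from the free edge to [t], preserving the root. *)
Fixpoint grow (t : tree unit) : seq step :=
  match t with
  | Eta => [::]
  | Node _ ts => Top (size ts) ::
      (fix go k ts := match ts with
       | [::] => [::]
       | t :: ts => map (At k) (grow t) ++ go k.+1 ts
       end) 0 ts
  end.

Lemma grow_node_word ts : grow (N ts) = Top (size ts) :: par 0 (map grow ts).
Proof. by rewrite /=; congr cons; elim: ts (0) => //= t ts IH k; rewrite IH. Qed.

(* A word from [N ts] to [graft D ts]: it depends only on [D]. *)
Fixpoint blow (D : tree unit) : seq step :=
  match D with
  | Eta => [:: Deg]
  | Node _ ds =>
      (fix go k ds := match ds with
       | [::] => [::]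
       | d :: ds => Inner k (nleaves d) :: map (At k) (blow d) ++ go k.+1 ds
       end) 0 ds
  end.

Fixpoint blows k (ds : seq (tree unit)) : seq step :=
  if ds is d :: ds then Inner k (nleaves d) :: map (At k) (blow d) ++ blows k.+1 ds
  else [::].

Lemma blow_node ds : blow (N ds) = blows 0 ds.
Proof. by rewrite /=; elim: ds (0) => //= d ds IH k; rewrite IH. Qed.

Lemma grow_path : (forall t, path rstep (grow t) Eta t) *
  (forall ts, paths (map grow ts) (nseq (size ts) Eta) ts).
Proof.
apply: tree_forest_ind => [//|[] ts p||t ts pt ps].
- rewrite grow_node_word; exists (corolla (size ts) tt); first exact: rstep_top.
  by apply: (parP (pre := [::]) (post := [::]) p); rewrite ?cats0.
- exact: paths_nil.
- exact: paths_cons.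
Qed.

Lemma blow_path :
  (forall D ts, size ts = nleaves D -> path rstep (blow D) (N ts) (graft D ts)) *
  (forall ds ts pre k, size ts = sumn (map (@nleaves unit) ds) -> size pre = k ->
     path rstep (blows k ds) (N (pre ++ ts)) (N (pre ++ grafts ds ts))).
Proof.
apply: tree_forest_ind => [[|t []] //= _|[] ds IH ts sz|[]//|d ds IHd IHds ts pre k].
- by exists t => //; apply: rstep_deg.
- rewrite blow_node; exact: (IH ts [::]).
move=> /split_size[t1 [t2 [-> s1 s2]]] sk; rewrite grafts_cons //=.
exists (N (pre ++ N t1 :: t2)); first exact: (@innerP _ _ _ _ pre t1 t2).
apply: (@path_cat _ _ _ _ (N (pre ++ graft d t1 :: t2))).
  exact: (pathat (IHd _ s1) (l := pre) (r := t2)).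
by have := IHds t2 (rcons pre (graft d t1)) k.+1 s2; rewrite !cat_rcons size_rcons
  sk; apply.
Qed.

Lemma at_blows u l S S' m ds ts i k : path rstep u S S' ->
  size ts = sumn (map (@nleaves unit) ds) ->
  size l = i -> size l + (size m).+1 = k ->
  req rstep (N (l ++ S :: m ++ ts)) (N (l ++ S' :: m ++ grafts ds ts))
    (map (At i) u ++ blows k ds) (blows k ds ++ map (At i) u).
Proof.
move=> pu sz Ei; elim: ds ts sz m k => [|d ds IH] ts sz m k Ek.
  by case: ts sz => //= _; rewrite !cats0; apply: req_refl; rewrite -Ei; apply: path_at.
move: sz => /split_size[t1 [t2 [-> s1 s2]]]; rewrite grafts_cons //=.
apply: (req_via (Inner k (nleaves d) :: map (At i) u ++ map (At k) (blow d) ++ blows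
  k.+1 ds)).
  rewrite -(cat_rcons (Inner k (nleaves d))) -cats1 -[Inner _ _ :: _ ++ _]cat_cons;
    apply: req_catl; first exact: (inner_l t2 pu Ei Ek s1).
  apply: (@path_cat _ _ _ _ (N (l ++ S' :: m ++ graft d t1 :: t2))).
    by apply: (pathat (blow_path.1 d t1 s1) (l := l ++ S' :: m)); rewrite -?catA
      ?size_cat.
  have := blow_path.2 ds t2 (l ++ S' :: rcons m (graft d t1)) k.+1 s2.
  by rewrite -!catA /= !cat_rcons; apply; rewrite size_cat /= size_rcons; lia.
apply: req_cons.
  by apply: (@innerP _ _ _ _ (l ++ S :: m) t1 t2); rewrite -?catA ?size_cat.
have := IH t2 s2 (rcons m (graft d t1)) k.+1; rewrite !cat_rcons size_rcons => IH'.
rewrite -[_ ++ map (At i) u]catA; apply: (req_trans _ (req_catr _ (IH' _))); last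
  by lia.
  apply: req_catA; apply: req_catl; first
    exact: (at_words t2 pu (blow_path.1 d t1 s1) Ei Ek).
  have := blow_path.2 ds t2 (l ++ S' :: rcons m (graft d t1)) k.+1 s2.
  by rewrite -!catA /= !cat_rcons; apply; rewrite size_cat /= size_rcons; lia.
by apply: (pathat (blow_path.1 d t1 s1) (l := l ++ S :: m)); rewrite -?catA ?size_cat.
Qed.

Lemma blowsP ds ts pre k S T : size ts = sumn (map (@nleaves unit) ds) -> size pre =
  k ->
  S = N (pre ++ ts) -> T = N (pre ++ grafts ds ts) -> path rstep (blows k ds) S T.
Proof. by move=> sz sk -> ->; apply: blow_path.2. Qed.

(** * Replacement of vertices after a contraction *)

Section Insert.
Variable D' : tree unit.

(** Grafting this list puts [D'] on leaf number [l] and leaves the other leaves free. *)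
Definition punct l r : seq (tree unit) := nseq l Eta ++ D' :: nseq r Eta.

(** Splitting a vertex in two and replacing the upper half by [D'] and the lower half by [D] is
    replacing it at once by [D] with [D'] on one leaf. The induction on [D] pushes the splitting
    into the tree of the forest that contains this leaf; [pre] holds the inputs already dealt
    with. *)
Lemma inner_blow :
  (forall D tl tm tr, size tm = nleaves D' -> size tl + (size tr).+1 = nleaves D ->
     req rstep (N (tl ++ tm ++ tr)) (graft D (tl ++ graft D' tm :: tr))
       (Inner (size tl) (size tm) :: map (At (size tl)) (blow D') ++ blow D)
       (blow (graft D (punct (size tl) (size tr))))) *
  (forall ds pre tl tm tr p l, size tm = nleaves D' ->
     size tl + (size tr).+1 = sumn (map (@nleaves unit) ds) ->
     size pre = p -> size tl = l ->
     req rstep (N (pre ++ tl ++ tm ++ tr))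
       (N (pre ++ grafts ds (tl ++ graft D' tm :: tr)))
       (Inner (p + l) (size tm) :: map (At (p + l)) (blow D') ++ blows p ds)
       (blows p (grafts ds (punct l (size tr))))).
Proof.
apply: tree_forest_ind.
(* [D] is the free edge: the splitting creates a unary root vertex, which [Deg] removes again. *)
- move=> [|? [|? ?]] tm [|? ?] //= sm _; rewrite !cats0.
  apply: (req_via [:: Inner 0 (size tm), Deg & blow D']).
    apply: (@req_cons _ _ (N [:: N tm])).
      by apply: (@innerP _ _ _ _ [::] tm [::]); rewrite ?cats0.
    by apply: deg_word; apply: blow_path.1.
  apply: (@req_catl _ _ _ _ [:: Inner 0 (size tm); Deg] [::] (blow D')); first
    exact: sec_root.
  exact: blow_path.1.
- move=> [] ds IH tl tm tr sm sz; rewrite !graft_node !blow_node.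
  exact: (IH [::] tl tm tr 0).
- by move=> pre [|? ?].
move=> d ds IHd IHds pre tl tm tr p l sm /= sz sp sl.
have pI : path rstep (blow D') (N tm) (graft D' tm) by apply: blow_path.1.
set n := nleaves d; set k := size tm.
case: (ltnP l n) => ld.
(* The leaf lies in the first tree [d]: the two edges concerned are nested, and the induction
   hypothesis for [d] applies over the input [p]. *)
- have /split_size[tr1 [tr2 [Etr s1 s2]]] :
    size tr = (n - l.+1) + sumn (map (@nleaves unit) ds) by rewrite /n in ld *; lia.
  subst tr.
  have En : size tl + (size tr1).+1 = n by lia.
  have sd : size (tl ++ graft D' tm :: tr1) = nleaves d by rewrite size_cat /=; lia.
  have -> : (take n (tl ++ graft D' tm :: tr1 ++ tr2)) = tl ++ graft D' tm :: tr1.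
    by rewrite -cat_cons catA take_size_cat.
  have -> : (drop n (tl ++ graft D' tm :: tr1 ++ tr2)) = tr2.
    by rewrite -cat_cons catA drop_size_cat.
  have Ep : punct l (size (tr1 ++ tr2)) = punct l (size tr1) ++ nseq (size tr2) Eta.
    by rewrite /punct size_cat nseqD -catA.
  have sp' : size (punct l (size tr1)) = n by rewrite size_cat /= !size_nseq; lia.
  rewrite Ep take_size_cat // drop_size_cat // s2 (graft_eta unit).2.
  have -> : nleaves (graft d (punct l (size tr1))) = size tl + k + size tr1.
    rewrite (nleaves_graft _).1 // map_cat sumn_cat /= !map_nseq !sumn_nseq !mul1n
      /k; lia.
  apply: (req_via [:: Inner (p + l) k, Inner p n &
      map (At p) (map (At l) (blow D')) ++ map (At p) (blow d) ++ blows p.+1 ds]).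
    apply: (@req_cons _ _ (N (pre ++ tl ++ N tm :: tr1 ++ tr2))).
      by apply: (@innerP _ _ _ _ (pre ++ tl) tm); rewrite -?catA ?size_cat //; lia.
    rewrite -(cat_rcons (Inner p n)) -cats1 -[Inner p n :: _ ++ _]cat_cons.
    apply: (@req_catl _ _ (N (pre ++ N (tl ++ graft D' tm :: tr1) :: tr2))).
      exact: inner_m.
    apply: (@path_cat _ _ _ _ (N (pre ++ graft d (tl ++ graft D' tm :: tr1) :: tr2))).
      exact: (pathat (blow_path.1 d _ sd) (l := pre) (r := tr2)).
    by apply: (blowsP (ds := ds) (ts := tr2) s2
      (pre := rcons pre (graft d (tl ++ graft D' tm :: tr1))));
      rewrite ?size_rcons ?cat_rcons ?sp.
  apply: (req_via ([:: Inner p (size tl + k + size tr1); At p (Inner l k)] ++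
      map (At p) (map (At l) (blow D')) ++ map (At p) (blow d) ++ blows p.+1 ds)).
    apply: (@req_catl _ _ (N (pre ++ N (tl ++ N tm :: tr1) :: tr2)) _
      [:: Inner (p + l) k; Inner p n]).
      have := sq_inner_nested pre tl tm tr1 tr2.
      by rewrite sp En sl -!catA.
    apply: (@path_cat _ _ _ _ (N (pre ++ N (tl ++ graft D' tm :: tr1) :: tr2))).
      exact: (pathat (pathat pI (l := tl) (r := tr1) erefl erefl sl) (l := pre)
        (r := tr2)).
    apply: (@path_cat _ _ _ _ (N (pre ++ graft d (tl ++ graft D' tm :: tr1) :: tr2))).
      exact: (pathat (blow_path.1 d _ sd) (l := pre) (r := tr2)).
    by apply: (blowsP (ds := ds) (ts := tr2) s2
      (pre := rcons pre (graft d (tl ++ graft D' tm :: tr1))));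
      rewrite ?size_rcons ?cat_rcons ?sp.
  apply: (@req_cons _ _ (N (pre ++ N (tl ++ tm ++ tr1) :: tr2))).
    by apply: (@innerP _ _ _ _ pre (tl ++ tm ++ tr1)); rewrite -?catA ?size_cat //; lia.
  have := IHd tl tm tr1 sm En; rewrite sl => IHd'.
  have := reqat (l := pre) (r := tr2) IHd' erefl erefl sp; rewrite /= map_cat => IHp.
  rewrite -/k -cat_cons [X in req _ _ _ X _]catA.
  apply: (req_catl IHp).
  by apply: (blowsP (ds := ds) (ts := tr2) s2
    (pre := rcons pre (graft d (tl ++ graft D' tm :: tr1))));
      rewrite ?size_rcons ?cat_rcons ?sp.
(* The leaf lies beyond [d]: the two edges enter the same vertex, and all that belongs to [d] is
   moved to the front. *)
have /split_size[tl1 [tl2 [Etl s1 s2]]] : size tl = n + (l - n) by lia.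
subst tl; rewrite -!catA take_size_cat // drop_size_cat //.
have -> : punct l (size tr) = nseq n Eta ++ punct (l - n) (size tr).
  by rewrite /punct catA -nseqD subnKC.
rewrite take_size_cat ?size_nseq // drop_size_cat ?size_nseq // (graft_eta unit).1.
set j := p.+1 + (l - n).
have sz2 : size (tl2 ++ graft D' tm :: tr) = sumn (map (@nleaves unit) ds).
  by move: sz; rewrite !size_cat /= -/n; lia.
have pL : path rstep (blows p.+1 ds)
  (N (pre ++ graft d tl1 :: tl2 ++ graft D' tm :: tr))
   (N (pre ++ graft d tl1 :: grafts ds (tl2 ++ graft D' tm :: tr))).
  by apply: (blowsP sz2 (pre := rcons pre (graft d tl1))); rewrite ?size_rcons
    ?cat_rcons ?sp.
have pd X : path rstep (map (At p) (blow d)) (N (pre ++ N tl1 :: X))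
  (N (pre ++ graft d tl1 :: X)).
  exact: (pathat (blow_path.1 d _ s1) (l := pre)).
apply: (req_via [:: Inner (p + l) k, Inner p n &
      map (At j) (blow D') ++ map (At p) (blow d) ++ blows p.+1 ds]).
  apply: (@req_cons _ _ (N (pre ++ tl1 ++ tl2 ++ N tm :: tr))).
    by apply: (@innerP _ _ _ _ (pre ++ tl1 ++ tl2) tm); rewrite -?catA ?size_cat //;
      lia.
  rewrite -(cat_rcons (Inner p n)) -cats1 -[Inner p n :: _ ++ _]cat_cons.
  apply: (@req_catl _ _ (N (pre ++ N tl1 :: tl2 ++ graft D' tm :: tr))).
    by apply: inner_r; rewrite ?s1 // /j; lia.
  apply: path_cat pL; exact: pd.
apply: (req_via ([:: Inner p n; Inner j k] ++
      map (At j) (blow D') ++ map (At p) (blow d) ++ blows p.+1 ds)).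
  apply: (@req_catl _ _ (N (pre ++ N tl1 :: tl2 ++ N tm :: tr)) _
    [:: Inner (p + l) k; Inner p n]).
    have := sq_inner_inner pre tl1 tl2 tm tr.
    rewrite sp s1 s2.
    have -> : p + n + (l - n) = p + l by lia.
    by have -> : p + (l - n).+1 = j by rewrite /j; lia.
  apply: (@path_cat _ _ _ _ (N (pre ++ N tl1 :: tl2 ++ graft D' tm :: tr))).
    by apply: (pathat pI (l := pre ++ N tl1 :: tl2)); rewrite -?catA ?size_cat //=
      /j; lia.
  apply: path_cat pL; exact: pd.
apply: (@req_cons _ _ (N (pre ++ N tl1 :: tl2 ++ tm ++ tr))).
  by apply: innerP.
apply: (req_via (Inner j k :: map (At p) (blow d) ++ map (At j) (blow D') ++ blows
  p.+1 ds)).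
  apply: (@req_cons _ _ (N (pre ++ N tl1 :: tl2 ++ N tm :: tr))).
    by apply: (@innerP _ _ _ _ (pre ++ N tl1 :: tl2) tm); rewrite -?catA ?size_cat
      //= /j; lia.
  apply: req_catA.
  apply: (req_catl (req_sym _) pL).
  by apply: (at_words tr (blow_path.1 d _ s1) pI); rewrite // /j; lia.
apply: (req_via (map (At p) (blow d) ++ Inner j k :: map (At j) (blow D') ++ blows
  p.+1 ds)).
  rewrite -[X in req _ _ _ X _]cat_cons -[X in req _ _ _ _ X](cat_rcons (Inner j k))
    -cats1.
  apply: (req_catl (req_sym (inner_l tr (blow_path.1 d _ s1) sp _ (erefl k)))); first
    by rewrite /j; lia.
  apply: path_cat pL.
  by apply: (pathat pI (l := pre ++ graft d tl1 :: tl2)); rewrite -?catA ?size_cat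
    //= /j; lia.
apply: (req_catr (pd _)).
have := IHds (rcons pre (graft d tl1)) tl2 tm tr p.+1 (l - n) sm.
rewrite !cat_rcons size_rcons sp s2; apply=> //.
by move: sz2; rewrite size_cat /= s2.
Qed.

End Insert.

Lemma par0_nil k p ts : par k (map grow (nseq p Eta ++ ts)) = par (k + p) (map grow ts).
Proof. by rewrite map_cat gpar_cat map_nseq par_nil size_nseq. Qed.

Lemma parRP k ts pre post S T : S = N (pre ++ nseq (size ts) Eta ++ post) ->
  T = N (pre ++ ts ++ post) -> size pre = k -> path rstep (par k (map grow ts)) S T.
Proof. exact: parP (grow_path.2 ts). Qed.

(** * Replacement of the root vertex of a grown tree *)

Section Grow.
Variable R : step -> tree unit -> tree unit -> Prop.
Hypothesis stR : forall g S T, rstep g S T -> R g S T.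

(** Stated for steps [h n] that create a root vertex with [n] free inputs to the right of [pre],
    because it serves twice: with [Top], from the free edge, and with [Up p], from the last tree of
    [pre]. The last hypothesis trades a contraction right after [h] for a corolla put on a single
    input. *)
Lemma grow_blows ds :
  (forall d, List.In d ds -> forall ts, size ts = nleaves d ->
     req rstep Eta (graft d ts) (grow (N ts) ++ blow d) (grow (graft d ts))) ->
  forall S pre p (h : nat -> step) ts, size pre = p ->
  size ts = sumn (map (@nleaves unit) ds) ->
  (forall n, R (h n) S (N (pre ++ nseq n Eta))) ->
  (forall a b c, req R S (N (pre ++ nseq a Eta ++ corolla b tt :: nseq c Eta))
     [:: h (a + b + c); Inner (p + a) b] [:: h (a + 1 + c); At (p + a) (Top b)]) ->
  req R S (N (pre ++ grafts ds ts))
    (h (size ts) :: par p (map grow ts) ++ blows p ds)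
    (h (size ds) :: par p (map grow (grafts ds ts))).
Proof.
have up := req_mono stR; have upp := path_mono stR.
elim: ds => [|d ds IHds] IHd S pre p h ts sp sz Hh Hsq.
  case: ts sz => //= _; apply: req_refl; apply: path1.
  by have := Hh 0.
move: sz => /split_size[t1 [t2 [-> s1 s2]]].
have {}IHds := IHds (fun d' dP => IHd d' (or_intror dP)).
have {}IHd := IHd d (or_introl erefl) t1 s1.
rewrite grafts_cons // map_cat gpar_cat !size_map size_cat /= s1.
set n := nleaves d; set n2 := size t2.
have pd X : path rstep (map (At p) (blow d)) (N (pre ++ N t1 :: X))
  (N (pre ++ graft d t1 :: X)).
  exact: (pathat (blow_path.1 d _ s1) (l := pre)).
have pL X : path rstep (blows p.+1 ds) (N (pre ++ X :: t2))
  (N (pre ++ X :: grafts ds t2)).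
  by apply: (blowsP s2 (pre := rcons pre X)); rewrite ?size_rcons ?cat_rcons ?sp.
have p2 X : path rstep (par p.+1 (map grow t2)) (N (pre ++ X :: nseq n2 Eta))
  (N (pre ++ X :: t2)).
  by apply: (parRP (pre := rcons pre X) (post := [::])); rewrite ?cat_rcons ?cats0
    ?size_rcons ?sp.
have h1 : R (h (1 + n2)) S (N (pre ++ Eta :: nseq n2 Eta)) by apply: (Hh (1 + n2)).
have pg X : path rstep (map (At p) (grow (graft d t1))) (N (pre ++ Eta :: X))
  (N (pre ++ graft d t1 :: X)).
  exact: (pathat (grow_path.1 _) (l := pre)).
apply: (req_via ([:: h (n + n2); Inner p n] ++ map (At p) (par 0 (map grow t1)) ++
   par p.+1 (map grow t2) ++ map (At p) (blow d) ++ blows p.+1 ds)).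
  apply: (req_cons (Hh _)).
  have Pp : paths (nseq p [::]) pre pre.
    by rewrite -sp; elim: (pre) => [|x s IH]; [exact: paths_nil|exact: paths_cons].
  have := inner_par Pp (grow_path.2 t1) (grow_path.2 t2) sp
    (erefl (size (nseq (size t1) Eta))).
  rewrite size_nseq s1 !gpar_cat par_nil size_nseq /= add0n size_map s1 ?par_nil
    ?size_nseq ?add0n => IP.
  rewrite -/n2 in IP; rewrite nseqD.
  rewrite -[X in req _ _ _ X _](cat_rcons (Inner p n)) -cats1.
  have := up _ _ _ _ (req_catl IP (v := map (At p) (blow d) ++ blows p.+1 ds) _).
  rewrite cat_cons -!catA; apply.
  exact: (path_cat (pd _) (pL _)).
apply: (req_via ([:: h (1 + n2); At p (Top n)] ++ map (At p) (par 0 (map grow t1)) ++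
   par p.+1 (map grow t2) ++ map (At p) (blow d) ++ blows p.+1 ds)).
  apply: (@req_catl _ _ (N (pre ++ corolla n tt :: nseq n2 Eta))).
    by have := Hsq 0 n n2; rewrite addn0 !add0n.
  apply: upp.
  apply: (@path_cat _ _ _ _ (N (pre ++ N t1 :: nseq n2 Eta))).
    apply: (pathat (S' := corolla n tt) (T' := N t1) _ (l := pre)); rewrite //.
    by apply: (parRP (pre := [::]) (post := [::])); rewrite ?cats0 ?s1.
  by apply: path_cat (p2 _) _; apply: path_cat (pd _) (pL _).
have -> : forall X, [:: h (1 + n2); At p (Top n)] ++ map (At p) (par 0 (map grow t1))
  ++ X =
   h (1 + n2) :: map (At p) (grow (N t1)) ++ X by move=> X; rewrite grow_node_word s1.
have pN X : path rstep (map (At p) (grow (N t1))) (N (pre ++ Eta :: X))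
  (N (pre ++ N t1 :: X)).
  exact: (pathat (grow_path.1 _) (l := pre)).
apply: (req_via (h (1 + n2) :: map (At p) (grow (graft d t1)) ++
   par p.+1 (map grow t2) ++ blows p.+1 ds)).
  apply: (req_cons h1); apply: up.
  apply: (req_via (map (At p) (grow (N t1)) ++ map (At p) (blow d) ++
     par p.+1 (map grow t2) ++ blows p.+1 ds)).
    apply: (req_catr (pN _)).
    apply: req_catA.
    apply: (req_catl (req_sym _) (pL _)).
    have := at_par (m := [::]) (j := p.+1) [::] (blow_path.1 d t1 s1)
      (grow_path.2 t2) sp.
    by rewrite /= !cats0 sp; apply; rewrite addn1.
  rewrite [X in req _ _ _ X _]catA -map_cat; apply: req_catl; last by apply: path_cat
    (p2 _) (pL _).
  exact: (reqat IHd (l := pre)).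
apply: (req_via ((h (1 + n2) :: par p.+1 (map grow t2) ++ blows p.+1 ds) ++
   map (At p) (grow (graft d t1)))).
  apply: (req_cons h1); apply: up.
  apply: (req_via (par p.+1 (map grow t2) ++ map (At p) (grow (graft d t1)) ++ blows
    p.+1 ds)).
    apply: req_catA.
    apply: (req_catl _ (pL _)).
    have := at_par (m := [::]) (j := p.+1) [::] (grow_path.1 (graft d t1))
      (grow_path.2 t2) sp.
    by rewrite /= !cats0 sp; apply; rewrite addn1.
  rewrite -[X in req _ _ _ _ X]catA; apply: (req_catr (p2 _)).
  by apply: (at_blows (m := [::]) (grow_path.1 (graft d t1)) s2 sp); rewrite sp addn1.
apply: (req_via ((h (1 + size ds) :: par p.+1 (map grow (grafts ds t2))) ++
   map (At p) (grow (graft d t1)))).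
  apply: req_catl; last exact: upp (pg _).
  have := IHds S (rcons pre Eta) p.+1 (fun n => h (1 + n)) t2.
  rewrite size_rcons sp !cat_rcons; apply=> //.
  - by move=> m; rewrite cat_rcons; apply: (Hh (1 + m)).
  - move=> a b c; rewrite cat_rcons; have := Hsq (1 + a) b c.
    by rewrite /= -[p + (1 + a)]addSnnS !addnA.
apply: (req_cons (Hh _)); apply: up; apply: req_sym.
have := at_par (m := [::]) (j := p.+1) [::] (grow_path.1 (graft d t1))
  (grow_path.2 (grafts ds t2)) sp.
rewrite /= !cats0 sp size_grafts; apply; by rewrite addn1.
Qed.

End Grow.

(** The free edge is settled by the section [sec_top], a vertex by [grow_blows] with the square
    [sq_top]. The second half delivers the induction hypotheses in the form that [grow_blows]
    expects. *)
Lemma grow_blow :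
  (forall D ts, size ts = nleaves D ->
     req rstep Eta (graft D ts) (grow (N ts) ++ blow D) (grow (graft D ts))) *
  (forall ds d, List.In d ds -> forall ts, size ts = nleaves d ->
     req rstep Eta (graft d ts) (grow (N ts) ++ blow d) (grow (graft d ts))).
Proof.
apply: tree_forest_ind => //.
- move=> [|t []] //= _; rewrite cats0.
  apply: (req_via [:: Top 1, Deg & grow t]).
    apply: (@req_cons _ _ (N [:: Eta])); first exact: (rstep_top 1).
    exact: deg_word (grow_path.1 t).
  exact: (req_catl sec_top (grow_path.1 t)).
- move=> [] ds IH ts sz; rewrite graft_node !grow_node_word blow_node size_grafts.
  apply: (@grow_blows rstep _ ds IH Eta [::] 0 Top ts) => //.
  + by move=> n; apply: rstep_top.
  + move=> a b c; rewrite add0n; exact: sq_top.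
- by move=> d ds IHd IHds d' [<-//|]; apply: IHds.
Qed.

(** * Inclusion of the part of a tree over an edge *)

(** Adds a root vertex under the [j]-th tree of [ts] and grows the other trees on its leaves. Entry
    [j] is set to [Eta] because [grow Eta] is the empty word. *)
Definition incl1 j (ts : seq (tree unit)) : seq step :=
  Up j (size ts - j.+1) :: par 0 (map grow (set_nth Eta ts j Eta)).

Lemma set_nth_cat (A : Type) (x0 : A) l x r y i : size l = i ->
  set_nth x0 (l ++ x :: r) i y = l ++ y :: r.
Proof. by move=> <-; elim: l => //= z l ->. Qed.

Lemma nth_catr (A : Type) (x0 : A) l x r i : size l = i ->
  nth x0 (l ++ x :: r) i = x.
Proof. by move=> <-; elim: l. Qed.

Lemma incl1_cat l t r i : size l = i ->
  incl1 i (l ++ t :: r) = Up i (size r) :: par 0 (map grow (l ++ Eta :: r)).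
Proof.
move=> sl; rewrite /incl1 set_nth_cat // size_cat /= sl.
by congr (Up _ _ :: _); lia.
Qed.

Lemma hole_paths l t r : paths (map grow (l ++ Eta :: r))
  (nseq (size l) Eta ++ t :: nseq (size r) Eta) (l ++ t :: r).
Proof.
rewrite map_cat; apply: (paths_cat (grow_path.2 l)); apply: paths_cons => //.
exact: grow_path.2.
Qed.

Lemma hole_path l t r : path rstep (par 0 (map grow (l ++ Eta :: r)))
  (N (nseq (size l) Eta ++ t :: nseq (size r) Eta)) (N (l ++ t :: r)).
Proof. by apply: (parP (hole_paths l t r) (pre := [::]) (post := [::]));
  rewrite ?cats0. Qed.

Lemma incl1P l t r i T : T = N (l ++ t :: r) -> size l = i -> path gstep
  (incl1 i (l ++ t :: r)) t T.
Proof.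
move=> -> <-; rewrite incl1_cat //.
exists (N (nseq (size l) Eta ++ t :: nseq (size r) Eta)); first exact: upP.
exact: gpath (hole_path l t r).
Qed.

(* A word from [above T e] to [T]. *)
Fixpoint incl (e : seq nat) (T : tree unit) : seq step :=
  match e with
  | [::] => [::]
  | j :: e' => if T is Node _ ts then incl e' (nth Eta ts j) ++ incl1 j ts else [::]
  end.

Lemma split_nth (A : Type) (x0 : A) (s : seq A) i : i < size s ->
  exists l r, s = l ++ nth x0 s i :: r /\ size l = i.
Proof.
elim: s i => [|x s IH] [|i] //= li; first by exists [::], s.
have [l [r [E sl]]] := IH i li; exists (x :: l), r; by rewrite /= -E sl.
Qed.

Lemma inclP e T : edge T e -> path gstep (incl e T) (above T e) T.
Proof.
elim: e T => //= j e IH [|[] ts] // /andP[lj ed].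
apply: (path_cat (IH _ ed)).
have [l [r [E sl]]] := split_nth Eta lj.
by rewrite {1 3}E; apply: incl1P.
Qed.

Lemma incl_cat e e' T : incl (e ++ e') T = incl e' (above T e) ++ incl e T.
Proof.
elim: e T => [|j e IH] T /=; first by rewrite cats0.
case: T => [|[] ts]; first by case: e' {IH}.
by rewrite IH catA.
Qed.

Lemma at_edge k ws i b :
  steps_edge (map (At k) ws) (i :: b) = if i == k then k :: steps_edge ws b else i :: b.
Proof.
elim: ws i b => [|g ws IH] i b /=; first by case: eqP => [->|].
by case: eqP => [_|/eqP/negbTE ne]; rewrite IH ?eqxx ?ne.
Qed.

Lemma par_edge_lt k wss i b : i < k -> steps_edge (par k wss) (i :: b) = i :: b.
Proof.
elim: wss k => //= ws wss IH k ik; rewrite steps_edge_cat at_edge.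
have -> : (i == k) = false by lia.
by apply: IH; lia.
Qed.

Lemma par_edge k wss j b :
  steps_edge (par k wss) (k + j :: b) = k + j :: steps_edge (nth [::] wss j) b.
Proof.
elim: wss k j => [|ws wss IH] k [|j] //=; rewrite steps_edge_cat at_edge.
- by rewrite addn0 eqxx par_edge_lt.
- have -> : (k + j.+1 == k) = false by lia.
  by rewrite addnS -addSn IH.
Qed.

Lemma incl_edge e T a : edge T e -> steps_edge (incl e T) a = e ++ a.
Proof.
elim: e T a => //= j e IH [|[] ts] //= a /andP[lj ed].
rewrite steps_edge_cat IH // /incl1 /= (par_edge 0 _ j) (nth_map Eta) ?size_set_nth.
  by rewrite nth_set_nth /= eqxx.
by lia.
Qed.

Lemma leaves_from_cons (ds : seq (tree unit)) p l : l < sumn (map (@nleaves unit) ds) ->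
  exists j e, nth [::] (leaves_from p ds) l = (p + j) :: e /\ j < size ds.
Proof.
elim: ds p l => //= d ds IH p l ll; rewrite nth_cat size_map (size_leaves _).1.
case: ltnP => ld.
  by exists 0, (nth [::] (leaves d) l); rewrite (nth_map [::]) ?(size_leaves _).1 //
    addn0.
have [|j [e [-> lj]]] := IH p.+1 (l - nleaves d); first by lia.
by exists j.+1, e; rewrite addSnnS.
Qed.

(** The growth of [x] over the input [p] commutes with the growth of the siblings on its right, so
    it can be postponed until after the inclusion from one of these siblings. *)
Lemma incl_swap p j x e G : j < size G ->
  edge (nth Eta G j) e ->
  req gstep (above (nth Eta G j) e) (N (nseq p Eta ++ x :: G))
    (incl (p.+1 + j :: e) (N (nseq p Eta ++ Eta :: G)) ++ map (At p) (grow x))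
    (incl (p.+1 + j :: e) (N (nseq p Eta ++ x :: G))).
Proof.
move=> lj ed; rewrite [incl _ _]/= [X in req _ _ _ _ X]/=.
have Ej y : nth Eta (nseq p Eta ++ y :: G) (p.+1 + j) = nth Eta G j.
  by rewrite nth_cat size_nseq addSnnS ltnNge leq_addr /= addKn.
rewrite !Ej -catA; apply: (req_catr (inclP ed)).
have [g1 [g2 [EG sg]]] := split_nth Eta lj.
set y := nth Eta G j in EG *; rewrite EG.
have E z : nseq p Eta ++ z :: g1 ++ y :: g2 = (nseq p Eta ++ z :: g1) ++ y :: g2.
  by rewrite -catA.
have sz z : size (nseq p Eta ++ z :: g1) = p.+1 + j.
  by rewrite size_cat size_nseq /= sg addSnnS.
rewrite !E !incl1_cat // -!catA !par0_nil add0n /=.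
apply: (@req_cons _ _ (N (nseq p Eta ++ Eta :: nseq (size g1) Eta ++ y :: nseq
  (size g2) Eta))).
  apply: upP; rewrite sg.
  by rewrite addSnnS nseqD -catA.
apply: greq; apply: req_sym.
rewrite map_cat gpar_cat size_map sg /= (_ : nseq j Eta = nseq (size g1) Eta) ?sg //.
rewrite -{1}sg.
have p1 w : path rstep (par p.+1 (map grow g1))
  (N (nseq p Eta ++ w :: nseq (size g1) Eta ++ y :: nseq (size g2) Eta))
   (N (nseq p Eta ++ w :: g1 ++ y :: nseq (size g2) Eta)).
  by apply: (parRP (pre := rcons (nseq p Eta) w)); rewrite ?cat_rcons ?size_rcons
    ?size_nseq.
apply: (req_via (par p.+1 (map grow g1) ++ map (At p) (grow x) ++ par (p.+1 + j).+1
  (map grow g2))).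
  apply: req_catA; apply: req_catl.
    apply: (at_par (m := [::]) (y :: nseq (size g2) Eta) (grow_path.1 x)
      (grow_path.2 g1)).
      by rewrite size_nseq.
    by rewrite size_nseq addn1.
  apply: (parRP (pre := nseq p Eta ++ x :: g1 ++ [:: y]) (post := [::]));
   rewrite ?cats0 -?catA //= -?catA //.
  by rewrite size_cat /= size_cat size_nseq /=; lia.
rewrite -[X in req _ _ _ _ X]catA; apply: (req_catr (p1 _)).
have := at_par (m := g1 ++ [:: y]) (j := (p.+1 + j).+1) [::] (grow_path.1 x)
  (grow_path.2 g2) (size_nseq p Eta).
rewrite !cats0 size_nseq size_cat sg /= -!catA /=; apply; lia.
Qed.

(** Adding a root vertex under [t] and replacing it by [D] gives the canonical inclusion from the
    leaf of [D] on which [t] ends up. In the forest version, the first [p] inputs belong to trees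
    already passed and are kept free. *)
Lemma up_blow :
  (forall D tl t tr, size tl + (size tr).+1 = nleaves D ->
     req gstep t (graft D (tl ++ t :: tr))
       (incl1 (size tl) (tl ++ t :: tr) ++ blow D)
       (incl (nth [::] (leaves D) (size tl)) (graft D (tl ++ t :: tr)))) *
  (forall ds p l tl t tr, size tl + (size tr).+1 = sumn (map (@nleaves unit) ds) ->
     size tl = l ->
     req gstep t (N (nseq p Eta ++ grafts ds (tl ++ t :: tr)))
       (Up (p + l) (size tr) :: par p (map grow (tl ++ Eta :: tr)) ++ blows p ds)
       (incl (nth [::] (leaves_from p ds) l)
         (N (nseq p Eta ++ grafts ds (tl ++ t :: tr))))).
Proof.
apply: tree_forest_ind.
- move=> [|? [|? ?]] t [|? ?] //= _; exact: sec_up.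
- move=> [] ds IH tl t tr sz; rewrite incl1_cat // blow_node graft_node leaves_node.
  exact: (IH 0 _ tl t tr).
- by move=> ? ? [].
move=> d ds IHd IHds p l tl t tr /= sz sl.
set n := nleaves d; rewrite [nth _ _ l]nth_cat size_map (size_leaves _).1 -/n.
case: ltnP => ld.
(* The leaf lies in [d]: by [sq_up_up] the word first builds the tree over the input [p], where the
   induction hypothesis for [d] applies; [grow_blows] with [Up p] then supplies the inputs to the
   right. *)
- have /split_size[tr1 [tr2 [Etr s1 s2]]] :
    size tr = (n - l.+1) + sumn (map (@nleaves unit) ds) by rewrite /n in ld *; lia.
  subst tr.
  have sd : size (tl ++ t :: tr1) = nleaves d by rewrite size_cat /= -/n; lia.
  have -> : (take n (tl ++ t :: tr1 ++ tr2)) = tl ++ t :: tr1.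
    by rewrite -cat_cons catA take_size_cat.
  have -> : (drop n (tl ++ t :: tr1 ++ tr2)) = tr2.
    by rewrite -cat_cons catA drop_size_cat.
  have El : (nth [::] (map (cons p) (leaves d)) l) = p :: nth [::] (leaves d) l.
    by rewrite (nth_map [::]) // (size_leaves _).1.
  rewrite El [X in req _ _ _ _ X]/= nth_catr ?size_nseq //.
  rewrite incl1_cat ?size_nseq // par0_nil add0n /= size_grafts.
  have szE : size (tl ++ Eta :: tr1) = n by rewrite /n -sd !size_cat.
  have -> : tl ++ Eta :: tr1 ++ tr2 = (tl ++ Eta :: tr1) ++ tr2 by rewrite -catA.
  rewrite map_cat gpar_cat size_map szE -[(par _ _ ++ _) ++ _]catA.
  have pd X : path rstep (map (At p) (blow d))
    (N (nseq p Eta ++ N (tl ++ t :: tr1) :: X))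
      (N (nseq p Eta ++ graft d (tl ++ t :: tr1) :: X)).
    by apply: (pathat (blow_path.1 d _ sd) (l := nseq p Eta)); rewrite ?size_nseq.
  have pL X : path rstep (blows p.+1 ds) (N (nseq p Eta ++ X :: tr2))
    (N (nseq p Eta ++ X :: grafts ds tr2)).
    by apply: (blowsP s2 (pre := rcons (nseq p Eta) X)); rewrite ?size_rcons
      ?cat_rcons ?size_nseq.
  have p2 X : path rstep (par p.+1 (map grow tr2))
    (N (nseq p Eta ++ X :: nseq (size tr2) Eta)) (N (nseq p Eta ++ X :: tr2)).
    by apply: (parRP (pre := rcons (nseq p Eta) X) (post := [::]));
      rewrite ?cat_rcons ?cats0 ?size_rcons ?size_nseq.
  have ph := hole_path tl t tr1; rewrite sl in ph.
  set hol := par 0 (map grow (tl ++ Eta :: tr1)).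
  have pRL : path rstep (map (At p) (blow d) ++ blows p.+1 ds)
    (N (nseq p Eta ++ N (tl ++ t :: tr1) :: tr2))
      (N (nseq p Eta ++ graft d (tl ++ t :: tr1) :: grafts ds tr2)).
    exact: (path_cat (pd _) (pL _)).
  apply: (req_via ([:: Up (p + l) (size (tr1 ++ tr2)); Inner p n] ++
     map (At p) hol ++ par p.+1 (map grow tr2) ++ map (At p) (blow d) ++ blows p.+1
       ds)).
    apply: (@req_cons _ _ (N (nseq p Eta ++ (nseq l Eta ++ t :: nseq (size tr1) Eta)
      ++ nseq (size tr2) Eta))).
      by apply: upP; rewrite size_cat !nseqD -!catA.
    have Pp : paths (nseq p [::]) (nseq p Eta) (nseq p Eta).
      by elim: (p) => [|x IH]; [exact: paths_nil|exact: paths_cons].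
    have := inner_par Pp (hole_paths tl t tr1) (grow_path.2 tr2) (size_nseq p Eta)
      erefl.
    have -> : size (nseq (size tl) Eta ++ t :: nseq (size tr1) Eta) = n.
      by rewrite size_cat /= !size_nseq /n; rewrite size_cat /= in sd.
    rewrite sl !gpar_cat par_nil size_nseq /= add0n size_map szE ?par_nil ?size_nseq
      ?add0n => IP.
    rewrite [X in req _ _ _ X _]catA -[X in req _ _ _ X _](cat_rcons (Inner p n))
      -cats1.
    have := greq (req_catl IP pRL).
    by rewrite cat_cons -!catA.
  apply: (req_via ([:: Up l (size tr1); Up p (size tr2)] ++
     map (At p) hol ++ par p.+1 (map grow tr2) ++ map (At p) (blow d) ++ blows p.+1
       ds)).
    apply: (@req_catl _ _ (N (nseq p Eta ++ N
      (nseq l Eta ++ t :: nseq (size tr1) Eta) :: nseq (size tr2) Eta))).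
      have := sq_up_up p l (size tr1) (size tr2) t; rewrite size_cat.
      suff -> : l + (size tr1).+1 = n by [].
      by rewrite /n -sd size_cat sl.
    apply: gpath; apply: (@path_cat _ _ _ _
      (N (nseq p Eta ++ N (tl ++ t :: tr1) :: nseq (size tr2) Eta))).
      by apply: (pathat ph (l := nseq p Eta)); rewrite ?size_nseq.
    exact: (path_cat (p2 _) pRL).
  apply: (req_via (Up l (size tr1) :: (hol ++ blow d) ++
     Up p (size tr2) :: par p.+1 (map grow tr2) ++ blows p.+1 ds)).
    apply: (req_cons (upP (erefl _))).
    apply: (req_via ((Up p (size tr2) :: map (At p) (hol ++ blow d)) ++
     par p.+1 (map grow tr2) ++ blows p.+1 ds)).
      rewrite map_cat cat_cons -catA.
      apply: (@req_cons _ _ (N (nseq p Eta ++ N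
        (nseq l Eta ++ t :: nseq (size tr1) Eta) :: nseq (size tr2) Eta))).
        exact: upP.
      apply: greq.
      apply: (@req_catr _ _ (N (nseq p Eta ++ N (tl ++ t :: tr1) :: nseq (size tr2)
        Eta))).
        by apply: (pathat ph (l := nseq p Eta)); rewrite ?size_nseq.
      apply: req_catA.
      apply: (req_catl _ (pL _)); apply: req_sym.
      have := at_par (m := [::]) (j := p.+1) [::] (blow_path.1 d _ sd)
        (grow_path.2 tr2) (size_nseq p Eta).
      by rewrite /= !cats0 size_nseq; apply; rewrite addn1.
    rewrite -[X in req _ _ _ _ X](cat_rcons (Up p (size tr2))) -cats1.
    apply: (@req_catl _ _ (N (nseq p Eta ++ graft d (tl ++ t :: tr1) :: nseq
      (size tr2) Eta))).
      apply: req_sym; apply: up_word; apply: (path_cat ph); exact: blow_path.1.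
    apply: gpath; exact: (path_cat (p2 _) (pL _)).
  rewrite -[X in req _ _ _ X _]cat_cons.
  have Es : size tl + (size tr1).+1 = nleaves d by rewrite -sd size_cat.
  have := IHd tl t tr1 Es; rewrite incl1_cat // cat_cons sl => IHd'.
  apply: (req_cat IHd').
  have := @grow_blows gstep rstep_gstep ds (grow_blow.2 ds) (graft d (tl ++ t :: tr1))
    (rcons (nseq p Eta) (graft d (tl ++ t :: tr1))) p.+1 (Up p) tr2.
  rewrite size_rcons size_nseq !cat_rcons; apply=> // [m|a b c].
    by apply: upP; rewrite cat_rcons.
  rewrite cat_rcons addSnnS; have := sq_up_right p a b c (graft d (tl ++ t :: tr1)).
  by rewrite addnS addn1 addSn addnS.
(* The leaf lies beyond [d]: by [sq_up_left] and [grow_blow] the tree over the input [p] is grown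
   separately, and its growth is moved to the end. This leaves a free edge there, as the induction
   hypothesis requires, and [incl_swap] puts the tree back. *)
have /split_size[tl1 [tl2 [Etl s1 s2]]] : size tl = n + (l - n) by lia.
subst tl; rewrite -!catA take_size_cat // drop_size_cat //.
set l' := l - n in s2 *; set r := size tr.
have sz2 : size (tl2 ++ t :: tr) = sumn (map (@nleaves unit) ds).
  by move: sz; rewrite !size_cat /= -/n; lia.
have pd X : path rstep (map (At p) (blow d)) (N (nseq p Eta ++ N tl1 :: X))
  (N (nseq p Eta ++ graft d tl1 :: X)).
  by apply: (pathat (blow_path.1 d _ s1) (l := nseq p Eta)); rewrite ?size_nseq.
have pL X : path rstep (blows p.+1 ds) (N (nseq p Eta ++ X :: tl2 ++ t :: tr))
    (N (nseq p Eta ++ X :: grafts ds (tl2 ++ t :: tr))).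
  by apply: (blowsP sz2 (pre := rcons (nseq p Eta) X)); rewrite ?size_rcons
    ?cat_rcons ?size_nseq.
set hol := par p.+1 (map grow (tl2 ++ Eta :: tr)).
have p2 X : path rstep hol (N (nseq p Eta ++ X :: nseq l' Eta ++ t :: nseq r Eta))
    (N (nseq p Eta ++ X :: tl2 ++ t :: tr)).
  apply: (parP (hole_paths tl2 t tr) (pre := rcons (nseq p Eta) X) (post := [::]));
  by rewrite ?cat_rcons ?cats0 ?size_rcons ?size_nseq ?s2.
have pRL : path rstep (map (At p) (blow d) ++ blows p.+1 ds)
  (N (nseq p Eta ++ N tl1 :: tl2 ++ t :: tr))
    (N (nseq p Eta ++ graft d tl1 :: grafts ds (tl2 ++ t :: tr))).
  exact: (path_cat (pd _) (pL _)).
have U0 : gstep (Up (p + l'.+1) r) t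
  (N (nseq p Eta ++ Eta :: nseq l' Eta ++ t :: nseq r Eta)).
  by apply: upP; rewrite nseqD -catA.
apply: (req_via ([:: Up (p + l) r; Inner p n] ++
   map (At p) (par 0 (map grow tl1)) ++ hol ++ map (At p) (blow d) ++ blows p.+1 ds)).
  apply: (@req_cons _ _ (N (nseq p Eta ++ nseq n Eta ++ nseq l' Eta ++ t :: nseq r
    Eta))).
    by apply: upP; rewrite -(subnKC ld) -/l' !nseqD -!catA.
  have Pp : paths (nseq p [::]) (nseq p Eta) (nseq p Eta).
    by elim: (p) => [|x IH]; [exact: paths_nil|exact: paths_cons].
  have := inner_par Pp (grow_path.2 tl1) (hole_paths tl2 t tr) (size_nseq p Eta) erefl.
  rewrite size_nseq s1 s2 -/r -/n !gpar_cat par_nil size_nseq /= add0n size_map s1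
    ?par_nil ?size_nseq ?add0n.
  rewrite -/hol -/n => IP; rewrite map_cat gpar_cat size_map s1
    -[(par _ _ ++ _) ++ _]catA.
  rewrite [X in req _ _ _ X _]catA -[X in req _ _ _ X _](cat_rcons (Inner p n)) -cats1.
  have := greq (req_catl IP pRL).
  by rewrite cat_cons -!catA.
apply: (req_via ([:: Up (p + l'.+1) r; At p (Top n)] ++
   map (At p) (par 0 (map grow tl1)) ++ hol ++ map (At p) (blow d) ++ blows p.+1 ds)).
  apply: (@req_catl _ _ (N (nseq p Eta ++ corolla n tt :: nseq l' Eta ++ t :: nseq r
    Eta))).
    have := sq_up_left p n l' r t.
    by have -> : p + n + l' = p + l by rewrite /l'; lia.
  apply: gpath; apply: (@path_cat _ _ _ _
    (N (nseq p Eta ++ N tl1 :: nseq l' Eta ++ t :: nseq r Eta))).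
    apply: (pathat (S' := corolla n tt) (T' := N tl1) _ (l := nseq p Eta));
      rewrite ?size_nseq //.
    by apply: (parRP (pre := [::]) (post := [::])); rewrite ?cats0 ?s1.
  exact: (path_cat (p2 _) pRL).
have -> : forall X, [:: Up (p + l'.+1) r; At p (Top n)] ++ map (At p)
  (par 0 (map grow tl1)) ++ X =
   Up (p + l'.+1) r :: map (At p) (grow (N tl1)) ++ X by move=> X;
     rewrite grow_node_word s1.
have pN X : path rstep (map (At p) (grow (N tl1))) (N (nseq p Eta ++ Eta :: X))
  (N (nseq p Eta ++ N tl1 :: X)).
  by apply: (pathat (grow_path.1 _) (l := nseq p Eta)); rewrite ?size_nseq.
have pg X : path rstep (map (At p) (grow (graft d tl1))) (N (nseq p Eta ++ Eta :: X))
  (N (nseq p Eta ++ graft d tl1 :: X)).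
  by apply: (pathat (grow_path.1 _) (l := nseq p Eta)); rewrite ?size_nseq.
have swap u S1 S2 : path rstep u S1 S2 ->
    req rstep (N (nseq p Eta ++ S1 :: nseq l' Eta ++ t :: nseq r Eta))
      (N (nseq p Eta ++ S2 :: tl2 ++ t :: tr)) (map (At p) u ++ hol)
        (hol ++ map (At p) u).
  move=> pu.
  have := at_par (m := [::]) (j := p.+1) [::] pu (hole_paths tl2 t tr)
    (size_nseq p Eta).
  by rewrite /= !cats0 size_nseq s2; apply; rewrite addn1.
apply: (req_via (Up (p + l'.+1) r :: map (At p) (grow (graft d tl1)) ++ hol ++ blows
  p.+1 ds)).
  apply: (req_cons U0); apply: greq.
  apply: (req_via (map (At p) (grow (N tl1)) ++ map (At p) (blow d) ++ hol ++ blows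
    p.+1 ds)).
    apply: (req_catr (pN _)).
    apply: req_catA.
    apply: (req_catl (req_sym _) (pL _)); apply: swap; exact: blow_path.1.
  rewrite [X in req _ _ _ X _]catA -map_cat; apply: req_catl; last
    exact: (path_cat (p2 _) (pL _)).
  apply: (reqat (grow_blow.1 d tl1 s1) (l := nseq p Eta)); by rewrite ?size_nseq.
apply: (req_via ((Up (p + l'.+1) r :: hol ++ blows p.+1 ds) ++ map (At p)
  (grow (graft d tl1)))).
  apply: (req_cons U0); apply: greq.
  apply: (req_via (hol ++ map (At p) (grow (graft d tl1)) ++ blows p.+1 ds)).
    apply: req_catA.
    apply: (req_catl _ (pL _)); apply: swap; exact: grow_path.1.
  rewrite -[X in req _ _ _ _ X]catA; apply: (req_catr (p2 _)).
  apply: (at_blows (m := [::]) (grow_path.1 (graft d tl1)) sz2 (size_nseq p Eta)).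
  by rewrite size_nseq addn1.
have E1 G : nseq p.+1 Eta ++ G = nseq p (@Eta unit) ++ Eta :: G.
  by rewrite -addn1 nseqD -catA.
have sz3 : size tl2 + (size tr).+1 = sumn (map (@nleaves unit) ds) by rewrite -sz2
  size_cat.
have := IHds p.+1 l' tl2 t tr sz3 s2.
rewrite E1 addSnnS -/r => IH.
apply: (req_trans (req_catl IH (gpath (pg _)))).
have [|j [e [Ee lj]]] := @leaves_from_cons ds p.+1 l'; first by rewrite -sz3 s2; lia.
have [||sG eG] := (above_graft_leaf unit).2 ds (tl2 ++ t :: tr) l' p.+1
  (nseq p.+1 Eta) tt sz2.
- by rewrite -sz3 s2; lia.
- by rewrite size_nseq.
have En q G : nth Eta (nseq q (@Eta unit) ++ G) (q + j) = nth Eta G j.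
  by rewrite nth_cat size_nseq ltnNge leq_addr /= addKn.
move: sG eG; rewrite Ee nth_catr // [above _ _]/= edge_node !En => sG /andP[_ eG].
rewrite -[X in req _ X]sG; apply: incl_swap => //.
by rewrite size_grafts.
Qed.

(** * Normal forms *)

(* Root-preserving maps: [RLeaf T] goes from the free edge to [T], while
   [RNode D fs] replaces the root vertex by [D] and applies the [fs] above it. *)
Inductive rmap := RLeaf of tree unit | RNode of tree unit & seq rmap.

Lemma rmap_forest_ind (P : rmap -> Prop) (Q : seq rmap -> Prop) :
  (forall T, P (RLeaf T)) -> (forall D fs, Q fs -> P (RNode D fs)) ->
  Q [::] -> (forall f fs, P f -> Q fs -> Q (f :: fs)) ->
  (forall f, P f) * (forall fs, Q fs).
Proof.
move=> PE PN Q0 Qc.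
have PT : forall f, P f.
  fix IH 1; case=> [//|D fs]; apply: PN.
  by elim: fs => [//|f fs IHfs]; apply: Qc.
by split=> //; elim=> // t ts; apply: Qc.
Qed.

Fixpoint src f : tree unit :=
  match f with RLeaf _ => Eta | RNode _ fs => N (map src fs) end.

Fixpoint tgt f : tree unit :=
  match f with RLeaf T => T | RNode D fs => graft D (map tgt fs) end.

Fixpoint valid f : bool :=
  match f with RLeaf _ => true | RNode D fs => (nleaves D == size fs) && all valid fs
    end.

Fixpoint canon f : seq step :=
  match f with RLeaf T => grow T | RNode D fs => par 0 (map canon fs) ++ blow D end.

Fixpoint rmap_edge f (a : seq nat) : seq nat :=
  match a with
  | [::] => [::]
  | i :: a' => if f is RNode D fs then nth [::] (leaves D) i ++ rmap_edge
    (nth (RLeaf Eta) fs i) a'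
               else a
  end.

Lemma canon_path : (forall f, valid f -> path rstep (canon f) (src f) (tgt f)) *
  (forall fs, all valid fs -> paths (map canon fs) (map src fs) (map tgt fs)).
Proof.
apply: rmap_forest_ind => [T _|D fs IH /= /andP[/eqP nD vf]||f fs IHf IHfs /=
  /andP[vf vfs]].
- exact: grow_path.1.
- apply: (@path_cat _ _ _ _ (N (map tgt fs))); last by apply: blow_path.1;
  rewrite size_map.
  by apply: (parP (IH vf) (pre := [::]) (post := [::])); rewrite ?cats0.
- by move=> _; exact: paths_nil.
- by apply: paths_cons; [apply: IHf|apply: IHfs].
Qed.

Lemma par_at v wss pre ss ts m T T' r k j : path rstep v T T' -> paths wss ss ts ->
  size pre = k -> k + size ss + size m = j ->
  req rstep (N (pre ++ ss ++ m ++ T :: r)) (N (pre ++ ts ++ m ++ T' :: r))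
    (par k wss ++ map (At j) v) (map (At j) v ++ par k wss).
Proof.
move=> pv ps; elim: ps pre k => [|u {}wss s {}ss t {}ts pu ps IH] pre k sp Ej /=.
  rewrite cats0; apply: req_refl; apply: (pathat pv (l := pre ++ m)); rewrite -?catA
    ?size_cat //.
  by rewrite -Ej addn0 sp.
apply: (req_via (map (At k) u ++ map (At j) v ++ par k.+1 wss)).
  rewrite -catA; apply: (@req_catr _ _ (N (pre ++ t :: ss ++ m ++ T :: r))).
    exact: (pathat pu (l := pre)).
  have := IH (rcons pre t) k.+1; rewrite size_rcons sp !cat_rcons; apply=> //.
  by rewrite -Ej /=; lia.
apply: req_catA.
apply: (@req_catl _ _ (N (pre ++ t :: ss ++ m ++ T' :: r))).
  have := at_words r pu pv sp (m := ss ++ m) (j := j); rewrite -!catA; apply.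
  by rewrite size_cat sp -Ej /=; lia.
by apply: (parP ps (pre := rcons pre t)); rewrite ?cat_rcons ?size_rcons ?sp.
Qed.

Lemma map_eq_cat (A B : Type) (f : A -> B) s u v : map f s = u ++ v ->
  exists s1 s2, [/\ s = s1 ++ s2, map f s1 = u & map f s2 = v].
Proof.
elim: u s => [|x u IH] s /=; first by exists [::], s.
case: s => //= y s [<- /IH[s1 [s2 [-> <- <-]]]].
by exists (y :: s1), s2.
Qed.

Lemma map_eq_mid (A B : Type) (f : A -> B) s u x v : map f s = u ++ x :: v ->
  exists s1 y s2, [/\ s = s1 ++ y :: s2, map f s1 = u, f y = x & map f s2 = v].
Proof.
move=> /map_eq_cat[s1 [[|y s2] [-> <- //= [<- <-]]]].
by exists s1, y, s2.
Qed.

Lemma src_eta fs n : map src fs = nseq n Eta -> fs = map RLeaf (map tgt fs).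
Proof.
elim: fs n => [|f fs IH] [|n] //= [sf /IH <-]; congr cons.
by case: f sf.
Qed.

Lemma map_canon_leaf ts : map canon (map RLeaf ts) = map grow ts.
Proof. by rewrite -map_comp. Qed.

Lemma grafts_punct D' tl tm tr : size tm = nleaves D' ->
  grafts (punct D' (size tl) (size tr)) (tl ++ tm ++ tr) = tl ++ graft D' tm :: tr.
Proof.
move=> sm; rewrite /punct grafts_cat ?map_nseq ?sumn_nseq ?mul1n //.
by rewrite grafts_eta grafts_cons // grafts_eta.
Qed.

Lemma nleaves_punct D' l r : sumn (map (@nleaves unit) (punct D' l r)) = l + nleaves
  D' + r.
Proof. by rewrite map_cat sumn_cat /= !map_nseq !sumn_nseq !mul1n addnA. Qed.

Lemma size_punct D' l r : size (punct D' l r) = l + r.+1.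
Proof. by rewrite size_cat /= !size_nseq. Qed.

(** The step changes the data as follows: a contraction merges two replacements by grafting one onto
    the other; a removed unary vertex is replaced by the free edge; a new top vertex is absorbed,
    with its replacement, into the tree grafted onto a leaf; [At] recurses. The words are compared
    by [inner_blow], [deg_word] and [grow_blow]. *)
Lemma canon_rstep g S T : rstep g S T -> forall f, valid f -> src f = T ->
  exists f', [/\ valid f', src f' = S, tgt f' = tgt f &
                 req rstep S (tgt f) (g :: canon f) (canon f')].
Proof.
elim=> {g S T} [l m r|U|n|l r g S T gS IH].
- case=> //= D fs /andP[/eqP nD vf] [] Efs.
  have [fl [f1 [fr [Ef El E1 Er]]]] := map_eq_mid Efs.
  case: f1 Ef E1 => //= D' fm Ef [Em].
  subst fs; move: vf; rewrite all_cat /= => /and3P[vl /andP[/eqP nD' vm] vr].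
  have sl : size l = size fl by rewrite -El size_map.
  have sm : size m = size fm by rewrite -Em size_map.
  have sD : size (map tgt fl) + (size (map tgt fr)).+1 = nleaves D.
    by rewrite !size_map nD size_cat.
  have sE : size (map tgt fm) = nleaves D' by rewrite size_map nD'.
  have tE : graft (graft D (punct D' (size fl) (size fr))) (map tgt (fl ++ fm ++ fr)) =
      graft D (map tgt fl ++ graft D' (map tgt fm) :: map tgt fr).
    rewrite (graft_graft _).1 ?nleaves_punct.
    + by rewrite !map_cat -{1}(size_map tgt fl) -{1}(size_map tgt fr) grafts_punct.
    + by rewrite size_punct -sD !size_map.
    + by rewrite size_map !size_cat nD'; lia.
  have pl := canon_path.2 fl vl; have pm := canon_path.2 fm vm; have pr :=
    canon_path.2 fr vr.
  rewrite El in pl; rewrite Em in pm; rewrite Er in pr.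
  have pm' : path rstep (par 0 (map canon fm)) (N m) (N (map tgt fm)).
    by apply: (parP pm (pre := [::]) (post := [::])); rewrite ?cats0.
  (* [D'] replaces the upper vertex, hence sits on leaf number [size l] of [D]. *)
  exists (RNode (graft D (punct D' (size fl) (size fr))) (fl ++ fm ++ fr)); split.
  + rewrite /= !all_cat vl vm vr !andbT (nleaves_graft _).1 ?nleaves_punct ?size_punct.
      by rewrite !size_cat nD' addnA eqxx.
    by rewrite -sD !size_map.
  + by rewrite /= !map_cat El Em Er.
  + by rewrite /= tE map_cat.
  rewrite map_cat /= !map_cat.
  set wl := map canon fl in pl *; set wm := map canon fm in pm pm' *; set wr := map
    canon fr in pr *.
  have swl : size wl = size l by rewrite sl size_map.
  have IwD : path rstep (blow D) (N (map tgt fl ++ graft D' (map tgt fm) :: map tgt fr))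
    (graft D (map tgt fl ++ graft D' (map tgt fm) :: map tgt fr)).
    by apply: blow_path.1; rewrite -sD size_cat.
  have sl' : size (map tgt fl) = size l by rewrite size_map.
  have IwD' : path rstep (map (At (size l)) (blow D'))
    (N (map tgt fl ++ N (map tgt fm) :: map tgt fr))
    (N (map tgt fl ++ graft D' (map tgt fm) :: map tgt fr)).
    exact: (pathat (blow_path.1 D' _ sE) (l := map tgt fl)).
  apply: (req_via (Inner (size l) (size m) :: par 0 (wl ++ par 0 wm :: wr) ++
     map (At (size l)) (blow D') ++ blow D)).
    apply: (@req_cons _ _ (N (l ++ N m :: r))); first exact: rstep_inner.
    rewrite catA; apply: (req_catl _ IwD).
    rewrite !gpar_cat /= map_cat swl add0n -!catA.
    apply: (@req_catr _ _ (N (map tgt fl ++ N m :: r))).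
      by apply: (parP pl (pre := [::]) (post := N m :: r)).
    apply: (@req_catr _ _ (N (map tgt fl ++ N (map tgt fm) :: r))).
      exact: (pathat pm' (l := map tgt fl)).
    have := at_par (m := [::]) [::] (blow_path.1 D' _ sE) pr sl' (j := (size l).+1).
    by rewrite /= !cats0; apply; rewrite sl' addn1.
  apply: (req_via (par 0 (wl ++ wm ++ wr) ++ Inner (size l) (size m) ::
     map (At (size l)) (blow D') ++ blow D)).
    rewrite -cat_cons -[X in req _ _ _ _ X](cat_rcons (Inner _ _)) -cats1.
    apply: (req_catl (req_sym (inner_par pl pm pr erefl erefl))).
    exact: (path_cat IwD' IwD).
  apply: (@req_catr _ _ (N (map tgt fl ++ map tgt fm ++ map tgt fr))).
    by apply: (parP (paths_cat pl (paths_cat pm pr)) (pre := [::]) (post := [::]));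
      rewrite ?cats0.
  have := (inner_blow D').1 D (map tgt fl) (map tgt fm) (map tgt fr) sE sD.
  by rewrite !size_map -sl -sm.
- move=> f vf sf; exists (RNode Eta [:: f]); split => //=; first by rewrite vf.
    by rewrite sf.
  rewrite cats0; apply: req_sym; rewrite -sf.
  exact: deg_word (canon_path.1 f vf).
- case=> //= D fs /andP[/eqP nD vf] [] sf.
  exists (RLeaf (graft D (map tgt fs))); split=> //=.
  have sn : size fs = n by rewrite -(size_map src) sf size_nseq.
  (* All inputs of the vertex are leaves, so the branches over it merely grow trees. *)
  rewrite {2}(src_eta sf) map_canon_leaf.
  have := grow_blow.1 D (map tgt fs); rewrite size_map nD grow_node_word size_map sn.
  by move=> /(_ erefl).
case=> //= D fs /andP[/eqP nD vf] [] Efs.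
have [fl [f1 [fr [Ef El Em Er]]]] := map_eq_mid Efs.
subst fs; move: vf; rewrite all_cat /= => /and3P[vl v1 vr].
have [f' [v' s' t' r']] := IH f1 v1 Em.
have sl : size l = size fl by rewrite -El size_map.
have sl' : size (map tgt fl) = size l by rewrite size_map.
have pl := canon_path.2 fl vl; have p1 := canon_path.1 f1 v1; have pr := canon_path.2
  fr vr.
rewrite El in pl; rewrite Em in p1; rewrite Er in pr.
exists (RNode D (fl ++ f' :: fr)); split=> /=.
- by rewrite nD !size_cat /= eqxx all_cat /= vl v' vr.
- by rewrite map_cat /= El Er s'.
- by rewrite !map_cat /= t'.
rewrite !map_cat /=; rewrite -cat_cons.
apply: (@req_catl _ _ (N (map tgt fl ++ tgt f1 :: map tgt fr))); last first.
  by apply: blow_path.1; rewrite nD !size_cat /= !size_map.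
rewrite !gpar_cat size_map /= -sl add0n.
apply: (req_via (par 0 (map canon fl) ++
  (At (size l) g :: map (At (size l)) (canon f1)) ++
   par (size l).+1 (map canon fr))).
  rewrite -[X in req _ _ _ _ X]cat_rcons -cats1 -[X in req _ _ _ X _]cat_cons.
  apply: (@req_catl _ _ (N (map tgt fl ++ T :: r))).
    have := par_at (pre := [::]) (m := [::]) r (path1 gS) pl (erefl 0) (j := size l).
    by move=> H; apply: req_sym; apply: H; rewrite addn0.
  apply: (@path_cat _ _ _ _ (N (map tgt fl ++ tgt f1 :: r))).
    exact: (pathat p1 (l := map tgt fl)).
  by apply: (parP pr (pre := rcons (map tgt fl) (tgt f1)) (post := [::]));
    rewrite ?cat_rcons ?cats0 ?size_rcons ?sl'.
apply: (@req_mid _ _ (N (map tgt fl ++ S :: r)) (N (map tgt fl ++ tgt f1 :: r))).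
- by apply: (parP pl (pre := [::]) (post := S :: r)).
- exact: (reqat r' (l := map tgt fl)).
- by apply: (parP pr (pre := rcons (map tgt fl) (tgt f1)) (post := [::]));
    rewrite ?cat_rcons ?cats0 ?size_rcons ?sl'.
Qed.

(** Once the root vertex is gone, the branch [f1] over its input [l] remains. Its image starts at
    leaf number [l] of [D], and all the other trees of the target are produced by the inclusion. *)
Lemma canon_up l r U f : valid f -> src f = N (nseq l Eta ++ U :: nseq r Eta) ->
  exists f' e, [/\ valid f', src f' = U, edge (tgt f) e, above (tgt f) e = tgt f' &
    req gstep U (tgt f) (Up l r :: canon f) (canon f' ++ incl e (tgt f))].
Proof.
case: f => //= D fs /andP[/eqP nD vf] [] Efs.
have [fl [f1 [fr [Ef El Em Er]]]] := map_eq_mid Efs.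
subst fs; move: vf; rewrite all_cat /= => /and3P[vl v1 vr].
have sl : size fl = l by rewrite -(size_map src) El size_nseq.
have sr : size fr = r by rewrite -(size_map src) Er size_nseq.
set tl := map tgt fl; set tr := map tgt fr.
have stl : size tl = l by rewrite size_map.
have str : size tr = r by rewrite size_map.
have sD : size tl + (size tr).+1 = nleaves D by rewrite nD stl str size_cat /= sl sr.
have E : map tgt (fl ++ f1 :: fr) = tl ++ tgt f1 :: tr by rewrite map_cat.
have lD : l < nleaves D by rewrite -sD; lia.
have sD' : size (tl ++ tgt f1 :: tr) = nleaves D by rewrite size_cat.
exists f1, (nth [::] (leaves D) l); rewrite E.
have [sE eE] := (above_graft_leaf unit).1 D (tl ++ tgt f1 :: tr) l sD' lD.
split=> //; first by rewrite sE nth_catr.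
have IwD : path rstep (blow D) (N (tl ++ tgt f1 :: tr)) (graft D (tl ++ tgt f1 :: tr)).
  exact: blow_path.1.
have p1 := canon_path.1 f1 v1; rewrite Em in p1.
rewrite (src_eta El) (src_eta Er) -/tl -/tr map_cat /= !map_canon_leaf gpar_cat /=
  size_map add0n stl.
apply: (req_via (Up l r :: map (At l) (canon f1) ++ par 0
  (map grow (tl ++ Eta :: tr)) ++ blow D)).
  apply: (req_cons (upP erefl)); apply: greq.
  rewrite [X in req _ _ _ _ X]catA; apply: (req_catl _ IwD).
  rewrite map_cat gpar_cat /= size_map stl add0n.
  apply: req_catA.
  apply: (@req_catl _ _ (N (tl ++ tgt f1 :: nseq r Eta))).
    have := par_at (pre := [::]) (m := [::]) (nseq r Eta) p1 (grow_path.2 tl)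
      (erefl 0) (j := l).
    by rewrite /= stl; apply; rewrite size_nseq addn0.
  by apply: (parRP (pre := rcons tl (tgt f1)) (post := [::]));
    rewrite ?cats0 ?cat_rcons ?size_rcons ?stl ?str.
have := incl1_cat (tgt f1) tr stl; rewrite str => EI.
apply: (req_via (canon f1 ++ incl1 l (tl ++ tgt f1 :: tr) ++ blow D)).
  rewrite EI cat_cons -[X in req _ _ _ _ X](cat_rcons (Up l r)) -cats1.
  rewrite -[X in req _ _ _ X _]cat_cons.
  apply: (@req_catl _ _ (N (nseq l Eta ++ tgt f1 :: nseq r Eta))).
    exact: req_sym (up_word _ _ p1).
  apply: gpath; apply: path_cat IwD.
  by have := hole_path tl (tgt f1) tr; rewrite stl str.
apply: (req_catr (gpath p1)).
by have := up_blow.1 D tl (tgt f1) tr sD; rewrite stl.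
Qed.

(** * Existence of normal forms *)

Fixpoint rmap_id (T : tree unit) : rmap :=
  match T with
  | Eta => RLeaf Eta
  | Node _ ts => RNode (corolla (size ts) tt) (map rmap_id ts)
  end.

Lemma blows_corolla pre ts k : size pre = k ->
  req rstep (N (pre ++ ts)) (N (pre ++ ts)) (blows k (nseq (size ts) Eta)) [::].
Proof.
elim: ts pre k => [|t ts IH] pre k sp /=; first exact: req_refl.
apply: (@req_cat _ _ (N (pre ++ t :: ts)) _ [:: Inner k 1; At k Deg] [::] _ [::]).
  by rewrite -sp; apply: sec_child.
by have := IH (rcons pre t) k.+1; rewrite cat_rcons size_rcons sp; apply.
Qed.

(** The canonical word of an identity is in general not empty: replacing a vertex by a corolla
    creates a unary vertex on each input and removes it again, which cancels by [sec_child]. *)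
Lemma rmap_idP :
  (forall T, [/\ valid (rmap_id T), src (rmap_id T) = T, tgt (rmap_id T) = T &
     req rstep T T [::] (canon (rmap_id T))]) *
  (forall ts, [/\ all valid (map rmap_id ts), map src (map rmap_id ts) = ts,
     map tgt (map rmap_id ts) = ts &
     forall pre k, size pre = k ->
     req rstep (N (pre ++ ts)) (N (pre ++ ts)) [::]
       (par k (map canon (map rmap_id ts)))]).
Proof.
apply: tree_forest_ind.
- by split=> //; apply: req_refl.
- move=> [] ts [vs ss tst r]; split=> /=.
  + by rewrite vs map_nseq sumn_nseq mul1n size_map eqxx.
  + by rewrite ss.
  + by rewrite -/(graft (corolla _ tt) _) tst -/(grafts _ _) grafts_eta.
  apply: (@req_cat _ _ (N ts) _ [::] _ [::] _ (r [::] 0 erefl)).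
  by have := @blows_corolla [::] ts 0 erefl; rewrite -blow_node => /req_sym.
- by split=> //= pre k _; apply: req_refl.
move=> t ts [vt st' tt' rt] [vs ss tts rs]; split=> /=.
- by rewrite vt.
- by rewrite st' ss.
- by rewrite tt' tts.
move=> pre k sp; apply: (@req_cat _ _ (N (pre ++ t :: ts)) _ [::] _ [::]).
  exact: (reqat rt (l := pre)).
by have := rs (rcons pre t) k.+1; rewrite cat_rcons size_rcons sp; apply.
Qed.

(** Letters are absorbed from the last to the first, so that each step meets a canonical word on its
    right. A root-preserving step leaves [q] unchanged, and [Up] prolongs it. *)
Lemma nf_word ws S T : path gstep ws S T ->
  exists q f, [/\ valid f, src f = S, edge T q, above T q = tgt f &
    req gstep S T ws (canon f ++ incl q T)].
Proof.
elim: ws S => [S /= <-|g ws IH S /= [S' gS /IH[q [f [vf sf eq sq r]]]]].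
  have [v s t r] := rmap_idP.1 S.
  by exists [::], (rmap_id S); rewrite cats0; split=> //; apply: greq.
have pI : path gstep (incl q T) (tgt f) T by rewrite -sq; apply: inclP.
case: (gS) => [gS'|[l [r' [Eg ES]]]].
  have [f' [v' s' t' r']] := canon_rstep gS' vf sf.
  exists q, f'; split=> //; first by rewrite t'.
  apply: req_trans (req_cons gS r) _; rewrite -cat_cons.
  exact: req_catl (greq r') pI.
rewrite ES in sf.
have [f' [e [v' s' ee se r1]]] := canon_up vf sf.
exists (q ++ e), f'; split=> //.
- by rewrite edge_cat eq sq.
- by rewrite above_cat sq.
rewrite incl_cat sq catA; apply: req_trans (req_cons gS r) _.
by rewrite -cat_cons Eg; apply: req_catl r1 pI.
Qed.

(** * Recovery of a normal form from its edge map *)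

Lemma par_edge0 k wss : steps_edge (par k wss) [::] = [::].
Proof.
elim: wss k => //= ws wss IH k; rewrite steps_edge_cat.
by have -> : steps_edge (map (At k) ws) [::] = [::] by elim: ws.
Qed.

Lemma blow_edge :
  (forall D i a, i < nleaves D -> steps_edge (blow D) (i :: a) = nth [::] (leaves D)
    i ++ a) *
  (forall ds p i a, i < sumn (map (@nleaves unit) ds) ->
     steps_edge (blows p ds) (p + i :: a) = nth [::] (leaves_from p ds) i ++ a).
Proof.
have Lw_lt ds k i a : i < k -> steps_edge (blows k ds) (i :: a) = i :: a.
  elim: ds k => //= d ds IH k ik; rewrite ik steps_edge_cat at_edge.
  have -> : (i == k) = false by lia.
  by apply: IH; lia.
apply: tree_forest_ind => [[]//|[] ds IH i a li||].
- by rewrite blow_node; apply: (IH 0).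
- by [].
move=> d ds IHd IHds p i a /= li.
rewrite ltnNge leq_addr /= ltn_add2l nth_cat size_map (size_leaves _).1.
case: ltnP => ld; rewrite steps_edge_cat at_edge.
  by rewrite eqxx addKn Lw_lt // IHd // (nth_map [::]) ?(size_leaves _).1.
have -> : ((p + i - nleaves d).+1 == p) = false by lia.
have -> : (p + i - nleaves d).+1 = p.+1 + (i - nleaves d) by lia.
by apply: IHds; lia.
Qed.

Lemma canon_edge :
  (forall f a, valid f -> edge (src f) a -> steps_edge (canon f) a = rmap_edge f a) *
  (forall fs i a, all valid fs -> i < size fs -> edge (nth Eta (map src fs) i) a ->
     steps_edge (nth [::] (map canon fs) i) a = rmap_edge (nth (RLeaf Eta) fs i) a).
Proof.
apply: rmap_forest_ind => [[|[] ts] [|//] _ _ //|D fs IH a /= /andP[/eqP nD vf]||].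
- rewrite (_ : canon _ = Top (size ts) :: par 0 (map grow ts)) /= ?par_edge0 //;
  exact: grow_node_word.
- rewrite steps_edge_cat; case: a => [_|j a /andP[lj ea]].
    rewrite par_edge0; case: D {nD} => //= _ ds.
    by elim: ds (0) => //= d ds IHds k; rewrite steps_edge_cat; elim: (blow d).
  rewrite size_map in lj.
  rewrite (par_edge 0 _ j) blow_edge.1 ?nD // IH //.
- by [].
move=> f fs IHf IHfs [|i] a /= /andP[vf vfs]; first by move=> _; apply: IHf.
by move=> li ea; apply: IHfs.
Qed.

Lemma nf_edge q f T a : valid f -> edge (src f) a -> edge T q ->
  steps_edge (canon f ++ incl q T) a = q ++ rmap_edge f a.
Proof. by move=> vf ea eq; rewrite steps_edge_cat incl_edge // canon_edge.1. Qed.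

(** The leaf addresses of one tree are selected by their first index. The sizes have to agree
    beforehand, because trees without leaves leave no trace in the list. *)
Lemma leaves_from_inj (ds ds' : seq (tree unit)) k : size ds = size ds' ->
  leaves_from k ds = leaves_from k ds' -> map (@leaves unit) ds = map (@leaves unit)
    ds'.
Proof.
elim: ds ds' k => [|d ds IH] [|d' ds'] //= k [sz] E.
have H (e : tree unit) (es : seq (tree unit)) :
  [seq behead l | l <- map (cons k) (leaves e) ++ leaves_from k.+1 es & head 0 l ==
    k] = leaves e.
  rewrite filter_cat map_cat.
  have -> : [seq l <- leaves_from k.+1 es | head 0 l == k] = [::].
    have nil m : k < m -> [seq l <- leaves_from m es | head 0 l == k] = [::]; last
      exact: nil.
    elim: es m => //= f es IHe m km.
    rewrite filter_cat IHe ?cats0; last by lia.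
    elim: (leaves f) => //= l ls ->; by have -> : (m == k) = false by lia.
  rewrite cats0; elim: (leaves e) => //= l ls IHl; by rewrite eqxx /= IHl.
have Ed : leaves d = leaves d' by rewrite -(H d ds) E H.
rewrite Ed; congr cons; apply: IH k.+1 sz _.
move: E; rewrite Ed => /(congr1 (drop (size (map (cons k) (leaves d'))))).
by rewrite !drop_size_cat.
Qed.

(** The lower tree is the common result cut off at the leaf addresses, so these addresses separate
    it from the trees grafted onto it. *)
Lemma graft_inj :
  (forall (D D' : tree unit) (ts ts' : seq (tree unit)), size ts = nleaves D -> size
    ts' = nleaves D' ->
     leaves D = leaves D' -> graft D ts = graft D' ts' -> D = D' /\ ts = ts') *
  (forall (ds ds' ts ts' : seq (tree unit)), size ts = sumn (map (@nleaves unit) ds) ->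
     size ts' = sumn (map (@nleaves unit) ds') ->
     map (@leaves unit) ds = map (@leaves unit) ds' -> grafts ds ts = grafts ds' ts' ->
     ds = ds' /\ ts = ts').
Proof.
have lvs_eta (es : seq (tree unit)) k : leaves_from k es <> [:: [::]].
  by elim: es k => //= e es IH k; case: (leaves e) => [|l ls] /=; [apply: IH|].
apply: tree_forest_ind.
- case=> [|[] ds'] ts ts' s1 s2 E Eg; last by case: (lvs_eta ds' 0 (esym E)).
  by case: ts s1 Eg => [|t []] //= _; case: ts' s2 => [|t' []] //= _ ->.
- move=> [] ds IH [|[] ds'] ts ts' s1 s2; first by move=> /lvs_eta.
  rewrite !leaves_node !graft_node => E [] Eg.
  have sz : size ds = size ds' by rewrite -(size_grafts ds ts) Eg size_grafts.
  by have [-> ->] := IH ds' ts ts' s1 s2 (leaves_from_inj sz E) Eg.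
- by move=> [|? ?] [|? ?] [|? ?].
move=> d ds IHd IHds [|d' ds'] ts ts' //= /split_size[t1 [t2 [-> s1 s2]]].
move=> /split_size[t1' [t2' [-> s1' s2']]] [Ed Eds].
rewrite !take_size_cat // !drop_size_cat // => -[E1 E2].
have [-> ->] := IHd _ _ _ s1 s1' Ed E1.
by have [-> ->] := IHds _ _ _ s2 s2' Eds E2.
Qed.

(** The images of the inputs of a vertex are the leaf addresses of its replacement [D]. Together
    with the common target they give, by [graft_inj], the tree [D] itself and the targets of the
    branches, to which the induction applies. *)
Lemma rmap_edge_inj :
  (forall f f', valid f -> valid f' -> src f = src f' -> tgt f = tgt f' ->
     (forall a, edge (src f) a -> rmap_edge f a = rmap_edge f' a) -> f = f') *
  (forall fs fs', all valid fs -> all valid fs' -> map src fs = map src fs' ->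
     map tgt fs = map tgt fs' ->
     (forall i a, i < size fs -> edge (nth Eta (map src fs) i) a ->
        rmap_edge (nth (RLeaf Eta) fs i) a = rmap_edge (nth (RLeaf Eta) fs' i) a) ->
          fs = fs').
Proof.
apply: rmap_forest_ind.
- by move=> T [T'|//] _ _ _ /= ->.
- move=> D fs IH [//|D' fs'] /= /andP[/eqP nD vf] /andP[/eqP nD' vf'] [] Es Et H.
  have sz : size fs = size fs' by rewrite -(size_map src fs) Es size_map.
  have El : leaves D = leaves D'.
    apply: (@eq_from_nth _ [::]); rewrite !(size_leaves _).1 ?nD ?nD' // => i li.
    have := H [:: i]; rewrite /= size_map li => /(_ isT).
    by rewrite !cats0.
  have [||ED Ets] := graft_inj.1 _ _ _ _ _ _ El Et; rewrite ?size_map //.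
  rewrite ED; congr RNode; apply: IH => // i a li ea.
  have := H (i :: a); rewrite /= size_map li ea => /(_ isT).
  by rewrite El; move/eqP; rewrite eqseq_cat // eqxx => /eqP.
- by move=> [].
move=> f fs IHf IHfs [|f' fs'] //= /andP[vf vfs] /andP[vf' vfs'] [E1 E2] [E3 E4] H.
congr cons; first by apply: IHf => // a ea; apply: (H 0).
by apply: IHfs => // i a li ea; apply: (H i.+1).
Qed.

(** * Edge maps determine morphisms *)

Lemma subtreeE T e : subtree T e = if edge T e then Some (above T e) else None.
Proof. by elim: e T => //= i e IH [|[] ts] //; case: ltnP. Qed.

Lemma is_edgeE T e : is_edge T e = edge T e.
Proof. by rewrite /is_edge subtreeE; case: edge. Qed.

Lemma subtree_some T e U : subtree T e = Some U -> edge T e /\ above T e = U.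
Proof. by rewrite subtreeE; case: edge => // -[]. Qed.

Lemma at_vertex_cons i p f j a : at_vertex (i :: p) f (j :: a) =
  if j == i then i :: at_vertex p f a else j :: a.
Proof.
by rewrite /at_vertex /= eq_sym; case: eqP => [->|] //=; case: ifP.
Qed.

Lemma subtree_mid l S r p : subtree (N (l ++ S :: r)) (size l :: p) = subtree S p.
Proof. by rewrite /= size_cat /= addnS ltnS leq_addr nth_catr. Qed.

Lemma replace_mid l S r p U :
  replace_subtree (N (l ++ S :: r)) (size l :: p) U = N
    (l ++ replace_subtree S p U :: r).
Proof. by rewrite /= nth_catr // set_nth_cat. Qed.

(** A root-preserving step in the format of the constructors of [elementary]: at an address [p],
    instead of under nested [At]. *)
Variant local g S T : Prop :=
| local_inner p l m r of subtree T p = Some (N (l ++ N m :: r))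
    & S = replace_subtree T p (N (l ++ m ++ r))
    & (forall a, step_edge g a = at_vertex p (uncontract (size l) (size m)) a)
| local_top p n of subtree T p = Some (corolla n tt) & S = replace_subtree T p Eta
    & (forall a, step_edge g a = a)
| local_deg p U of subtree S p = Some (N [:: U]) & T = replace_subtree S p U
    & (forall a, step_edge g a = at_vertex p behead a).

Lemma rstep_local g S T : rstep g S T -> local g S T.
Proof.
have emA i h p f : (forall a, step_edge h a = at_vertex p f a) ->
    forall a, step_edge (At i h) a = at_vertex (i :: p) f a.
  by move=> H [|j a] //; rewrite at_vertex_cons /= H.
elim=> {g S T} [l m r|U|n|l r g S T _ [p l' m' r' E1 E2 E3|p n E1 E2 E3|p U E1 E2 E3]].
- by apply: (@local_inner _ _ _ [::] l m r) => // a; rewrite /at_vertex drop0 prefix0s.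
- by apply: (@local_deg _ _ _ [::] U) => // a; rewrite /at_vertex drop0 prefix0s.
- exact: (@local_top _ _ _ [::] n).
- apply: (@local_inner _ _ _ (size l :: p) l' m' r').
  + by rewrite subtree_mid.
  + by rewrite replace_mid -E2.
  + exact: emA.
- apply: (@local_top _ _ _ (size l :: p) n).
  + by rewrite subtree_mid.
  + by rewrite replace_mid -E2.
  + by move=> [|j a] //=; case: eqP => // ->; rewrite E3.
- apply: (@local_deg _ _ _ (size l :: p) U).
  + by rewrite subtree_mid.
  + by rewrite replace_mid -E2.
  + exact: emA.
Qed.

Lemma realize_step g S T : gstep g S T ->
  exists h : elementary S T, forall a, edge S a -> on_edges h a = step_edge g a.
Proof.
case=> [/rstep_local[p l m r E1 -> E3|p n E1 E2 E3|p U E1 -> E3]|[l [r [-> ->]]]].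
- by exists (inner_face E1) => a _; rewrite E3.
(* At the root, [Top] turns the free edge into a corolla; this is a [corolla_face], as [top_face]
   excludes the root vertex. *)
- case: p E1 E2 => [[->] ->|i p E1 E2].
    have e0 : is_edge (corolla n tt) [::] by [].
    by exists (corolla_face e0) => -[|//] _; rewrite E3.
  by subst S; have ne : i :: p <> [::] by []; exists (top_face ne E1) => a _;
    rewrite E3.
- by exists (degeneracy E1) => a _; rewrite E3.
(* Under a free edge, [Up l r] creates a corolla and is its [corolla_face] at the input [l]; in all
   other cases it is a [root_face]. *)
case: S => [|[] ts].
  have e0 : is_edge (corolla (l + r.+1) tt) [:: l].
    by rewrite is_edgeE edge_node size_nseq nth_nseq; case: ifP; rewrite andbT; lia.
  have -> : N (nseq l Eta ++ Eta :: nseq r Eta) = corolla (l + r.+1) tt.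
    by rewrite /corolla nseqD.
  by exists (corolla_face e0) => -[].
have ne : Node tt ts <> Eta by [].
by exists (root_face l r ne).
Qed.

Definition ats p g := foldr At g p.

Lemma ats_edge p g a : step_edge g [::] = [::] -> step_edge (ats p g) a = at_vertex p
  (step_edge g) a.
Proof.
move=> g0; elim: p a => [|i p IH] a /=; first by rewrite /at_vertex prefix0s drop0.
by case: a => [|j a] //; rewrite at_vertex_cons IH.
Qed.

Lemma rstep_ats T p g U1 U2 : edge T p -> rstep g U1 U2 ->
  rstep (ats p g) (replace_subtree T p U1) (replace_subtree T p U2).
Proof.
move=> + gU; elim: p T => //= i p IH [|[] ts] // /andP[li ep].
have [l [r [E sl]]] := split_nth Eta li.
rewrite {1 3}E !set_nth_cat //; apply: (atP (IH _ ep)) => //.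
Qed.

Lemma replace_id T p : edge T p -> replace_subtree T p (above T p) = T.
Proof.
elim: p T => //= i p IH [|[] ts] // /andP[li ep]; rewrite IH //.
have [l [r [E sl]]] := split_nth Eta li.
by rewrite {1}E set_nth_cat // -E.
Qed.

Lemma step_of S T (h : elementary S T) :
  exists2 g, gstep g S T & forall a, edge S a -> on_edges h a = step_edge g a.
Proof.
case: h => {S T} [T p l m r H|T p n np H|U l r nU|n e He|T p U H] /=.
- have [ep sp] := subtree_some H.
  exists (ats p (Inner (size l) (size m))); last by move=> a _; rewrite ats_edge.
  by left; rewrite -{2}(replace_id ep) sp; apply: rstep_ats => //; apply: rstep_inner.
- have [ep sp] := subtree_some H.
  exists (ats p (Top n)).
    by left; rewrite -{2}(replace_id ep) sp; apply: rstep_ats => //; apply: rstep_top.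
  move=> a _ /=; rewrite ats_edge // /at_vertex; case: ifP => // /prefixP[b ->].
  by rewrite drop_size_cat.
- by exists (Up l r) => //; apply: upP.
- move: He; rewrite is_edgeE => ee; case: e ee => [|i e] ee.
    by exists (Top n) => [|[]//]; left; apply: rstep_top.
  move: (ee); rewrite edge_node size_nseq nth_nseq => /andP[li]; rewrite li.
  case: e ee => // ee _; exists (Up i (n - i.+1)) => [|[]//].
  apply: upP; rewrite /corolla {1}(_ : n = i + (n - i.+1).+1) ?nseqD //; lia.
- have [ep sp] := subtree_some H.
  exists (ats p Deg); last by move=> a _; rewrite ats_edge.
  by left; rewrite -{1}(replace_id ep) sp; apply: rstep_ats => //; apply: rstep_deg.
Qed.

(** Serves to show that a step and its source fix the target, so that the intermediate trees of two
    typed words can be identified. *)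
Fixpoint apply_step g (S : tree unit) : tree unit :=
  match g with
  | Inner i k => if S is Node _ ts then N
    (take i ts ++ N (take k (drop i ts)) :: drop k (drop i ts)) else Eta
  | Deg => if S is Node _ ts then head Eta ts else Eta
  | Top n => corolla n tt
  | At i g => if S is Node _ ts then N
    (set_nth Eta ts i (apply_step g (nth Eta ts i))) else Eta
  | Up l r => N (nseq l Eta ++ S :: nseq r Eta)
  end.

Lemma gstep_apply g S T : gstep g S T -> apply_step g S = T.
Proof.
case=> [|[l [r [-> ->]]]] //.
elim=> {g S T} //= [l m r|l r g S T _ IH].
- by rewrite take_size_cat ?drop_size_cat // take_size_cat ?drop_size_cat.
- by rewrite nth_catr // set_nth_cat // IH.
Qed.

Lemma gstep_fun g S T T' : gstep g S T -> gstep g S T' -> T = T'.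
Proof. by move=> /gstep_apply <- /gstep_apply. Qed.

(* [S -> N [:: S] -> S] is the identity, so that the relations between words of
   length two extend to words of length one. *)
Lemma letter_eq S T (g g' : elementary S T) :
  (forall a, edge S a -> on_edges g a = on_edges g' a) ->
  dend_eq (word_cons g (word_nil T)) (word_cons g' (word_nil T)).
Proof.
move=> E.
have [s sE] := @realize_step (Up 0 0) S (N [:: S]) (upP erefl).
have [d dE] := realize_step (rstep_gstep (rstep_deg S)).
have sd a : edge S a -> on_edges d (on_edges s a) = a.
  by move=> ea; rewrite sE // dE //= ?ea ?andbT.
have Hsd : dend_eq (word_cons s (word_cons d (word_nil S))) (word_nil S).
  by apply: dend_section => a; rewrite is_edgeE; apply: sd.
have add h : dend_eq (word_cons h (word_nil T))
    (word_cons s (word_cons d (word_cons h (word_nil T)))).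
  exact: (dend_cat (dend_sym Hsd) (dend_refl (word_cons h (word_nil T)))).
apply: dend_trans (add g) _; apply: dend_trans (dend_sym (add g')).
apply: (dend_cat (dend_refl (word_cons s (word_nil _))) (dend_square _)).
move=> a; rewrite is_edgeE => ea; apply: E.
rewrite dE //; apply: rstep_edge ea; exact: rstep_deg.
Qed.

(** * Typed words over untyped words *)

Definition agree S T (g : elementary S T) a :=
  gstep a S T /\ forall e, edge S e -> on_edges g e = step_edge a e.

Fixpoint realizes S T (u : word S T) (ws : seq step) : Prop :=
  match u with
  | word_nil _ => ws = [::]
  | word_cons _ _ _ g w => exists a ws', [/\ ws = a :: ws', agree g a & realizes w ws']
  end.

Lemma realizes_ex S T (u : word S T) : exists2 ws, path gstep ws S T & realizes u ws.
Proof.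
elim: u => {S T} [T|S T U g u [ws p r]]; first by exists [::].
by have [a aS aE] := step_of g; exists (a :: ws); [exists T|exists a, ws].
Qed.

Lemma path_realizes ws S T : path gstep ws S T -> exists u : word S T, realizes u ws.
Proof.
elim: ws S => [S /= <-|a ws IH S /= [S' aS /IH[u r]]]; first by exists (word_nil S).
have [g gE] := realize_step aS.
by exists (word_cons g u), a, ws.
Qed.

Lemma realizes_nil S T (u : word S T) (e : S = T) : realizes u [::] ->
  u = eq_rect S (word S) (word_nil S) T e.
Proof.
case: u e => [T' e _|S' T' U g w e [a [ws' []]]] //.
by rewrite (proof_irrelevance _ e erefl).
Qed.

Lemma realizes_cons S T (u : word S T) a ws : realizes u (a :: ws) ->
  exists S' (g : elementary S S') (w : word S' T),
    [/\ u = word_cons g w, agree g a & realizes w ws].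
Proof.
case: u => //= S' T' U g w [a' [ws' [[-> ->] ga rw]]].
by exists T', g, w.
Qed.

Lemma realizes2 S T (u : word S T) a b : realizes u [:: a; b] ->
  exists S' (g : elementary S S') (h : elementary S' T),
    [/\ u = word_cons g (word_cons h (word_nil T)), agree g a & agree h b].
Proof.
move=> /realizes_cons[S' [g [w [-> ga /realizes_cons[S2 [h [w' [-> hb r]]]]]]]].
case: w' h hb r => [T' h hb _|S3 T' U g' w' h hb [? [? []]]] //.
by exists S', g, h.
Qed.

(** Letters that agree with the same step have the same target by [gstep_fun], and are then related
    by [letter_eq]. *)
Lemma realizes_fun ws S T (u v : word S T) : realizes u ws -> realizes v ws ->
  dend_eq u v.
Proof.
elim: ws S u v => [|a ws IH] S u v.
  case: u v => [T' v _|? ? ? ? ? ? [? [? []]]] // rv.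
  rewrite (realizes_nil erefl rv) /=; exact: dend_refl.
move=> /realizes_cons[S1 [g1 [w1 [-> [g1a E1] r1]]]]
  /realizes_cons[S2 [g2 [w2 [-> [g2a E2] r2]]]].
have E := gstep_fun g1a g2a; subst S2.
apply: (@dend_cat _ _ _ (word_cons g1 (word_nil _)) (word_cons g2 (word_nil _))).
  by apply: letter_eq => e ee; rewrite E1 ?E2.
exact: IH.
Qed.

Lemma realizes_cat S T (u : word S T) ws1 ws2 : realizes u (ws1 ++ ws2) ->
  exists S' (u1 : word S S') (u2 : word S' T),
    [/\ u = word_cat u1 u2, realizes u1 ws1 & realizes u2 ws2].
Proof.
elim: ws1 S u => [|a ws1 IH] S u r; first by exists S, (word_nil S), u.
have [S1 [g [w [-> ga /IH[S' [u1 [u2 [-> r1 r2]]]]]]]] := realizes_cons r.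
by exists S', (word_cons g u1), u2; split=> //; exists a, ws1.
Qed.

Lemma realizes_path S T (u : word S T) ws : realizes u ws -> path gstep ws S T.
Proof.
elim: u ws => {S T} [T ws -> //|S T U g u IH _ [a [ws [-> [aS _] /IH p]]]].
by exists T.
Qed.

Lemma path_fun ws S T T' : path gstep ws S T -> path gstep ws S T' -> T = T'.
Proof.
elim: ws S => [S /= -> //|a ws IH S /= [S1 a1 p1] [S2 a2 p2]].
by have E := gstep_fun a1 a2; subst S2; apply: IH p1 p2.
Qed.

(** The generators of [req] and [dend_eq] match, as both are stated by effects on edges.
    Transitivity needs a typed middle word, from [path_realizes], and concatenation needs equal
    middle trees, from [path_fun]. *)
Lemma req_dend S T ws ws' : req gstep S T ws ws' ->
  forall u u' : word S T, realizes u ws -> realizes u' ws' -> dend_eq u u'.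
Proof.
elim=> {S T ws ws'}.
- move=> S T T' U g h g' h' R1 R2 R3 R4 E u u'.
  move=> /realizes2[S1 [x [y [-> [x1 x2] [y1 y2]]]]]
    /realizes2[S2 [x' [y' [-> [x1' x2'] [y1' y2']]]]].
  apply: dend_square => a; rewrite is_edgeE => ea.
  rewrite x2 // x2' // y2 ?y2' ?E //; exact: gstep_edge ea.
- move=> S T g h R1 R2 E u u' /realizes2[S1 [x [y [-> [x1 x2] [y1 y2]]]]]
  /(realizes_nil erefl) -> /=.
  apply: dend_section => a; rewrite is_edgeE => ea.
  rewrite x2 // y2 ?E //; exact: gstep_edge ea.
- by move=> S T ws _ u u'; apply: realizes_fun.
- by move=> S T ws ws' _ IH u u' ru ru'; apply: dend_sym; apply: IH.
- move=> S T ws1 ws2 ws3 r IH1 _ IH2 u u' ru ru'.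
  have [v rv] := path_realizes (req_pathr r).
  by apply: dend_trans (IH1 _ _ ru rv) (IH2 _ _ rv ru').
move=> S T U w1 w1' w2 w2' r1 IH1 r2 IH2 u u'.
move=> /realizes_cat[S1 [u1 [u2 [-> a1 a2]]]] /realizes_cat[S2 [v1 [v2 [-> b1 b2]]]].
have E1 := path_fun (realizes_path a1) (req_pathl r1).
have E2 := path_fun (realizes_path b1) (req_pathr r1).
by subst S1 S2; apply: dend_cat; [apply: IH1|apply: IH2].
Qed.

Fixpoint word_edge S T (u : word S T) (a : seq nat) : seq nat :=
  match u with word_nil _ => a | word_cons _ _ _ g w => word_edge w (on_edges g a) end.

Lemma word_edge_cat S T U (u : word S T) (v : word T U) a : word_edge (word_cat u v)
  a = word_edge v (word_edge u a).
Proof. by elim: u v a => {S T} //= S T V g u IH v a; rewrite IH. Qed.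

Lemma word_edge_realizes S T (u : word S T) ws a : realizes u ws -> edge S a ->
  word_edge u a = steps_edge ws a.
Proof.
elim: u ws a => {S T} [T ws a -> //|S T U g u IH _ a [b [ws [-> [bS bE] r]]] ea] /=.
by rewrite bE //; apply: IH => //; apply: gstep_edge bS _ ea.
Qed.

Lemma edge_word_edge S T (u : word S T) a : edge S a -> edge T (word_edge u a).
Proof.
move=> ea; have [ws p r] := realizes_ex u; rewrite (word_edge_realizes r ea).
exact: path_edge p _ ea.
Qed.

Lemma dend_eq_edge S T (u v : word S T) : dend_eq u v -> forall a, edge S a ->
  word_edge u a = word_edge v a.
Proof.
elim=> {S T u v} //=.
- by move=> S T T' U g h g' h' E a ea; apply: E; rewrite is_edgeE.
- by move=> S T g h E a ea; apply: E; rewrite is_edgeE.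
- by move=> S T u v _ IH a ea; rewrite IH.
- by move=> S T u v w _ IH1 _ IH2 a ea; rewrite IH1 // IH2.
- move=> S T U u u' v v' _ IH1 _ IH2 a ea; rewrite !word_edge_cat IH1 // IH2 //.
  exact: edge_word_edge.
Qed.

Lemma word_nf S T (u : word S T) :
  exists q f, [/\ valid f, src f = S, edge T q, above T q = tgt f &
    forall a, edge S a -> word_edge u a = q ++ rmap_edge f a].
Proof.
have [ws p r] := realizes_ex u.
have [q [f [vf sf eq sq rq]]] := nf_word p.
exists q, f; split=> // a ea.
by rewrite (word_edge_realizes r ea) (req_edge rq ea) nf_edge // sf.
Qed.

Lemma nf_path q f T : valid f -> edge T q -> above T q = tgt f ->
  path gstep (canon f ++ incl q T) (src f) T.
Proof.
move=> vf eq sq; apply: path_cat; first exact: gpath (canon_path.1 f vf).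
by rewrite -sq; apply: inclP.
Qed.

Lemma nf_realize q f T : valid f -> edge T q -> above T q = tgt f ->
  exists u : word (src f) T, forall a, edge (src f) a -> word_edge u a = q ++
    rmap_edge f a.
Proof.
move=> vf eq sq; have [u r] := path_realizes (nf_path vf eq sq).
by exists u => a ea; rewrite (word_edge_realizes r ea) nf_edge.
Qed.

Lemma nf_inj q f q' f' T : valid f -> valid f' -> src f = src f' ->
  above T q = tgt f -> above T q' = tgt f' ->
  (forall a, edge (src f) a -> q ++ rmap_edge f a = q' ++ rmap_edge f' a) -> q = q'
    /\ f = f'.
Proof.
move=> vf vf' es sq sq' E.
(* Evaluation at the root edge of the source, which root-preserving maps send to the root edge. *)
have Eq : q = q' by have := E [::] isT; case: (f) (f') => [?|? ?] [?|? ?];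
  rewrite !cats0.
split=> //; apply: rmap_edge_inj.1 => //; first by rewrite -sq -sq' Eq.
by move=> a /E/eqP; rewrite Eq eqseq_cat // eqxx => /eqP.
Qed.

Lemma dend_eqP S T (u v : word S T) :
  (forall a, edge S a -> word_edge u a = word_edge v a) -> dend_eq u v.
Proof.
move=> E; have [ws p r] := realizes_ex u; have [ws' p' r'] := realizes_ex v.
have [q [f [vf sf eq sq rq]]] := nf_word p.
have [q' [f' [vf' sf' eq' sq' rq']]] := nf_word p'.
have [||Eq Ef] := nf_inj vf vf' _ sq sq'; first by rewrite sf sf'.
  rewrite sf => a ea; rewrite -(@nf_edge q f T) ?sf // -(@nf_edge q' f' T) ?sf' //.
  by rewrite -(req_edge rq ea) -(req_edge rq' ea) -(word_edge_realizes r ea)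
    -(word_edge_realizes r' ea) E.
subst q' f'.
exact: (req_dend (req_trans rq (req_sym rq')) r r').
Qed.

(** * Normalization of operations *)

(** Replaces the induction nested through [tree] and [seq] by one hypothesis for all labels of the
    decoration. *)
Lemma op_labels_ind (X : Type) (P : op X -> Prop) :
  (forall k x, P (Stem k x)) ->
  (forall w D, (forall c, List.In c (labels D) -> P c) -> P (Vertex w D)) ->
  forall b, P b.
Proof.
move=> PS PV; fix IH 1; case=> [k x|w D]; first exact: PS.
apply: PV; move: D; fix IHD 1; case=> [c []|a ts c /= [<-|]]; first exact: IH.
elim: ts => [[]|t ts IHts] /=.
by move/(@List.in_app_or _ _ _ _) => [/IHD|/IHts].
Qed.

Section Labels.
Variable A : Type.

Lemma in_cat_or (s t : seq A) x : List.In x (s ++ t) <-> List.In x s \/ List.In x t.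
Proof. by split; [apply: List.in_app_or|apply: List.in_or_app]. Qed.

Lemma eq_tmap_in (B : Type) (f g : A -> B) :
  (forall t : tree A, (forall x, List.In x (labels t) -> f x = g x) -> tmap f t =
    tmap g t) *
  (forall ts : seq (tree A), (forall x, List.In x (flatten (map (@labels A) ts)) -> f
    x = g x) ->
     map (tmap f) ts = map (tmap g) ts).
Proof.
apply: tree_forest_ind => //= [a ts IH H|t ts IHt IHts H].
- by rewrite H ?IH //; [move=> x xt; apply: H; right|left].
- by rewrite IHt ?IHts // => x xt; apply: H; apply/in_cat_or; [right|left].
Qed.

Lemma above_in (t : tree A) p a us : above t p = Node a us -> List.In a (labels t).
Proof.
elim: p t => [|i p IH] [|b ts] //=; first by move=> [-> _]; left.
move=> H; right; elim: ts i H => [|t ts IHts] [|i] /= H; try by case: p H {IH}.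
- by apply/in_cat_or; left; apply: IH H.
- by apply/in_cat_or; right; apply: IHts H.
Qed.

Lemma all_vertices_in (p q : A -> nat -> bool) :
  (forall t : tree A, (forall x n, List.In x (labels t) -> p x n -> q x n) ->
     all_vertices p t -> all_vertices q t) *
  (forall ts : seq (tree A), (forall x n, List.In x (flatten (map (@labels A) ts)) ->
    p x n -> q x n) ->
     all (all_vertices p) ts -> all (all_vertices q) ts).
Proof.
apply: tree_forest_ind => //= [a ts IH H /andP[pa pts]|t ts IHt IHts H /andP[pt pts]].
- rewrite H //=; last by left. by apply: IH => // x n xt; apply: H; right.
- rewrite IHt ?IHts // => x n xt; apply: H; apply/in_cat_or; by [right|left].
Qed.

Lemma all_vertices_all (p : A -> bool) t : all_vertices (fun a _ => p a) t = all p
  (labels t).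
Proof.
move: t; apply: (fst (tree_forest_ind (Q := fun ts =>
  all (all_vertices (fun a _ => p a)) ts = all p (flatten (map (@labels A) ts))) _ _
    _ _)) => //=.
- by move=> a ts ->.
- by move=> t ts -> ->; rewrite all_cat.
Qed.

Lemma all_in (p : A -> bool) (s : seq A) : all p s <-> forall x, List.In x s -> p x.
Proof.
split; last first.
  elim: s => //= x s IH H; rewrite H; last by left.
  by apply: IH => y ys; apply: H; right.
by elim: s => //= x s IH /andP[px ps] y [<-//|]; apply: IH.
Qed.

Lemma all_vertices_inP (p : A -> nat -> bool) (t : tree A) x : all_vertices p t ->
  List.In x (labels t) -> exists n, p x n.
Proof.
move: t; apply: (fst (tree_forest_ind (Q := fun ts =>
  all (all_vertices p) ts -> List.In x (flatten (map (@labels A) ts)) -> exists n, p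
    x n) _ _ _ _)) => //=.
- by move=> a ts IH /andP[pa pts] [<-|]; [exists (size ts)|apply: IH].
- by move=> t ts IHt IHts /andP[pt pts] /in_cat_or[/(IHt pt)|/(IHts pts)].
Qed.

Lemma above_size t p a us (q : A -> nat -> bool) : all_vertices q t ->
  above t p = Node a us -> q a (size us).
Proof. by move=> /(all_vertices_above p) + E; rewrite E => /andP[]. Qed.

End Labels.

Notation wd := (fun c n => (root_edge c == n) && well_decorated c).

Section Ops.
Variable X : Type.
Implicit Types (b c : op X) (D Y : tree (op X)).

Lemma wd_vertex w D : well_decorated (Vertex w D) = all_vertices wd D.
Proof. by []. Qed.

Lemma wd_in D c : all_vertices wd D -> List.In c (labels D) -> well_decorated c.
Proof. by move=> aD /(all_vertices_inP aD)[n /andP[]]. Qed.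

Lemma nleaves_target b : well_decorated b -> nleaves (target b) = root_edge b.
Proof.
elim/op_labels_ind: b => [k x _|w D IH]; first by rewrite nleaves_corolla.
rewrite wd_vertex => wD /=; rewrite (nleaves_tjoin _).1 ?nleaves_tmap //.
rewrite wf_tmap; apply: (all_vertices_in _ _).1 wD => c n cD /andP[/eqP <- wc].
by rewrite IH.
Qed.

Lemma wf_target D : all_vertices wd D -> wf (tmap (@target X) D).
Proof.
move=> wD; rewrite wf_tmap; apply: all_vertices_impl wD => c n /andP[/eqP <- wc].
by rewrite nleaves_target.
Qed.

(* The root edge of the white vertex of the operation, which is decorated by the
   tree, becomes the edge at the given address in the target. *)
Inductive wpos : op X -> seq nat -> tree (op X) -> Prop :=
| wpos_white D : wpos (Vertex true D) [::] D
| wpos_black D p b us q D' of above D p = Node b us & wpos b q D' :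
    wpos (Vertex false D) (join_edge (tmap (@target X) D) p ++ q) D'.

(** What may lie over an input of a black vertex in a reduced operation; on decorations with such
    labels, [expand_black] undoes [black_vertex]. *)
Definition good (c : op X) (n : nat) : bool :=
  [&& root_edge c == n, well_decorated c, ~~ is_black c & reduced c].

Lemma nvertices1 (A : Type) (a : A) ts : nvertices (Node a ts) == 1 -> Node a ts =
  corolla (size ts) a.
Proof.
rewrite /nvertices /= => /eqP[] H; rewrite /corolla; congr Node.
by elim: ts H => //= -[|? ?] ts IH //= /IH <-.
Qed.

Lemma expand_black_vertex Y : all_vertices good Y -> expand_black (black_vertex Y) = Y.
Proof.
case: Y => [//|b ts] gY; rewrite /black_vertex; case: ifP => // n1.
move: gY => /andP[/and4P[/eqP rb _ nb _] _].
by rewrite (nvertices1 n1) -rb; case: b nb {rb n1} => // -[].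
Qed.

Lemma target_black_vertex Y : all_vertices good Y ->
  target (black_vertex Y) = tjoin (tmap (@target X) Y).
Proof.
case: Y => [//|b ts] gY; rewrite /black_vertex; case: ifP => // n1.
move: gY => /andP[/and4P[/eqP rb wb _ _] _].
rewrite (nvertices1 n1) -rb /= map_nseq /= map_nseq -(nleaves_target wb).
by rewrite (graft_eta _).1.
Qed.

Lemma root_black_vertex Y : all_vertices good Y ->
  root_edge (black_vertex Y) = nleaves Y.
Proof.
case: Y => [//|b ts] gY; rewrite /black_vertex; case: ifP => // n1.
move: gY => /andP[/and4P[/eqP rb wb _ _] _].
by rewrite (nvertices1 n1) nleaves_corolla.
Qed.

Lemma wd_black_vertex Y : all_vertices good Y -> well_decorated (black_vertex Y).
Proof.
move=> gY; have : well_decorated (Vertex false Y).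
  by rewrite wd_vertex; apply: all_vertices_impl gY => c n /and4P[r w _ _]; rewrite r w.
case: Y gY => // b ts gY; rewrite /black_vertex; case: ifP => // _ _.
by move: gY => /andP[/and4P[]].
Qed.

Lemma reduced_black_vertex Y : all_vertices good Y -> reduced (black_vertex Y).
Proof.
move=> gY.
have aY : all (fun c => ~~ is_black c && reduced c) (labels Y).
  by rewrite -all_vertices_all; apply: all_vertices_impl gY => c n /and4P[_ _ nb r];
    rewrite nb r.
have : (nvertices Y != 1) -> reduced (Vertex false Y).
  move=> n1 /=; rewrite n1 /=; apply/andP; split.
    by rewrite -all_predC; apply: sub_all aY => c /andP[].
  by rewrite (labels_tmap _).1 all_map; apply: sub_all aY => c /andP[].
case: Y gY aY => [|b ts] gY aY; first by apply.
rewrite /black_vertex; case: ifP => [_ _|_]; last by apply.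
by move: aY => /= /andP[/andP[]].
Qed.

Lemma whites_black_vertex Y :
  whites (black_vertex Y) = flatten (labels (tmap (@whites X) Y)).
Proof.
case: Y => [//|b ts]; rewrite /black_vertex; case: ifP => // n1.
by rewrite (nvertices1 n1) /= map_nseq; elim: (size ts) => //=; rewrite cats0.
Qed.

(** If the black vertex is unary, it is dropped; but then [p] is the root of [Y] and contributes the
    empty address. *)
Lemma wpos_black_vertex Y p D us : above Y p = Node (Vertex true D) us ->
  wpos (black_vertex Y) (join_edge (tmap (@target X) Y) p) D.
Proof.
move=> E; case: Y E => [|b ts]; first by case: p.
rewrite /black_vertex; case: ifP => n1 E; last first.
  by rewrite -[join_edge _ _]cats0; apply: (wpos_black E); apply: wpos_white.
move: E; rewrite (nvertices1 n1); case: p => [[-> _]|i p] /=; first exact: wpos_white.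
rewrite nth_nseq; case: ifP => _; by case: p.
Qed.

(* A recursive description of [expand_black (normalize b)]. *)
Fixpoint expand b : tree (op X) :=
  match b with
  | Stem k x => corolla k (Stem k x)
  | Vertex true D => corolla (nleaves D)
    (Vertex true (tmap (fun c => black_vertex (expand c)) D))
  | Vertex false D => tjoin (tmap expand D)
  end.

Lemma good_corolla b n : good b n -> all_vertices good (corolla n b).
Proof. by move=> gb; rewrite /= size_nseq gb /=; elim: n {gb}. Qed.

Lemma tmap_corolla (A B : Type) (f : A -> B) n a : tmap f (corolla n a) = corolla n
  (f a).
Proof. by rewrite /corolla /= map_nseq. Qed.

Lemma tjoin_corolla (A : Type) (u : tree A) : tjoin (corolla (nleaves u) u) = u.
Proof. by rewrite /= map_nseq (graft_eta _).1. Qed.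

Lemma nvertices_corolla (A : Type) n (a : A) : nvertices (corolla n a) = 1.
Proof. by rewrite /nvertices /= map_nseq; elim: n. Qed.

Lemma nth_leaves_corolla (A : Type) n (a : A) i : i < n ->
  nth [::] (leaves (corolla n a)) i = [:: i].
Proof.
move=> li; rewrite leaves_node.
suff L k m j : j < m -> nth [::] (leaves_from k (nseq m (@Eta A))) j = [:: k + j]
  by rewrite L.
elim: m k j => //= m IH k [|j] //=; first by rewrite addn0.
by move=> jm; rewrite IH // addSnnS.
Qed.

Lemma black_vertex_corolla n b : black_vertex (corolla n b) = b.
Proof. by rewrite /black_vertex [corolla n b]/corolla -/(corolla n b)
  nvertices_corolla. Qed.

(** Normalization alternates [black_vertex] and [expand_black], which cancel on good decorations;
    this is what makes the recursion of [expand] agree with it. Goodness is therefore carried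
    through the same induction. *)
Lemma expandP b : well_decorated b ->
  [/\ all_vertices good (expand b), nleaves (expand b) = root_edge b,
      tjoin (tmap (@target X) (expand b)) = target b & normalize b = black_vertex
        (expand b)].
Proof.
elim/op_labels_ind: b => [k x _|w D IH wD].
  split.
  - by apply: good_corolla; rewrite /good /= eqxx.
  - by rewrite nleaves_corolla.
  - by rewrite [expand _]/= tmap_corolla [target _]/= -{1}(nleaves_corolla k x)
    tjoin_corolla.
  - by rewrite [expand _]/= black_vertex_corolla.
have {}IH c : List.In c (labels D) -> _ := fun cD => IH c cD (wd_in wD cD).
case: w wD => wD.
  have En : tmap (@normalize X) D = tmap (fun c => black_vertex (expand c)) D.
    by apply: (eq_tmap_in _ _).1 => c /IH[].
  have Et : tmap (@target X) (tmap (fun c => black_vertex (expand c)) D) = tmap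
    (@target X) D.
    rewrite tmap_comp; apply: (eq_tmap_in _ _).1 => c /IH[g _ <- _] /=.
    exact: target_black_vertex.
  have Ew : all_vertices wd (tmap (fun c => black_vertex (expand c)) D).
    rewrite (all_vertices_tmap _ _).1.
    apply: (all_vertices_in _ _).1 wD => c n /IH[g r _ _] /andP[/eqP <- _].
    by rewrite root_black_vertex // r eqxx wd_black_vertex.
  split.
  - apply: good_corolla; rewrite /good wd_vertex Ew /= nleaves_tmap eqxx /=.
    rewrite (labels_tmap _).1 all_map (labels_tmap _).1 all_map.
    by apply/all_in => c /IH[g _ _ _] /=; apply: reduced_black_vertex.
  - by rewrite nleaves_corolla.
  - rewrite [expand _]/= tmap_corolla [target (Vertex _ _)]/= Et.
    by rewrite -{1}(nleaves_tmap (@target X) D) -(nleaves_tjoin _).1 ?tjoin_corolla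
      //; apply: wf_target.
  - by rewrite [expand _]/= black_vertex_corolla /= En.
have wfE : wf (tmap expand D).
  rewrite wf_tmap; apply: (all_vertices_in _ _).1 wD => c n /IH[_ -> _ _] /andP[] //.
have gE : all_vertices (fun t _ => all_vertices good t) (tmap expand D).
  by rewrite (all_vertices_tmap _ _).1; apply: (all_vertices_in _ _).1 wD => c n /IH[].
split.
- by rewrite /= (all_vertices_tjoin _).1.
- by rewrite /= (nleaves_tjoin _).1 // nleaves_tmap.
- rewrite /= (tjoin_tmap_tjoin _).1 //.
    rewrite tmap_comp; congr tjoin.
    by apply: (eq_tmap_in _ _).1 => c /IH[].
  apply: all_vertices_impl gE => t _; apply: all_vertices_impl => c n
    /and4P[/eqP <- w _ _].
  by rewrite nleaves_target.
- rewrite /=; congr (black_vertex (tjoin _)).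
  apply: (eq_tmap_in _ _).1 => c /IH[g _ _ ->]; exact: expand_black_vertex.
Qed.

Lemma normalize_good b : well_decorated b ->
  [/\ well_decorated (normalize b), reduced (normalize b),
      root_edge (normalize b) = root_edge b & target (normalize b) = target b].
Proof.
move=> /expandP[g r t ->]; rewrite wd_black_vertex ?reduced_black_vertex
  ?root_black_vertex //.
by rewrite target_black_vertex.
Qed.

(** Merging black vertices reorders labels, as in [labels_tjoin], hence a permutation. For
    operations with a single white vertex it becomes an equality. *)
Lemma whites_expand b : well_decorated b ->
  Permutation (flatten (labels (tmap (@whites X) (expand b))))
    (map (tmap (@normalize X)) (whites b)).
Proof.
elim/op_labels_ind: b => [k x _|w D IH wD].
  rewrite /= map_nseq /= map_nseq; elim: k => //= k ih; rewrite cats0; exact: ih.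
have {}IH c : List.In c (labels D) -> _ := fun cD => IH c cD (wd_in wD cD).
have PE : Permutation (flatten (labels (tmap (fun c => whites (normalize c)) D)))
   (map (tmap (@normalize X)) (flatten (labels (tmap (@whites X) D)))).
  rewrite !(labels_tmap _).1.
  have : forall c, List.In c (labels D) -> Permutation (whites (normalize c))
    (map (tmap (@normalize X)) (whites c)).
    move=> c cD; have [_ _ _ ->] := expandP (wd_in wD cD).
    rewrite whites_black_vertex; exact: IH.
  elim: (labels D) => //= c s IHs H; rewrite map_cat; apply: Permutation_app.
    by apply: H; left.
  by apply: IHs => d ds; apply: H; right.
case: w wD => wD.
  have En : tmap (fun c => black_vertex (expand c)) D = tmap (@normalize X) D.
    by apply: (eq_tmap_in _ _).1 => c cD; have [_ _ _ ->] := expandP (wd_in wD cD).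
  rewrite [expand _]/= tmap_corolla /= map_nseq.
  have -> : flatten (nseq (nleaves D) (@nil (seq (tree (op X))))) = [::] by elim:
    (nleaves D).
  rewrite cats0 En; apply: Permutation_cons => //.
  by move: PE; rewrite tmap_comp.
rewrite /= !(labels_tmap _).1.
have wfE : wf (tmap expand D).
  rewrite wf_tmap; apply: (all_vertices_in _ _).1 wD => c n cD /andP[/eqP <- wc].
  by have [_ -> _ _] := expandP wc.
have P1 := (labels_tjoin _).1 _ wfE.
have P2 : Permutation (flatten (map (@whites X) (labels (tjoin (tmap expand D)))))
  (flatten (map (@whites X) (flatten (map (@labels _) (labels (tmap expand D)))))).
  have : forall u v, Permutation u v -> Permutation (flatten (map (@whites X) u))
    (flatten (map (@whites X) v)).
    move=> u v; elim=> //= [x u' v' _ IHu|x y u'|u' v' w' _ IH1 _ IH2].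
    - exact: Permutation_app_head.
    - by rewrite !catA; apply: Permutation_app_tail; apply: Permutation_app_comm.
    - exact: Permutation_trans IH1 IH2.
  by apply.
apply: Permutation_trans P2 _; rewrite (labels_tmap _).1.
elim: (labels D) IH => //= c s IHs H; rewrite !map_cat !flatten_cat;
  apply: Permutation_app.
  by rewrite -(labels_tmap _).1; apply: H; left.
by apply: IHs => d ds; apply: H; right.
Qed.

Lemma whites_normalize b : well_decorated b ->
  Permutation (whites (normalize b)) (map (tmap (@normalize X)) (whites b)).
Proof.
move=> wb; have [_ _ _ ->] := expandP wb; rewrite whites_black_vertex;
  exact: whites_expand.
Qed.

Lemma above_graft_node (A : Type) (t : tree A) p a ts us : above t p = Node a ts ->
  exists ts', above (graft t us) p = Node a ts'.
Proof.
elim: p t us => [|i p IH] [|b vs] us //=; first by move=> [-> _]; eexists.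
rewrite -/(grafts vs us); elim: vs us i => [|v vs IHvs] us [|i] /=; try by case: p {IH}.
- exact: IH.
- exact: IHvs.
Qed.

(** Merging black vertices substitutes decorations into one another. By [join_edge_tjoin_node] the
    address obtained does not depend on the order of the substitutions, so the white vertex keeps
    the address [q]. *)
Lemma wpos_expand b q D : wpos b q D -> well_decorated b ->
  exists p us, above (expand b) p = Node (Vertex true (tmap (@normalize X) D)) us /\
    join_edge (tmap (@target X) (expand b)) p = q.
Proof.
elim=> {b q D} [D wD|D p b us q D' Ep wp IH wD].
  exists [::], (nseq (nleaves D) Eta); split=> //=.
  congr (Node (Vertex true _) _); apply: (eq_tmap_in _ _).1 => c cD.
  by have [_ _ _ ->] := expandP (wd_in wD cD).
have bD := above_in Ep; have [p1 [us1 [E1 E2]]] := IH (wd_in wD bD).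
have wfE : wf (tmap expand D).
  rewrite wf_tmap; apply: (all_vertices_in _ _).1 wD => c n cD /andP[/eqP <- wc].
  by have [_ -> _ _] := expandP wc.
have gE : all_vertices (fun t _ => all_vertices (fun c n => nleaves (target c) == n)
  t) (tmap expand D).
  rewrite (all_vertices_tmap _ _).1; apply: (all_vertices_in _ _).1 wD => c n cD
    /andP[_ wc].
  have [g _ _ _] := expandP wc.
  apply: all_vertices_impl g => a m /and4P[/eqP <- w _ _]; by rewrite nleaves_target.
have Ep' : above (tmap expand D) p = Node (expand b) (map (tmap expand) us)
  by rewrite above_tmap Ep.
have edp : edge (tmap expand D) p by rewrite edge_tmap (above_edge Ep).
have [S1 S2] := above_tjoin wfE edp.
have [us2 E3] := above_graft_node (map (@tjoin _) (map (tmap expand) us)) E1.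
exists (join_edge (tmap expand D) p ++ p1), us2; split.
  by rewrite /= above_cat S1 Ep'.
rewrite [expand _]/= (join_edge_tjoin_node wfE gE Ep' (above_edge E1)) E2 tmap_comp;
  congr (join_edge _ _ ++ _).
apply: (eq_tmap_in _ _).1 => c cD /=.
by have [_ _ -> _] := expandP (wd_in wD cD).
Qed.

Lemma wpos_normalize b q D : wpos b q D -> well_decorated b ->
  wpos (normalize b) q (tmap (@normalize X) D).
Proof.
move=> wp wb; have [p [us [E <-]]] := wpos_expand wp wb.
have [_ _ _ ->] := expandP wb; exact: wpos_black_vertex E.
Qed.

End Ops.

(** * Composition of operations *)

Lemma in_flatten (A B : Type) (f : A -> seq B) s x :
  List.In x (flatten (map f s)) <-> exists2 y, List.In y s & List.In x (f y).
Proof.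
elim: s => [|y s IH] /=; first by split=> // -[].
rewrite in_cat_or IH; split=> [[xy|[z zs xz]]|[z [<-|zs] xz]].
- by exists y => //; left.
- by exists z => //; right.
- by left.
- by right; exists z.
Qed.

Lemma in_above (A : Type) (t : tree A) a : List.In a (labels t) ->
  exists p us, above t p = Node a us.
Proof.
move: t; apply: (fst (tree_forest_ind (Q := fun ts =>
  List.In a (flatten (map (@labels A) ts)) -> exists i p us, above (nth Eta ts i) p =
    Node a us) _ _ _ _)) => //=.
- move=> b ts IH [->|/IH[i [p [us E]]]]; first by exists [::], ts.
  by exists (i :: p), us.
- move=> t ts IHt IHts /in_cat_or[/IHt[p [us E]]|/IHts[i [p [us E]]]].
    by exists 0, p, us.
  by exists i.+1, p, us.
Qed.

Lemma above_count (A B : Type) (w : A -> seq B) t p a us : above t p = Node a us ->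
  size (w a) <= size (flatten (map w (labels t))).
Proof.
elim: p t => [|i p IH] [|b ts] //=.
  by move=> [-> _]; rewrite size_cat leq_addr.
move=> H; rewrite size_cat; apply: leq_trans (leq_addl _ _).
elim: ts i H => [|t ts IHts] [|i] /= H; try by case: p H {IH}.
- by rewrite map_cat flatten_cat size_cat; apply: leq_trans (leq_addr _ _); apply: IH H.
- by rewrite map_cat flatten_cat size_cat; apply: leq_trans (leq_addl _ _);
  apply: IHts H.
Qed.

(** For [w] the list of white vertices: labels at distinct vertices of a decoration contribute
    separately to the total. *)
Lemma above_count2 (A B : Type) (w : A -> seq B) t p a us p' a' us' : p <> p' ->
  above t p = Node a us -> above t p' = Node a' us' ->
  size (w a) + size (w a') <= size (flatten (map w (labels t))).
Proof.
have nthC ts i q c vs : above (nth Eta ts i) q = Node c vs ->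
    size (w c) <= size (flatten (map w (flatten (map (@labels A) ts)))).
  elim: ts i => [|t0 ts IH] [|i] /=; try by case: q.
    by move/(above_count w) => H; rewrite map_cat flatten_cat size_cat;
      apply: leq_trans (leq_addr _ _).
  by move/IH => H; rewrite map_cat flatten_cat size_cat; apply: leq_trans
    (leq_addl _ _).
elim: p p' t => [|i p IH] [|j p'] [|b ts] //= np.
- by move=> [-> _] /nthC; rewrite size_cat leq_add2l.
- by move=> /nthC + [<- _]; rewrite size_cat addnC leq_add2l.
move=> H H'; rewrite size_cat; apply: leq_trans (leq_addl _ _).
elim: ts i j np H H' => [|t0 ts IHts] [|i] [|j] /= np H H'; try
  by [case: p H {IH np} | case: p' H' {np}].
- rewrite map_cat flatten_cat size_cat; apply: leq_trans (leq_addr _ _).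
  by apply: IH H H' => Ep; apply: np; rewrite Ep.
- by rewrite map_cat flatten_cat size_cat leq_add ?(above_count _ H)
  ?(nthC _ _ _ _ _ H').
- by rewrite map_cat flatten_cat size_cat addnC leq_add ?(above_count _ H')
  ?(nthC _ _ _ _ _ H).
- rewrite map_cat flatten_cat size_cat; apply: leq_trans (leq_addl _ _).
  by apply: (IHts i j) => // -[Ei Ep]; apply: np; rewrite Ei Ep.
Qed.

Section Wpos.
Variable X : Type.
Implicit Types (b c : op X) (D : tree (op X)).

Lemma whites_black D : whites (Vertex false D) = flatten (map (@whites X) (labels D)).
Proof. by rewrite /= (labels_tmap _).1. Qed.

Lemma whites_white D : whites (Vertex true D) = D :: flatten
  (map (@whites X) (labels D)).
Proof. by rewrite /= (labels_tmap _).1. Qed.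

(** The inequality is strict because the white vertex itself is counted on the right only. In
    particular, nothing white lies over a single white vertex. *)
Lemma wpos_size b q D : wpos b q D ->
  size (flatten (map (@whites X) (labels D))) < size (whites b).
Proof.
elim=> {b q D} [D|D p b us q D' E _ IH]; first by rewrite whites_white.
rewrite whites_black; apply: leq_trans IH _; exact: above_count E.
Qed.

Lemma wpos_ex b : whites b <> [::] -> exists q D, wpos b q D /\ List.In D (whites b).
Proof.
elim/op_labels_ind: b => [//|[] D IH].
  by move=> _; exists [::], D; split; [apply: wpos_white|rewrite whites_white; left].
rewrite whites_black => ne.
have [c cD nc] : exists2 c, List.In c (labels D) & whites c <> [::].
  elim: (labels D) ne => //= c s IHs; case E: (whites c) => [|x w] ne.
    by have [d ds nd] := IHs ne; exists d => //; right.
  by exists c; [left|rewrite E].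
have [q [D' [wp D'c]]] := IH c cD nc.
have [p [us E]] := in_above cD.
exists (join_edge (tmap (@target X) D) p ++ q), D'; split; first exact: wpos_black E wp.
by apply/in_flatten; exists c.
Qed.

Lemma wpos1 b D : whites b = [:: D] -> exists q, wpos b q D.
Proof.
move=> wb; have [|q [D' [wp]]] := @wpos_ex b; first by rewrite wb.
by rewrite wb => -[->|//]; exists q.
Qed.

Lemma wpos_pos b q D : wpos b q D -> 0 < size (whites b).
Proof. by move/wpos_size; apply: leq_ltn_trans. Qed.

(** Distinct branches leading to white vertices would yield two of them by [above_count2]. *)
Lemma wpos_uniq b q D q' D' : size (whites b) = 1 -> wpos b q D -> wpos b q' D' ->
  q = q' /\ D = D'.
Proof.
move=> + wp; elim: wp q' D' => {b q D} [D|D p b us q D0 E wp IH] q' D' s1 wp'.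
  by move E: (Vertex true D) wp' => d wp'; case: wp' E => // D2 [->].
move Eb: (Vertex false D) wp' => d wp'; case: wp' Eb => // D2 p2 b2 us2 q2 D2' E2 wp2
  [ED].
subst D2; rewrite whites_black in s1.
case: (p =P p2) => [Ep|np]; last first.
  have := above_count2 (@whites X) np E E2; rewrite s1.
  by have := wpos_pos wp; have := wpos_pos wp2; lia.
subst p2; move: E2; rewrite E => -[Eb _]; subst b2.
have [|-> ->] := IH q2 D2' _ wp2; last by [].
by have := above_count (@whites X) E; have := wpos_pos wp; lia.
Qed.

Lemma replace_white_id c b : whites b = [::] -> replace_white c b = b.
Proof.
elim/op_labels_ind: b => [//|[//|] D IH]; rewrite whites_black => w0 /=; congr Vertex.
rewrite -[RHS](tmap_id _ (f := id)) //; apply: (eq_tmap_in _ _).1 => d dD.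
apply: IH => //; elim: (labels D) dD w0 => //= e s IHs [->|ds].
  by case: (whites d).
by case: (whites e) => //; apply: IHs.
Qed.

Lemma whites_replace_white c b D : whites b = [:: D] -> whites (replace_white c b) =
  whites c.
Proof.
elim/op_labels_ind: b => [//|[] D' IH]; first by [].
rewrite whites_black /= !(labels_tmap _).1 -map_comp.
elim: (labels D') IH => //= e s IHs IH.
case E: (whites e) => [|x w] /=.
  move=> /(IHs (fun d ds => IH d (or_intror ds))) ->.
  by rewrite (replace_white_id _ E) E.
move=> [Ex /nilP]; rewrite /nilp size_cat addn_eq0 => /andP[/nilP w0 s0]; subst x w.
rewrite (IH e (or_introl erefl) E).
have -> : flatten (map (@whites X \o replace_white c) s) = flatten (map (@whites X) s).
  elim: s s0 {IHs IH} => //= d s IHs; rewrite size_cat addn_eq0 =>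
    /andP[/nilP d0 /IHs ->].
  by rewrite (replace_white_id _ d0).
by move/nilP: s0 => ->; rewrite cats0.
Qed.

(** A target depends on the labels of a decoration only through their targets, and [c] has the same
    target as the branch that it replaces. *)
Lemma replace_white_good c b : well_decorated c -> well_decorated b ->
  (forall D, List.In D (whites b) -> root_edge c = nleaves D /\ target c = target
    (Vertex true D)) ->
  [/\ root_edge (replace_white c b) = root_edge b,
      target (replace_white c b) = target b & well_decorated (replace_white c b)].
Proof.
move=> wc; elim/op_labels_ind: b => [//|[] D IH wD H].
  by have [|-> ->] := H D; first by rewrite whites_white; left.
have {}IH d : List.In d (labels D) -> [/\ root_edge (replace_white c d) = root_edge d,
      target (replace_white c d) = target d & well_decorated (replace_white c d)].
  move=> dD; apply: IH => //; first exact: wd_in dD.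
  by move=> D0 D0d; apply: H; rewrite whites_black; apply/in_flatten; exists d.
split.
- by rewrite /= nleaves_tmap.
- by rewrite /= tmap_comp; congr tjoin; apply: (eq_tmap_in _ _).1 => d /IH[].
- rewrite [replace_white _ _]/= wd_vertex (all_vertices_tmap _ _).1;
  apply: (all_vertices_in _ _).1 wD.
  by move=> d n /IH[-> _ ->] /andP[-> _].
Qed.

Lemma wpos_replace_white c b q D q1 D1 : well_decorated c -> well_decorated b ->
  (forall D, List.In D (whites b) -> root_edge c = nleaves D /\ target c = target
    (Vertex true D)) ->
  wpos b q D -> wpos c q1 D1 -> wpos (replace_white c b) (q ++ q1) D1.
Proof.
move=> wc wb H wp wp1; elim: wp wb H => {b q D} [//|D p b us q D' E wp IH wD H].
have bD := above_in E.
have Et : tmap (@target X) (tmap (replace_white c) D) = tmap (@target X) D.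
  rewrite tmap_comp; apply: (eq_tmap_in _ _).1 => d dD /=.
  have [|//] := replace_white_good wc (wd_in wD dD).
  by move=> D0 D0d; apply: H; rewrite whites_black; apply/in_flatten; exists d.
rewrite -catA /= -Et; apply: (@wpos_black _ _ _ _ (map (tmap (replace_white c)) us)).
  by rewrite above_tmap E.
apply: IH; first exact: wd_in bD.
by move=> D0 D0d; apply: H; rewrite whites_black; apply/in_flatten; exists b.
Qed.

End Wpos.

Lemma edge_graft (A : Type) (t : tree A) us e : edge t e -> edge (graft t us) e.
Proof.
elim: e t us => [|i e IH] [|a ts] us //= /andP[li ei]; rewrite -/(grafts ts us)
  size_grafts li /=.
elim: ts us i li ei => [|t ts IHts] us [|i] //= li ei; [exact: IH|exact: IHts].
Qed.

(** An edge of [Z] other than the root edge is input [i] of some vertex [p], that is, leaf number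
    [i] of the label of [p], to which [join_edge_tjoin_node] applies. *)
Lemma join_edge_tjoin (A B : Type) (h : A -> tree B) (Z : tree (tree A)) a : wf Z ->
  all_vertices (fun t _ => all_vertices (fun c n => nleaves (h c) == n) t) Z ->
  edge Z a ->
  join_edge (tmap h (tjoin Z)) (join_edge Z a) = join_edge
    (tmap (fun t => tjoin (tmap h t)) Z) a.
Proof.
move=> wZ oZ; case: (lastP a) => [//|p i].
rewrite -cats1 edge_cat (join_edge_cat Z) [RHS]join_edge_cat => /andP[ep].
case E: (above Z p) => [//|t us]; rewrite edge_node => /andP[li _].
have ot : all_vertices (fun c n => nleaves (h c) == n) t by exact: (above_size oZ E).
have nt : nleaves t = size us by apply/eqP; apply: (above_size wZ E).
have [|_ el] := (leaves_edge A).1 t i; first by rewrite nt.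
rewrite [join_edge (Node _ _) _]/= cats0 (join_edge_tjoin_node wZ oZ E el) above_tmap
  E /= cats0.
rewrite (leaves_tjoin _).1 ?wf_tmap // (nth_map [::]) ?(leaves_tmap _).1 //.
by rewrite (size_leaves _).1 nt.
Qed.

Lemma wpos_edge (X : Type) (b : op X) q D a : well_decorated b -> wpos b q D -> edge
  D a ->
  edge (target b) (q ++ join_edge (tmap (@target X) D) a).
Proof.
move=> wb wp ea; elim: wp wb ea => {b q D} [D wD ea|D p b us q D' E wp IH wD ea].
  by apply: edge_join_edge; rewrite ?wf_target // edge_tmap.
have [||S1 S2] := @above_tjoin _ (tmap (@target X) D) p; rewrite ?wf_target
  ?edge_tmap ?(above_edge E) //.
rewrite /= -catA edge_cat S2 S1 above_tmap E /=.
by apply: edge_graft; apply: IH => //; apply: wd_in wD (above_in E).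
Qed.

(** * Relabelling the leaves of an operation *)

Section Opmap.
Variables (X Y : Type) (f : X -> Y).

Lemma root_opmap b : root_edge (opmap f b) = root_edge b.
Proof. by case: b => //= w D; rewrite nleaves_tmap. Qed.

Lemma wd_opmap b : well_decorated (opmap f b) = well_decorated b.
Proof.
elim/op_labels_ind: b => [//|w D IH] ; rewrite [opmap _ _]/= !wd_vertex
  (all_vertices_tmap _ _).1.
apply/idP/idP; apply: (all_vertices_in _ _).1 => c n /IH <-; by rewrite root_opmap.
Qed.

Lemma target_opmap b : target (opmap f b) = tmap f (target b).
Proof.
elim/op_labels_ind: b => [k x|w D IH] /=; first by rewrite map_nseq.
rewrite tmap_comp -tjoin_tmap tmap_comp; congr tjoin.
exact: (eq_tmap_in _ _).1.
Qed.

Lemma tmap_target_opmap D :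
  tmap (@target Y) (tmap (opmap f) D) = tmap (tmap f) (tmap (@target X) D).
Proof. by rewrite !tmap_comp; apply: eq_tmap => c; rewrite /= target_opmap. Qed.

Lemma whites_opmap b : whites (opmap f b) = map (tmap (opmap f)) (whites b).
Proof.
elim/op_labels_ind: b => [//|w D IH] /=; rewrite map_cat !(labels_tmap _).1.
congr (_ ++ _); first by case: w.
by elim: (labels D) IH => //= c s IHs IH; rewrite map_cat (IH c (or_introl erefl))
  IHs // => d ds; apply: IH; right.
Qed.

Lemma wpos_opmap b q D' : wpos (opmap f b) q D' ->
  exists2 D, wpos b q D & D' = tmap (opmap f) D.
Proof.
elim/op_labels_ind: b q D' => [k x|w D IH] q D' wp.
  by move E: (opmap f _) wp => d wp; case: wp E.
move E: (opmap f _) wp => d wp; case: wp E => [D0|D0 p b us q' D'' E wp] [Ew ED];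
  subst w D0.
  by exists D => //; apply: wpos_white.
move: E; rewrite above_tmap tmap_target_opmap join_edge_tmap.
case E: (above D p) => [//|c vs] [Eb _]; subst b.
have [D1 w1 ->] := IH c (above_in E) _ _ wp.
by exists D1 => //; apply: wpos_black E w1.
Qed.

(** Relabelling preserves shapes, so a decomposition of the relabelled tree lifts to the tree
    itself. *)
Lemma ungraft :
  (forall (t : tree Y) y us, size us = nleaves t -> tmap f y = graft t us ->
     exists t' us', [/\ tmap f t' = t, map (tmap f) us' = us & graft t' us' = y]) *
  (forall (ts : seq (tree Y)) ys us, size us = sumn (map (@nleaves Y) ts) ->
     map (tmap f) ys = grafts ts us ->
     exists ts' us', [/\ map (tmap f) ts' = ts, map (tmap f) us' = us & grafts ts'
       us' = ys]).
Proof.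
apply: tree_forest_ind => [y [|u []] //= _ E|a ts IH [|b ys] us // su [fb /IH]||].
- by exists Eta, [:: y]; rewrite /= E.
- move=> /(_ su)[ts' [us' [E1 E2 E3]]].
  by exists (Node b ts'), us'; rewrite graft_node E3 /= fb E1.
- by move=> [|? ?] [|? ?] //; exists [::], [::].
move=> t ts IHt IHts [|y ys] us /split_size[u1 [u2 [-> s1 s2]]]; rewrite grafts_cons
  //= => -[].
move=> /(IHt _ _ s1)[t' [us1 [E1 E2 E3]]] /(IHts _ _ s2)[ts' [us2 [F1 F2 F3]]].
exists (t' :: ts'), (us1 ++ us2); rewrite map_cat E2 F2 /= E1 F1; split=> //.
have s1' : size us1 = nleaves t' by rewrite -(nleaves_tmap f) E1 -s1 -E2 size_map.
by rewrite -s1' take_size_cat // drop_size_cat // E3 F3.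
Qed.

Lemma unjoin :
  (forall (Z : tree (tree Y)) y, wf Z -> tmap f y = tjoin Z ->
     exists2 Z', tmap (tmap f) Z' = Z & tjoin Z' = y) *
  (forall (Zs : seq (tree (tree Y))) ys, all (@wf Y) Zs -> map (tmap f) ys = map
    (@tjoin Y) Zs ->
     exists2 Zs', map (tmap (tmap f)) Zs' = Zs & map (@tjoin X) Zs' = ys).
Proof.
apply: tree_forest_ind => [[]//|t Zs IH y /andP[/eqP nt wZ] /=||].
- by exists Eta.
- move=> /ungraft.1 [|t' [us' [E1 /IH[//|Zs' E2 E3] E4]]]; first by rewrite size_map nt.
  by exists (Node t' Zs'); rewrite /= ?E1 ?E2 // E3.
- by move=> [|? ?] // _ _; exists [::].
move=> Z Zs IHZ IHZs [|y ys] //= /andP[wZ wZs]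
  [/(IHZ _ wZ)[Z' <- <-] /(IHZs _ wZs)[Zs' <- <-]].
by exists (Z' :: Zs').
Qed.

Lemma unlabel_tree :
  (forall (D : tree (op Y)), (forall c, List.In c (labels D) -> forall y, tmap f y =
    target c ->
      exists2 l, opmap f l = c & target l = y) ->
    forall Z, tmap (tmap f) Z = tmap (@target Y) D ->
    exists2 D', tmap (opmap f) D' = D & tmap (@target X) D' = Z) *
  (forall (Ds : seq (tree (op Y))),
    (forall c, List.In c (flatten (map (@labels _) Ds)) -> forall y, tmap f y =
      target c ->
      exists2 l, opmap f l = c & target l = y) ->
    forall Zs, map (tmap (tmap f)) Zs = map (tmap (@target Y)) Ds ->
    exists2 Ds', map (tmap (opmap f)) Ds' = Ds & map (tmap (@target X)) Ds' = Zs).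
Proof.
apply: tree_forest_ind.
- by move=> _ [] // _; exists Eta.
- move=> c Ds IH H [|z Zs] //= [Ec EDs].
  have [l <- Ez] := H c (or_introl erefl) z Ec.
  have [Ds' E1 E2] := IH (fun d dD => H d (or_intror dD)) Zs EDs.
  by exists (Node l Ds'); rewrite /= ?E1 // Ez E2.
- by move=> _ [] // _; exists [::].
move=> D Ds IHD IHDs H [|Z Zs] //= [EZ EZs].
have [D' <- <-] := IHD (fun d dD => H d (proj2 (in_cat_or _ _ _) (or_introl dD))) Z EZ.
have [Ds' <- <-] := IHDs (fun d dD => H d (proj2 (in_cat_or _ _ _) (or_intror dD)))
  Zs EZs.
by exists (D' :: Ds').
Qed.

(** The vertices of the target correspond to the leaves of [b], so labels on the former are labels
    on the latter. This produces the [l] that [is_composite] asks for. *)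
Lemma relabel_ex b y : well_decorated b -> tmap f y = target b ->
  exists2 l, opmap f l = b & target l = y.
Proof.
elim/op_labels_ind: b y => [k x|w D IH] y.
  case: y => [//|a us] _ [fa E]; exists (Stem k a); rewrite /= ?fa //.
  congr Node; elim: us k E => [|u us IHu] [|k] //= [Eu /IHu <-].
  by case: u Eu.
move=> wD /=; move=> /unjoin.1 [|Z EZ <-]; first exact: wf_target.
have [|D' ED <-] := unlabel_tree.1 D _ Z EZ.
  by move=> c cD y' Ey; apply: IH => //; apply: wd_in cD.
by exists (Vertex w D'); rewrite /= ?ED.
Qed.

End Opmap.

(** * Grafting operations onto the leaves of an operation *)

Section Opjoin.
Variable X : Type.
Implicit Types (l : op (op X)) (D : tree (op (op X))).

Lemma opjoin_good l : well_decorated l -> all_vertices wd (target l) ->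
  [/\ root_edge (opjoin l) = root_edge l, well_decorated (opjoin l) &
      target (opjoin l) = tjoin (tmap (@target X) (target l))].
Proof.
elim/op_labels_ind: l => [k c _ /= /andP[]|w D IH wD].
  rewrite size_nseq => /andP[/eqP rc wc] _; split=> //.
  have E := nleaves_target wc; rewrite rc in E.
  by rewrite map_nseq /= map_nseq -E (graft_eta _).1.
rewrite /= (all_vertices_tjoin _).1 ?wf_target // (all_vertices_tmap _ _).1.
rewrite all_vertices_all => /all_in aD.
have {}IH c : List.In c (labels D) ->
  [/\ root_edge (opjoin c) = root_edge c, well_decorated (opjoin c) &
      target (opjoin c) = tjoin (tmap (@target X) (target c))].
  by move=> cD; apply: IH => //; [apply: wd_in cD|apply: aD].
split.
- by rewrite nleaves_tmap.
- rewrite -/(well_decorated (Vertex w _)) wd_vertex (all_vertices_tmap _ _).1;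
  apply: (all_vertices_in _ _).1 wD.
  by move=> c n /IH[-> -> _] /andP[->].
rewrite (tjoin_tmap_tjoin _).1 ?wf_target //.
  rewrite !tmap_comp; congr tjoin.
  by apply: (eq_tmap_in _ _).1 => c /IH[].
rewrite (all_vertices_tmap _ _).1 all_vertices_all; apply/all_in => c /aD.
by apply: all_vertices_impl => d n /andP[/eqP <- wd]; rewrite nleaves_target.
Qed.

Lemma whites_opjoin l :
  (forall c, List.In c (labels (target l)) -> whites c = [::]) -> well_decorated l ->
  whites (opjoin l) = map (tmap (@opjoin X)) (whites l).
Proof.
move=> + wl; elim/op_labels_ind: l wl => [k c _|w D IH wD] H /=; first by apply: H;
  left.
rewrite map_cat !(labels_tmap _).1; congr (_ ++ _); first by case: w {wD H}.
have {}H d c : List.In d (labels D) -> List.In c (labels (target d)) -> whites c = [::].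
  move=> dD cd; apply: H; rewrite /=.
  have P := (labels_tjoin _).1 _ (wf_target wD).
  apply: (Permutation_in _ (Permutation_sym P)); rewrite (labels_tmap _).1 -map_comp.
  by apply/in_flatten; exists d.
have {}IH d : List.In d (labels D) -> whites (opjoin d) = map (tmap (@opjoin X))
  (whites d).
  by move=> dD; apply: IH => //; [apply: wd_in dD|move=> c; apply: H].
elim: (labels D) IH {H} => //= d s IHs IH.
by rewrite map_cat (IH d (or_introl erefl)) IHs // => e es; apply: IH; right.
Qed.

(** Grafting substitutes the targets of the labels into [target l]. The equation says that the
    grafted operation acts on edges as [l] does, followed by [join_edge] for this substitution. *)
Lemma wpos_opjoin l q D : well_decorated l -> all_vertices wd (target l) -> wpos l q
  D ->
  exists2 q', wpos (opjoin l) q' (tmap (@opjoin X) D) &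
    forall a, edge D a ->
     q' ++ join_edge (tmap (@target X) (tmap (@opjoin X) D)) a =
     join_edge (tmap (@target X) (target l)) (q ++ join_edge (tmap (@target _) D) a).
Proof.
have aux w D0 : well_decorated (Vertex w D0) -> all_vertices wd
  (target (Vertex w D0)) ->
   [/\ wf (tmap (@target (op X)) D0),
       all_vertices (fun t _ => all_vertices (fun c n => nleaves (target c) == n) t)
         (tmap (@target _) D0),
       forall c, List.In c (labels D0) -> all_vertices wd (target c) &
       tmap (@target X) (tmap (@opjoin X) D0) =
       tmap (fun t => tjoin (tmap (@target X) t)) (tmap (@target _) D0)].
  rewrite wd_vertex => wD; have wT := wf_target wD.
  rewrite /= (all_vertices_tjoin _).1 // (all_vertices_tmap _ _).1.
  rewrite all_vertices_all => /all_in aD; split=> //.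
    rewrite (all_vertices_tmap _ _).1 all_vertices_all; apply/all_in => c /aD.
    by apply: all_vertices_impl => d n /andP[/eqP <- wd]; rewrite nleaves_target.
  rewrite !tmap_comp; apply: (eq_tmap_in _ _).1 => c cD /=.
  by have [] := opjoin_good (wd_in wD cD) (aD c cD).
move=> + + wp; elim: wp => {l q D} [D wD aD|D p b us q D' E wp IH wD aD].
  have [H1 H2 H3 H4] := aux _ _ wD aD.
  exists [::]; first exact: wpos_white.
  by move=> a ea; rewrite H4 /= join_edge_tjoin // edge_tmap.
have [H1 H2 H3 H4] := aux _ _ wD aD.
have bD := above_in E; have [q1 w1 E1] := IH (wd_in wD bD) (H3 b bD).
exists (join_edge (tmap (@target X) (tmap (@opjoin X) D)) p ++ q1).
  apply: (@wpos_black _ _ _ (opjoin b) (map (tmap (@opjoin X)) us) _ _ _ w1).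
  by rewrite above_tmap E.
move=> a ea; rewrite -!catA E1 // H4 /=.
rewrite (join_edge_tjoin_node H1 H2 (t := target b)
  (us := map (tmap (@target _)) us)) //.
  by rewrite above_tmap E.
by apply: wpos_edge => //; apply: wd_in bD.
Qed.

End Opjoin.

(* [e] is the action of the operation [b] on the edges of its source [S]. *)
Definition opedge (b : op unit) (S : tree unit) (e : seq nat -> seq nat) : Prop :=
  exists q D, wpos b q D /\
    forall a, edge S a -> e a = q ++ join_edge (tmap (@target unit) D) a.

Lemma wpos_wd (X : Type) (b : op X) q D : wpos b q D -> well_decorated b ->
  all_vertices wd D.
Proof.
elim=> {b q D} // D p b us q D' E _ IH wD; apply: IH; exact: wd_in wD (above_in E).
Qed.

Lemma size_whites S T (b : B03 S T) : size (whites b) = 1.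
Proof. by rewrite -(size_map (@tshape _)) b03_source. Qed.

Lemma b03_white S T (b : B03 S T) : exists q D,
  [/\ wpos b q D, whites b = [:: D] & tshape D = S].
Proof.
have := b03_source b; case E: (whites b) => [|D []] //= [tD].
by have [q wp] := wpos1 E; exists q, D.
Qed.

Lemma opedge_uniq S T (b : B03 S T) e e' : opedge b S e -> opedge b S e' ->
  forall a, edge S a -> e a = e' a.
Proof.
move=> [q [D [wp E]]] [q' [D' [wp' E']]] a ea.
have [Eq ED] := wpos_uniq (size_whites b) wp wp'.
by rewrite E // E' // Eq ED.
Qed.

Lemma opedge_edge S T (b : B03 S T) e : opedge b S e ->
  forall a, edge S a -> edge T (e a).
Proof.
have [q [D [wp _ tD]]] := b03_white b.
move=> oe a ea; have -> : e a = q ++ join_edge (tmap (@target unit) D) a.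
  by apply: (opedge_uniq (e' := fun a => q ++ join_edge (tmap (@target unit) D) a)
    oe) => //; exists q, D.
rewrite -(b03_target b); apply: wpos_edge => //; first exact: b03_decorated.
by rewrite -(edge_tmap (fun=> tt)) -/(tshape D) tD.
Qed.

(** * Composite operations and their action on edges *)

Section Composite.
Variables (S T U : ptree) (b' : B03 T U) (b : B03 S T) (l : op (op unit)).
Hypotheses (lb : opmap (fun=> tt) l = b) (wb' : whites b' = [:: target l]).

Let r := replace_white (opjoin l) b'.

Lemma comp_decorated : well_decorated l /\ all_vertices wd (target l).
Proof.
split; first by rewrite -(wd_opmap (fun=> tt)) lb b03_decorated.
have [q wp] := wpos1 wb'; exact: wpos_wd wp (b03_decorated b').
Qed.

Lemma comp_root D : List.In D (whites b') ->
  root_edge (opjoin l) = nleaves D /\ target (opjoin l) = target (Vertex true D).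
Proof.
rewrite wb' => -[<-|//]; have [wl wt] := comp_decorated.
have [-> _ ->] := opjoin_good wl wt.
by rewrite nleaves_target.
Qed.

Lemma comp_good : well_decorated r /\ target r = U.
Proof.
have [wl wt] := comp_decorated; have [_ wo _] := opjoin_good wl wt.
have [_ tr wr] := replace_white_good wo (b03_decorated b') comp_root.
by split=> //; rewrite /r tr b03_target.
Qed.

Lemma comp_whites : map (@tshape _) (whites (normalize r)) = [:: S].
Proof.
have [wl wt] := comp_decorated; have [wr _] := comp_good.
have Ew : map (@tshape _) (map (tmap (@normalize _)) (whites r)) = [:: S].
  rewrite (whites_replace_white _ wb') whites_opjoin //.
    rewrite -(b03_source b) -lb whites_opmap -!map_comp; apply: eq_map => D /=.
    by rewrite /tshape !tmap_comp; apply: eq_tmap.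
  (* Nothing white lies over the single white vertex of [b'], so the labels of [target l] contain no
     white vertex. *)
  move=> c cl; have [q wp] := wpos1 wb'; have := wpos_size wp.
  rewrite wb' ltnS leqn0 => /nilP.
  elim: (labels (target l)) cl => //= d s IHs [->|cs].
    by case: (whites c).
  by case: (whites d) => //; apply: IHs.
have P : Permutation (map (@tshape _) (whites (normalize r)))
    (map (@tshape _) (map (tmap (@normalize _)) (whites r))).
  exact: (Permutation_map _ (whites_normalize wr)).
rewrite Ew in P.
by apply: Permutation_length_1_inv; apply: Permutation_sym.
Qed.

Lemma comp_normal : [/\ well_decorated (normalize r), reduced (normalize r) &
  target (normalize r) = U].
Proof. by have [wr <-] := comp_good; have [] := normalize_good wr. Qed.

(** The white vertex of the composite is that of the grafted [l], at an address that prolongs the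
    one in [b']. Normalization changes neither this address nor the targets of what lies over the
    vertex. *)
Lemma comp_edge e e' : opedge b S e -> opedge b' T e' ->
  opedge (normalize r) S (fun a => e' (e a)).
Proof.
move=> oe oe'; have [wl wt] := comp_decorated; have [wr tr] := comp_good.
have [_ wo _] := opjoin_good wl wt.
have [q [D0 [wp _ tD]]] := b03_white b; have [q' wp'] := wpos1 wb'.
have [D wpl ED] : exists2 D, wpos l q D & D0 = tmap (opmap (fun=> tt)) D.
  by apply: wpos_opmap; rewrite lb.
have [q1 wpo E1] := wpos_opjoin wl wt wpl.
have wpr : wpos r (q' ++ q1) (tmap (@opjoin _) D).
  exact: wpos_replace_white wo (b03_decorated b') comp_root wp' wpo.
exists (q' ++ q1), (tmap (@normalize _) (tmap (@opjoin _) D)); split.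
  exact: wpos_normalize.
move=> a ea.
have eD : edge D a by rewrite -(edge_tmap (opmap (fun=> tt))) -ED
  -(edge_tmap (fun=> tt)) -/(tshape D0) tD.
have -> : tmap (@target _) (tmap (@normalize _) (tmap (@opjoin _) D)) = tmap
  (@target _) (tmap (@opjoin _) D).
  rewrite tmap_comp; apply: (eq_tmap_in _ _).1 => c cD.
  by have [] := normalize_good (wd_in (wpos_wd wpr wr) cD).
have Ea : e a = q ++ join_edge (tmap (@target _) D) a.
  rewrite (opedge_uniq (e' := fun a => q ++ join_edge (tmap (@target _) D0) a) oe)
    //; last by exists q, D0.
  by rewrite ED tmap_target_opmap join_edge_tmap.
rewrite -catA E1 // -Ea.
rewrite (opedge_uniq (e' := fun a => q' ++ join_edge (tmap (@target _) (target l)) a)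
  oe') //.
  by exists q', (target l).
exact: opedge_edge oe _ ea.
Qed.

End Composite.

Lemma composite_edge S T U (b' : B03 T U) (b : B03 S T) (c : B03 S U) e e' :
  is_composite b' b c -> opedge b S e -> opedge b' T e' ->
  opedge c S (fun a => e' (e a)).
Proof. by case=> l [lb wb' ->] oe oe'; exact: (comp_edge lb wb' oe oe'). Qed.

Lemma composite_ex S T U (b' : B03 T U) (b : B03 S T) :
  exists c : B03 S U, is_composite b' b c.
Proof.
have [q [D [wp wb' tD]]] := b03_white b'.
have [||l lb tl] := @relabel_ex _ _ (fun=> tt) b D; first exact: b03_decorated.
  by rewrite b03_target -tD.
rewrite -tl in wb'.
have [w r t] := comp_normal lb wb'.
by exists (MkB03 w r (comp_whites lb wb') t), l.
Qed.

Lemma stemsP :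
  (forall T : tree unit, [/\ tjoin (tmap (@target unit) (stems T)) = T,
     tshape (stems T) = T, all_vertices wd (stems T),
     flatten (map (@whites unit) (labels (stems T))) = [::] &
     forall a, edge T a -> join_edge (tmap (@target unit) (stems T)) a = a]) *
  (forall Ts : seq (tree unit), [/\ map (@tjoin unit)
    (map (tmap (@target unit)) (map stems Ts)) = Ts,
     map (@tshape _) (map stems Ts) = Ts, all (all_vertices wd) (map stems Ts),
     flatten (map (@whites unit) (flatten (map (@labels _) (map stems Ts)))) = [::] &
     forall i a, i < size Ts -> edge (nth Eta Ts i) a ->
       join_edge (tmap (@target unit) (nth Eta (map stems Ts) i)) a = a]).
Proof.
apply: tree_forest_ind => [|[] Ts [H1 H2 H3 H4 H5]||t Ts [E1 E2 E3 E4 E5]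
  [H1 H2 H3 H4 H5]].
- by split=> // -[].
- split=> /=.
  + exact: (etrans (congr1 (graft (corolla (size Ts) tt)) H1) (graft_corolla tt Ts)).
  + by rewrite /tshape /= H2.
  + by rewrite size_map eqxx.
  + by rewrite H4.
  + case=> [//|i a] /andP[li ea].
    rewrite -[LHS]/(nth [::] (leaves (corolla (size Ts) tt)) i ++
      join_edge (nth Eta (map (tmap (@target unit)) (map stems Ts)) i) a).
    rewrite (nth_map Eta) ?size_map // H5 //.
    by rewrite nth_leaves_corolla.
- by split.
split=> /=.
- by rewrite E1 H1.
- by rewrite E2 H2.
- by rewrite E3.
- by rewrite map_cat flatten_cat E4 H4.
- by case=> [|i] a; [move=> _; apply: E5|apply: H5].
Qed.

Lemma unit_edge T : opedge (unit_op T) T id.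
Proof.
exists [::], (stems T); split; first exact: wpos_white.
by move=> a ea; have [_ _ _ _ ->] := stemsP.1 T.
Qed.

(** * Operations as normal forms *)

(* [f] amounts to the replacement of every vertex of [src f] by its label in
   [decor f], followed by grafting the trees [tops f] onto the leaves. *)
Fixpoint decor (f : rmap) : tree (tree unit) :=
  match f with RLeaf _ => Eta | RNode D fs => Node D (map decor fs) end.

Fixpoint tops (f : rmap) : seq (tree unit) :=
  match f with RLeaf T => [:: T] | RNode _ fs => flatten (map tops fs) end.

Lemma decorP :
  (forall f, [/\ tshape (decor f) = src f, size (tops f) = nleaves (decor f), wf
    (decor f) = valid f &
     valid f -> tgt f = graft (tjoin (decor f)) (tops f) /\
       forall a, edge (src f) a -> rmap_edge f a = join_edge (decor f) a]) *
  (forall fs, [/\ map (@tshape _) (map decor fs) = map src fs,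
     size (flatten (map tops fs)) = sumn (map (@nleaves _) (map decor fs)),
     all (@wf _) (map decor fs) = all valid fs &
     all valid fs -> map tgt fs = grafts (map (@tjoin _) (map decor fs))
       (flatten (map tops fs)) /\
       forall i a, i < size fs -> edge (nth Eta (map src fs) i) a ->
         rmap_edge (nth (RLeaf Eta) fs i) a = join_edge (nth Eta (map decor fs) i) a]).
Proof.
apply: rmap_forest_ind => [T|D fs [H1 H2 H3 H4]||f fs [E1 E2 E3 E4] [H1 H2 H3 H4]].
- by split=> // _; split=> // -[].
- split.
  + by rewrite /tshape /= H1.
  + exact: H2.
  + by rewrite /= H3 size_map.
  move=> /= /andP[/eqP nD vf]; have [T1 T2] := H4 vf; split.
    rewrite T1 (graft_graft _).1 ?size_map // H2 (nleaves_tjoin _).2 //.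
    by rewrite H3.
  by case=> [//|i a] /andP[li ea] /=; rewrite T2 // -(size_map src).
- by split.
split=> /=.
- by rewrite E1 H1.
- by rewrite size_cat E2 H2.
- by rewrite E3 H3.
move=> /andP[vf vfs]; have [T1 T2] := E4 vf; have [T3 T4] := H4 vfs; split.
  have sz : size (tops f) = nleaves (tjoin (decor f)) by rewrite E2
    (nleaves_tjoin _).1 // E3.
  by rewrite take_size_cat // drop_size_cat // -T1 -T3.
by case=> [|i] a; [move=> _; apply: T2|apply: T4].
Qed.

Lemma decor_ex :
  (forall (Z : tree (tree unit)) ts, size ts = nleaves Z -> exists f, decor f = Z /\
    tops f = ts) *
  (forall (Zs : seq (tree (tree unit))) ts, size ts = sumn (map (@nleaves _) Zs) ->
     exists fs, map decor fs = Zs /\ flatten (map tops fs) = ts).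
Proof.
apply: tree_forest_ind => [[|T []] //= _|D Zs IH ts /= /IH[fs [<- <-]]||].
- by exists (RLeaf T).
- by exists (RNode D fs).
- by move=> [] // _; exists [::].
move=> Z Zs IHZ IHZs ts /= /split_size[t1 [t2 [-> /IHZ[f [<- <-]] /IHZs[fs [<- <-]]]]].
by exists (f :: fs).
Qed.

(** The decoration of the black vertex under the white one: [T] with the part over [q] replaced by
    [Y], the vertices outside that part being labelled by stems. *)
Fixpoint plug (T : tree unit) (q : seq nat) (Y : tree (op unit)) : tree (op unit) :=
  match q with
  | [::] => Y
  | i :: q => if T is Node _ ts
              then Node (Stem (size ts) tt) (set_nth Eta (map stems ts) i
                (plug (nth Eta ts i) q Y))
              else Eta
  end.

Lemma plug_mid l t r q Y :
  plug (N (l ++ t :: r)) (size l :: q) Y =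
  Node (Stem (size (l ++ t :: r)) tt) (map stems l ++ plug t q Y :: map stems r).
Proof. by rewrite /= nth_catr // map_cat /= set_nth_cat // size_map. Qed.

Notation tj := (fun D : tree (op unit) => tjoin (tmap (@target unit) D)).

Lemma tj_stem k ds : size ds = k -> tj (Node (Stem k tt) ds) = N (map tj ds).
Proof.
move=> <-; rewrite [LHS]/= -map_comp -[LHS]/(graft (corolla (size ds) tt) (map tj ds)).
by rewrite -(size_map tj) graft_corolla.
Qed.

Lemma join_edge_stem k ds i a : i < k -> join_edge
  (tmap (@target unit) (Node (Stem k tt) ds)) (i :: a) =
  i :: join_edge (nth Eta (map (tmap (@target unit)) ds) i) a.
Proof.
move=> ik; rewrite -[LHS]/(nth [::] (leaves (corolla k tt)) i ++
      join_edge (nth Eta (map (tmap (@target unit)) ds) i) a).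
by rewrite nth_leaves_corolla.
Qed.

Lemma plugP q T Y a us : edge T q -> tj Y = above T q -> all_vertices wd Y -> Y =
  Node a us ->
  [/\ tj (plug T q Y) = T, all_vertices wd (plug T q Y), above (plug T q Y) q = Y,
      flatten (map (@whites unit) (labels (plug T q Y))) = flatten
        (map (@whites unit) (labels Y)) &
      join_edge (tmap (@target unit) (plug T q Y)) q = q].
Proof.
move=> + + wY EY; elim: q T => [|i q IH] T //=.
case: T => [|[] ts] // /andP[li eq].
have [l [r [E sl]]] := split_nth Eta li.
move: E eq; move: (nth Eta ts i) => t E eq Et.
subst i ts; have [I1 I2 I3 I4 I5] := IH t eq Et.
have [L1 L2 L3 L4 _] := stemsP.2 l; have [R1 R2 R3 R4 _] := stemsP.2 r.
rewrite map_cat /= set_nth_cat ?size_map //.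
have ss : size (map stems l ++ plug t q Y :: map stems r) = size (l ++ t :: r).
  by rewrite !size_cat /= !size_map.
split.
- apply: (etrans (tj_stem ss)); rewrite map_cat /= I1.
  by rewrite (map_comp (@tjoin _)) L1 (map_comp (@tjoin _)) R1.
- by rewrite ss eqxx /= all_cat L3 /= I2 R3.
- by rewrite nth_catr ?size_map.
- by rewrite map_cat /= flatten_cat /= !map_cat !flatten_cat /= L4 I4 R4 cats0.
have := @join_edge_stem (size (l ++ t :: r))
  (map stems l ++ plug t q Y :: map stems r) (size l) q.
rewrite size_cat /= -addSnnS leq_addr => /(_ isT) ->.
by rewrite map_cat /= nth_catr ?size_map // I5.
Qed.

Definition is_stem (X : Type) (c : op X) : bool := if c is Stem _ _ then true else
  false.

Lemma stems_target :
  (forall Y : tree (op unit), all_vertices wd Y -> all (@is_stem _) (labels Y) ->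
    stems (tj Y) = Y) *
  (forall Ys : seq (tree (op unit)), all (all_vertices wd) Ys ->
     all (@is_stem _) (flatten (map (@labels _) Ys)) -> map stems (map tj Ys) = Ys).
Proof.
apply: tree_forest_ind => [//|[k []|//] ds IH /= /andP[/andP[/eqP kd _] wds]
  /(IH wds) E||].
- apply: (etrans (congr1 stems (tj_stem (esym kd)))).
  by rewrite [LHS]/= E size_map kd.
- by [].
move=> Y Ys IHY IHYs /= /andP[wY wYs]; rewrite all_cat => /andP[sY sYs].
by rewrite IHY // IHYs.
Qed.

Lemma no_white_stem (c : op unit) : ~~ is_black c -> whites c = [::] -> is_stem c.
Proof. by case: c => // -[]. Qed.

Lemma no_whites_stems (s : seq (op unit)) : all (fun c => ~~ is_black c) s ->
  size (flatten (map (@whites unit) s)) = 0 -> all (@is_stem _) s.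
Proof.
elim: s => //= c s IH /andP[nb nbs]; rewrite size_cat => /eqP.
rewrite addn_eq0 => /andP[/nilP w0 /eqP/IH ->] //.
by rewrite no_white_stem.
Qed.

(** The reduced operation with target [t] and no white vertex: a stem if [t] is a corolla, and
    otherwise a single black vertex with stems over it. *)
Definition op_of_tree (t : tree unit) : op unit := black_vertex (stems t).

Lemma op_of_tree_target (c : op unit) : well_decorated c -> reduced c -> whites c =
  [::] ->
  op_of_tree (target c) = c.
Proof.
case: c => [k [] _ _ _|[//|] D wD].
  have E : stems (corolla k tt) = corolla k (Stem k tt) by rewrite /= size_nseq
    map_nseq.
  exact: (etrans (congr1 (@black_vertex unit) E) (black_vertex_corolla k _)).
move=> /andP[/andP[n1 nb] _]; rewrite whites_black => w0.
have sD : all (@is_stem _) (labels D) by apply: no_whites_stems; rewrite ?all_predC ?w0.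
rewrite /op_of_tree [target _]/= stems_target.1 //.
by case: D n1 {nb wD w0 sD} => // b ts n1; rewrite /black_vertex (negbTE n1).
Qed.

(** A label that is neither black nor contains a white vertex is a stem, and a decoration by stems
    is determined by its target. Since the only white vertex is the label at [p], the target and
    what lies at [p] determine [D0]. *)
Lemma plug_struct p D0 D us : all_vertices wd D0 -> all (fun c => ~~ is_black c)
  (labels D0) ->
  size (flatten (map (@whites unit) (labels D0))) = 1 -> above D0 p = Node
    (Vertex true D) us ->
  [/\ join_edge (tmap (@target unit) D0) p = p, edge (tj D0) p &
   exists ts, [/\ size ts = nleaves D, above (tj D0) p = graft
     (target (Vertex true D)) ts &
     D0 = plug (tj D0) p (Node (Vertex true D) (map stems ts))]].
Proof.
elim: p D0 => [|i p IH] D0 wD nb s1.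
  move=> /= E; subst D0; split=> //; exists (map tj us).
  move: wD => /= /andP[/andP[/eqP rD _] wus].
  move: s1 => /= -[]; rewrite size_cat => /eqP; rewrite addn_eq0 => /andP[_ /eqP s1].
  move: nb => /= nb; have sus := no_whites_stems nb s1.
  by rewrite size_map -rD -map_comp stems_target.2.
case: D0 wD nb s1 => // c ds; rewrite [labels _]/= [all_vertices _ _]/=.
move=> /andP[/andP[/eqP rc wc] wds] /andP[nbc nbs] s1 E.
have li : i < size ds by case: ltnP => // ge; move: E => /=; rewrite nth_default //;
  case: p {IH}.
rewrite /= in E.
have [l [r [Eds sl]]] := split_nth Eta li.
move: E Eds; move: (nth Eta ds i) => d E Eds; subst i ds.
have {wds} /and3P[wl wd wr] : [&& all (all_vertices wd) l, all_vertices wd d & all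
  (all_vertices wd) r].
  by move: wds; rewrite all_cat.
have Efl : flatten (map (@labels _) (l ++ d :: r)) =
    flatten (map (@labels _) l) ++ labels d ++ flatten (map (@labels _) r).
  by rewrite map_cat flatten_cat.
have {}nbs : all (fun c => ~~ is_black c) (flatten (map (@labels _) (l ++ d :: r)))
  := nbs.
move: nbs s1; rewrite Efl !all_cat => /and3P[nl nd nr] s1.
rewrite /= !map_cat !flatten_cat !size_cat in s1.
have d1 := above_count (@whites unit) E; rewrite whites_white /= in d1.
(* The one white vertex is already counted in [d], so none is left for [c], [l] and [r]. *)
have c0 : whites c = [::] by apply/nilP; rewrite /nilp; lia.
have sl0 := no_whites_stems nl; have sr0 := no_whites_stems nr.
have El : map stems (map tj l) = l by apply: stems_target.2 => //; apply: sl0; lia.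
have Er : map stems (map tj r) = r by apply: stems_target.2 => //; apply: sr0; lia.
have sd : size (flatten (map (@whites unit) (labels d))) = 1 by lia.
have [J1 J2 [ts [J3 J4 J5]]] := IH d wd nd sd E.
have := no_white_stem nbc c0; case: c rc wc nbc s1 c0 => // k [] kE _ _ _ _ _.
rewrite /= in kE.
have ET : tj (Node (Stem k tt) (l ++ d :: r)) = N (map tj l ++ tj d :: map tj r).
  by rewrite tj_stem // map_cat.
rewrite ET; split.
- have := @join_edge_stem k (l ++ d :: r) (size l) p; rewrite kE => /(_ li) /= ->.
  by rewrite map_cat /= nth_catr ?size_map // J1.
- by rewrite edge_node size_cat !size_map /= nth_catr ?size_map // J2 andbT; lia.
exists ts; split=> //; first by rewrite /= nth_catr ?size_map.
have := plug_mid (map tj l) (tj d) (map tj r) p (Node (Vertex true D) (map stems ts)).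
rewrite size_map => ->; rewrite El Er -J5; congr (Node (Stem _ _) _).
by rewrite kE !size_cat /= !size_map.
Qed.

(** Recovers an operation from its normal form, which gives uniqueness. The outer [black_vertex]
    accounts for operations with no vertex under the white one: a unary black vertex there is
    dropped. *)
Definition op_of_nf (q : seq nat) (f : rmap) (T : tree unit) : op unit :=
  black_vertex (plug T q (Node (Vertex true (tmap op_of_tree (decor f)))
    (map stems (tops f)))).

Lemma b03_nf S T (b : B03 S T) : exists q f,
  [/\ valid f, src f = S, edge T q, above T q = tgt f &
   opedge b S (fun a => q ++ rmap_edge f a) /\ b03 b = op_of_nf q f T].
Proof.
have [q [D [wp wb tD]]] := b03_white b.
have wdb := b03_decorated b; have rb := b03_reduced b.
have wdD := wpos_wd wp wdb.
have wZ : wf (tmap (@target unit) D) := wf_target wdD.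
have szZ : nleaves (tmap (@target unit) D) = nleaves D by rewrite nleaves_tmap.
have sD : size (flatten (map (@whites unit) (labels D))) = 0.
  by have := wpos_size wp; rewrite wb ltnS leqn0 => /eqP.
have labD : all (@reduced _) (labels D) -> tmap op_of_tree (tmap (@target unit) D) = D.
  move=> /all_in rD; rewrite tmap_comp -[RHS](tmap_id _ (f := id)) //.
  apply: (eq_tmap_in _ _).1 => c cD; apply: op_of_tree_target (wd_in wdD cD)
    (rD c cD) _.
  elim: (labels D) sD cD => //= d s IHs; rewrite size_cat => /eqP.
  rewrite addn_eq0 => /andP[/nilP w0 /eqP s0] [<-//|]; exact: IHs.
have main ts : size ts = nleaves D -> edge T q -> above T q = graft
  (tjoin (tmap (@target unit) D)) ts ->
    all (@reduced _) (labels D) ->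
    b03 b = black_vertex (plug T q (Node (Vertex true D) (map stems ts))) ->
  exists q f, [/\ valid f, src f = S, edge T q, above T q = tgt f &
   opedge b S (fun a => q ++ rmap_edge f a) /\ b03 b = op_of_nf q f T].
  move=> sts eq sq rD Eb; have [|f [Ef Et]] := decor_ex.1 (tmap (@target unit) D) ts;
    first by rewrite szZ.
  have [H1 H2 H3 H4] := decorP.1 f.
  have vf : valid f by rewrite -H3 Ef.
  have [H5 H6] := H4 vf.
  have sf : src f = S by rewrite -H1 Ef -tD /tshape tmap_comp; apply: eq_tmap.
  exists q, f; split=> //; first by rewrite H5 Ef Et.
  split; first by exists q, D; split=> // a ea; rewrite H6 ?sf // Ef.
  by rewrite /op_of_nf Ef Et labD.
case: (b) wp wb wdb rb (b03_target b) main => b0 _ _ _ _ /= wp wb wdb rb tb main.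
case: wp wb wdb rb tb main labD {tD sD szZ wZ} => [D1|D1 p c us q' D' E wp] wb wdb rb
  tb main labD.
  (* The white vertex is the root vertex: [q] is the root edge, and only free edges are grafted. *)
  apply: (main (nseq (nleaves D1) Eta)) => //.
  - by rewrite size_nseq.
  - have wT := wf_target (wdb : all_vertices wd D1).
    have E := (nleaves_tjoin _).1 _ wT; rewrite nleaves_tmap in E.
    by rewrite -E (graft_eta _).1.
  - by move: rb; rewrite /= (labels_tmap _).1 all_map.
  rewrite [plug _ _ _]/= map_nseq.
  exact: (esym (black_vertex_corolla (nleaves D1) (Vertex true D1))).
have cD := above_in E.
move: rb => /andP[/= /andP[n1 nb]]; rewrite (labels_tmap _).1 all_map => /all_in rl.
have nb' : all (fun c => ~~ is_black c) (labels D1) by rewrite all_predC.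
move/all_in: (nb') => /(_ c cD) nbc.
have rc := rl c cD; rewrite /= in rc.
(* Black vertices are not adjacent, so the label at [p] has the white vertex itself as its root. *)
case: wp E wb nbc rc main labD cD wdD => [D2|//] E wb nbc rc main labD cD wdD.
have s1 : size (flatten (map (@whites unit) (labels D1))) = 1
  by rewrite -whites_black wb.
have [J1 J2 [ts [J3 J4 J5]]] := plug_struct wdb nb' s1 E.
have tb' : tj D1 = T by [].
rewrite tb' in J2 J4 J5; rewrite cats0 J1 in main.
apply: (main ts) => //.
- by move: rc; rewrite /= (labels_tmap _).1 all_map.
- rewrite -J5; case: (D1) n1 => //= d ds n1; by rewrite (negbTE n1).
Qed.

Lemma nf_b03 q f T : valid f -> edge T q -> above T q = tgt f ->
  exists b : B03 (src f) T, opedge b (src f) (fun a => q ++ rmap_edge f a).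
Proof.
move=> vf eq sq; have [H1 H2 H3 H4] := decorP.1 f; have [H5 H6] := H4 vf.
(* Black vertices are put over and under the white vertex in every case, unary ones included;
   normalization deletes the latter. *)
pose V := Vertex true (tmap (fun t => Vertex false (stems t)) (decor f)).
pose Y := Node V (map stems (tops f)).
have tV : tmap (@target unit) (tmap (fun t => Vertex false (stems t)) (decor f)) =
  decor f.
  rewrite tmap_comp; apply: tmap_id => t /=; by have [] := stemsP.1 t.
have [L1 L2 L3 L4 _] := stemsP.2 (tops f).
have wV : well_decorated V.
  rewrite wd_vertex (all_vertices_tmap _ _).1.
  rewrite -H3 in vf; apply: all_vertices_impl vf => t n /eqP <-.
  have [E1 _ E3 _ _] := stemsP.1 t; rewrite wd_vertex E3 andbT.
  by rewrite -[X in _ == nleaves X]E1 (nleaves_tjoin _).1 ?nleaves_tmap //;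
    apply: wf_target.
have wY : all_vertices wd Y.
  apply/andP; split; last exact: L3.
  by apply/andP; split=> //; rewrite /= size_map H2 nleaves_tmap.
have tY : tj Y = above T q by rewrite sq H5 /= L1 tV.
have [I1 I2 I3 I4 I5] := plugP eq tY wY erefl.
pose b := Vertex false (plug T q Y).
have wb : well_decorated b by [].
have wh : flatten (map (@whites unit)
  (labels (tmap (fun t => Vertex false (stems t)) (decor f)))) = [::].
  rewrite (labels_tmap _).1; elim: (labels (decor f)) => //= t s ->;
    rewrite (labels_tmap _).1 cats0.
  by have [_ _ _ ->] := stemsP.1 t.
have whb : whites b = [:: tmap (fun t => Vertex false (stems t)) (decor f)].
  by rewrite whites_black I4 /Y /= L4 cats0 (labels_tmap _).1 wh.
have [wn rn _ tn] := normalize_good wb.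
have sn : map (@tshape _) (whites (normalize b)) = [:: src f].
  have P : Permutation (map (@tshape _) (whites (normalize b)))
    (map (@tshape _) (map (tmap (@normalize _)) (whites b))).
    exact: (Permutation_map _ (whites_normalize wb)).
  have E : map (@tshape _) (map (tmap (@normalize _)) (whites b)) = [:: src f].
    by rewrite whb /= -H1 /tshape !tmap_comp; congr [:: _]; apply: eq_tmap.
  rewrite E in P; by apply: Permutation_length_1_inv; apply: Permutation_sym.
have tb : target (normalize b) = T by rewrite tn.
exists (MkB03 wn rn sn tb).
have wp : wpos b q (tmap (fun t => Vertex false (stems t)) (decor f)).
  rewrite -[q]cats0 -{1}I5; apply: (wpos_black I3); exact: wpos_white.
exists q, (tmap (@normalize _) (tmap (fun t => Vertex false (stems t)) (decor f))).
split; first exact: wpos_normalize.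
move=> a ea; congr (_ ++ _); rewrite H6 //; congr (join_edge _ _).
rewrite -[LHS]tV !tmap_comp; apply: eq_tmap => t /=.
have wt : well_decorated (Vertex false (stems t)) by rewrite wd_vertex; have [_ _ ->]
  := stemsP.1 t.
by have [_ _ _ ->] := normalize_good wt.
Qed.

(** * The isomorphism *)

Lemma b03_inj S T (b b' : B03 S T) : b03 b = b03 b' -> b = b'.
Proof.
case: b b' => [b d r s t] [b' d' r' s' t'] /= E; subst b'.
by congr MkB03; apply: proof_irrelevance.
Qed.

(** A relation, because neither side has a preferred description of the other; existence and
    uniqueness in both directions turn it into a bijection. *)
Definition represents S T (b : B03 S T) (x : dend_hom S T) : Prop :=
  exists u, x = dend_class u /\ opedge b S (word_edge u).

Lemma opedge_ext b S e e' : (forall a, edge S a -> e a = e' a) -> opedge b S e ->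
  opedge b S e'.
Proof. by move=> E [q [D [wp H]]]; exists q, D; split=> // a ea; rewrite -E // H. Qed.

Lemma represents_hom S T (b : B03 S T) : exists x, represents b x.
Proof.
have [q [f [vf sf eq sq [oe _]]]] := b03_nf b; subst S.
have [u uE] := nf_realize vf eq sq.
by exists (dend_class u), u; split=> //; apply: opedge_ext oe => a /uE.
Qed.

Lemma represents_op S T (x : dend_hom S T) : exists b : B03 S T, represents b x.
Proof.
have [u ->] := dend_classP x; have [q [f [vf sf eq sq uE]]] := word_nf u; subst S.
have [b oe] := nf_b03 vf eq sq.
by exists b, u; split=> //; apply: opedge_ext oe => a /uE.
Qed.

Lemma represents_hom_uniq S T (b : B03 S T) x x' : represents b x -> represents b x'
  -> x = x'.
Proof.
move=> [u [-> oe]] [u' [-> oe']]; apply: dend_class_eq; apply: dend_eqP.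
exact: opedge_uniq oe oe'.
Qed.

Lemma represents_op_uniq S T (b b' : B03 S T) x : represents b x -> represents b' x
  -> b = b'.
Proof.
move=> cb cb'; apply: b03_inj.
have [q [f [vf sf eq sq [oe ->]]]] := b03_nf b.
have [q' [f' [vf' sf' eq' sq' [oe' ->]]]] := b03_nf b'.
move: cb cb' => [u [Ex ou]] [u' [Ex' ou']].
(* Equality of classes becomes a relation between words by testing membership of [u]. *)
have uu' : dend_eq u u'.
  have : sval (dend_class u) u by apply: dend_refl.
  by rewrite -Ex Ex' => /dend_sym.
have ss : src f = src f' by rewrite sf.
suff [-> ->] : q = q' /\ f = f' by [].
apply: (nf_inj vf vf' ss sq sq'); rewrite sf => a ea.
rewrite -(opedge_uniq ou oe) // -(opedge_uniq ou' oe') //.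
exact: dend_eq_edge uu' _ ea.
Qed.

Lemma unit_ex T : exists u : B03 T T, b03 u = unit_op T.
Proof.
have [E1 E2 E3 E4 _] := stemsP.1 T.
have rd : reduced (unit_op T).
  rewrite /= (labels_tmap _).1 all_map.
  move: T {E1 E2 E3 E4}; apply: (fst (tree_forest_ind (Q := fun Ts =>
    all (preim (@reduced unit) id) (flatten (map (@labels _) (map stems Ts)))) _ _ _
      _)) => //=.
  by move=> t Ts ht hTs; rewrite all_cat ht hTs.
have wh : map (@tshape _) (whites (unit_op T)) = [:: T].
  by rewrite whites_white E4 /= E2.
by exists (MkB03 (E3 : well_decorated (unit_op T)) rd wh E1).
Qed.

Lemma represents_unit T (u : B03 T T) : b03 u = unit_op T -> represents u
  (@idm Omega_p T).
Proof. by move=> E; exists (word_nil T); split=> //; rewrite E; apply: unit_edge. Qed.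

Lemma represents_comp S T U (b' : B03 T U) (b : B03 S T) (c : B03 S U) x y :
  is_composite b' b c -> represents b x -> represents b' y ->
  represents c (@compm Omega_p S T U y x).
Proof.
move=> bc [u [-> ou]] [v [-> ov]]; exists (word_cat u v); split; first
  exact: dend_compE.
by apply: opedge_ext (composite_edge bc ou ov) => a _; rewrite word_edge_cat.
Qed.

Definition hom_of S T (b : B03 S T) : dend_hom S T :=
  sval (constructive_indefinite_description _ (represents_hom b)).
Definition op_of S T (x : dend_hom S T) : B03 S T :=
  sval (constructive_indefinite_description _ (represents_op x)).

Lemma hom_ofP S T (b : B03 S T) : represents b (hom_of b).
Proof. by rewrite /hom_of; case: constructive_indefinite_description. Qed.

Lemma op_ofP S T (x : dend_hom S T) : represents (op_of x) x.
Proof. by rewrite /op_of; case: constructive_indefinite_description. Qed.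

Lemma hom_ofK S T : cancel (@hom_of S T) (@op_of S T).
Proof. by move=> b; apply: represents_op_uniq (op_ofP _) (hom_ofP b). Qed.

Lemma op_ofK S T : cancel (@op_of S T) (@hom_of S T).
Proof. by move=> x; apply: represents_hom_uniq (hom_ofP _) (op_ofP x). Qed.

(** Morphisms are compared heterogeneously, as their types change along the equality of objects. *)
Lemma functor_ext (C D : category) (F G : functor C D) :
  (forall a, F a = G a) ->
  (forall (a b : C) (f : Hom a b), JMeq (fhom F f) (fhom G f)) -> F = G.
Proof.
case: F G => [F0 F1 F2 F3] [G0 G1 G2 G3] /= E0.
have {E0} E : F0 = G0 by apply: functional_extensionality.
subst G0 => E1.
have E : F1 = G1.
  apply: functional_extensionality_dep => a; apply: functional_extensionality_dep => b.
  by apply: functional_extensionality => f; apply: JMeq_eq.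
by subst G1; congr Functor; apply: proof_irrelevance.
Qed.

Lemma nat_trans_JMeq (C D : category) (F F' G G' : functor C D)
    (s : nat_trans F G) (s' : nat_trans F' G') :
  F = F' -> G = G' -> (forall a, JMeq (s a) (s' a)) -> JMeq s s'.
Proof.
move=> EF EG; subst F' G' => E.
have -> : s = s' by apply: nat_trans_eq => a; apply: JMeq_eq.
exact: JMeq_refl.
Qed.

Lemma bimodule03_hom_JMeq (E : category) (A A' B B' : bimodule03 E)
    (f : bimodule03_hom A B) (f' : bimodule03_hom A' B') :
  A = A' -> B = B' -> (forall T, JMeq (f T) (f' T)) -> JMeq f f'.
Proof.
move=> EA EB; subst A' B' => H.
have -> : f = f' by apply: bimodule03_hom_eq => T; apply: JMeq_eq.
exact: JMeq_refl.
Qed.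

Section Isomorphism.
Variable E : category.

Lemma functor_of_1 (A : bimodule03 E) (T : Omega_p) :
  bact A (op_of (idm T)) = idm (A T).
Proof.
have [u uE] := unit_ex T.
by rewrite -(represents_op_uniq (represents_unit uE) (op_ofP _)) (bact_unit A uE).
Qed.

Lemma functor_of_M (A : bimodule03 E) (S T U : Omega_p) (g : Hom T U) (f : Hom S T) :
  bact A (op_of (compm g f)) = compm (bact A (op_of g)) (bact A (op_of f)).
Proof.
have [c cE] := composite_ex (op_of g) (op_of f).
rewrite -(bact_comp A cE); congr (bact A _).
exact: represents_op_uniq (op_ofP _) (represents_comp cE (op_ofP f) (op_ofP g)).
Qed.

Definition functor_of (A : bimodule03 E) : functor Omega_p E :=
  @Functor Omega_p E (bob A) (fun S T x => bact A (op_of x)) (functor_of_1 A)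
    (@functor_of_M A).

Lemma bimodule_of_unit (F : functor Omega_p E) T (u : B03 T T) :
  b03 u = unit_op T -> fhom F (hom_of u : @Hom Omega_p T T) = idm (F T).
Proof. by move=> /represents_unit/(represents_hom_uniq (hom_ofP u)) ->; apply: fhom1.
  Qed.

Lemma bimodule_of_comp (F : functor Omega_p E) S T U (b' : B03 T U) (b : B03 S T)
  (c : B03 S U) :
  is_composite b' b c ->
  fhom F (hom_of c : @Hom Omega_p S U) =
  compm (fhom F (hom_of b' : @Hom Omega_p T U)) (fhom F (hom_of b : @Hom Omega_p S T)).
Proof.
move=> bc; rewrite -fhomM; congr (fhom F _).
exact: represents_hom_uniq (hom_ofP c) (represents_comp bc (hom_ofP b) (hom_ofP b')).
Qed.

Definition bimodule_of (F : functor Omega_p E) : bimodule03 E :=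
  @Bimodule03 E F (fun S T b => fhom F (hom_of b : @Hom Omega_p S T))
    (bimodule_of_unit F) (bimodule_of_comp F).

Lemma bimodule03_eq (ob : ptree -> E) act act' u u' c c' : act = act' ->
  @Bimodule03 E ob act u c = @Bimodule03 E ob act' u' c'.
Proof. by move=> Ea; subst act'; congr Bimodule03; apply: proof_irrelevance. Qed.

Lemma bimodule_ofK (A : bimodule03 E) : bimodule_of (functor_of A) = A.
Proof.
case: A => A act u c; apply: bimodule03_eq.
apply: functional_extensionality_dep => S; apply: functional_extensionality_dep => T.
by apply: functional_extensionality => b; rewrite /= hom_ofK.
Qed.

Lemma functor_ofK (F : functor Omega_p E) : functor_of (bimodule_of F) = F.
Proof.
apply: functor_ext => // S T x /=; rewrite op_ofK; exact: JMeq_refl.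
Qed.

Lemma nat_of_hom (A B : bimodule03 E) (h : bimodule03_hom A B) (S T : Omega_p)
  (x : Hom S T) :
  compm (h T) (fhom (functor_of A) x) = compm (fhom (functor_of B) x) (h S).
Proof. exact: bhom_act. Qed.

Lemma hom_of_nat (F G : functor Omega_p E) (s : nat_trans F G) S T (b : B03 S T) :
  compm (s T) (bact (bimodule_of F) b) = compm (bact (bimodule_of G) b) (s S).
Proof. exact: nnat. Qed.

Definition to_functors : functor (bimodule03_category E) (functor_category Omega_p E).
Proof.
refine (@Functor (bimodule03_category E) (functor_category Omega_p E) functor_of
  (fun A B h => @NatTrans _ _ (functor_of A) (functor_of B) h (nat_of_hom h)) _ _).
- by move=> A; apply: nat_trans_eq.
- by move=> A B C g f; apply: nat_trans_eq.
Defined.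

Definition to_bimodules : functor (functor_category Omega_p E) (bimodule03_category E).
Proof.
refine (@Functor (functor_category Omega_p E) (bimodule03_category E) bimodule_of
  (fun F G s => @Bimodule03Hom _ (bimodule_of F) (bimodule_of G) s
    (@hom_of_nat _ _ s)) _ _).
- by move=> A; apply: bimodule03_hom_eq.
- by move=> A B C g f; apply: bimodule03_hom_eq.
Defined.

Lemma bimodule03_functors_iso :
  isomorphic (bimodule03_category E) (functor_category Omega_p E).
Proof.
exists to_functors, to_bimodules; split.
- apply: functor_ext => [A|A B h]; first exact: bimodule_ofK.
  apply: bimodule03_hom_JMeq => [||T]; [exact: bimodule_ofK|exact: bimodule_ofK|].
  (* The round trip changes no object [A T] and no component up to conversion; only the two
     bimodules indexing the type of [h] change along a propositional equality. *)
  exact: JMeq_refl.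
- apply: functor_ext => [F|F G s]; first exact: functor_ofK.
  apply: nat_trans_JMeq => [||T]; [exact: functor_ofK|exact: functor_ofK|].
  exact: JMeq_refl.
Qed.

End Isomorphism.

Theorem lemma5p9 (E : symmetric_monoidal_category) :
  isomorphic (bimodule03_category E) (functor_category Omega_p E).
Proof. exact: bimodule03_functors_iso. Qed.
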